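(* Let $\alpha,\beta>0$, $a=\frac{1}{1+\alpha}$, $\theta=\frac{\beta}{1+\alpha}$. Let $C_{n,j}$ be the number of blocks of size $j$ in the random partition of $\{1,\dots,n\}$ generated by the Chinese restaurant process with parameters $a,\theta$, and let $X_{n+1,j}$ be the number of branches of size $j$ attached to the root of a random tree of size $n+1$ generated by the growth process of $\mathcal{T}_{\alpha,\beta}$. Then $C_{n,j}$ and $X_{n+1,j}$ have the same distribution. Furthermore, with $\lambda_{n,j}=\frac{n^{1/(\alpha+1)}\binom{j-1-\frac{1}{\alpha+1}}{j-1}}{(\alpha+1)j}$, as $n\to\infty$, for every $s\ge1$, \[ \mathbb{E}\big(X_{n+1,j}^{\underline{s}}\big)=\lambda_{n,j}^s\cdot\frac{\Gamma(s+\beta)\,\Gamma(\frac{\beta}{\alpha+1})}{\Gamma(\beta)\,\Gamma(\frac{\beta+s}{\alpha+1})}\,(1+o(1)), \] i.e. the factorial moments are of mixed Poisson type with a mixing distribution $Z$ supported on $[0,\infty)$ with moments $\mathbb{E}(Z^s)=\frac{\Gamma(s+\beta)\Gamma(\frac{\beta}{\alpha+1})}{\Gamma(\beta)\Gamma(\frac{\beta+s}{\alpha+1})}$. Moreover: (i) if $\lambda_{n,j}\to\infty$, then $X_{n+1,j}/\lambda_{n,j}$ converges in distribution, with convergence of all moments, to $Z$; (ii) if $\lambda_{n,j}\to\rho\in(0,\infty)$, then $X_{n+1,j}$ converges in distribution, with convergence of all moments, to $Y\sim\mathrm{MPo}(\rho Z)$.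
   Context: Chinese restaurant process with parameters $0<a<1$, $\theta>-a$: at time $1$ the partition is $\{\{1\}\}$; given a partition of $\{1,\dots,n\}$ with blocks $t_1,\dots,t_k$, element $n+1$ joins $t_i$ with probability $\frac{|t_i|-a}{n+\theta}$ and forms a new singleton block with probability $\frac{\theta+ka}{n+\theta}$. Growth process of $\mathcal{T}_{\alpha,\beta}$: start with a root labelled $0$; at step $n+1$ ($n\ge0$) the node $n+1$ is attached to a non-root node $v$ with probability $\frac{d(v)+\alpha}{\beta+(\alpha+1)n}$ and to the root with probability $\frac{d(\mathrm{root})+\beta}{\beta+(\alpha+1)n}$, $d(\cdot)$ the current outdegree; a tree of size $n+1$ has labels $0,\dots,n$. A branch of the root is the subtree rooted at a child of the root. $x^{\underline{s}}=x(x-1)\cdots(x-s+1)$. For non-negative $Z$ and $\rho>0$, $Y\sim\mathrm{MPo}(\rho Z)$ means $\mathbb{P}\{Y=\ell\}=\frac{\rho^\ell}{\ell!}\mathbb{E}(Z^\ell e^{-\rho Z})$, $\ell\ge0$. ''Convergence of all moments'' refers to non-negative integer moments.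
   Formalization: The factorial-moment asymptotic is stated for j=j(n)≥1 with j=o(n) (fixed j included; automatic in (i) and (ii)); without this it is false, e.g. for j=n and s=2 the factorial moment is 0. *)

(* Defs.v *)
From HB Require Import structures.
From mathcomp Require Import all_boot all_order all_algebra.
From mathcomp Require Import all_classical all_reals all_analysis.
Set Implicit Arguments. Unset Strict Implicit. Unset Printing Implicit Defensive.
Import Order.TTheory GRing.Theory Num.Theory.
Import numFieldNormedType.Exports.
Local Open Scope classical_set_scope.
Local Open Scope ring_scope.

Section Defs.
Variable R : realType.

(* A finite discrete probability law: list of (outcome, probability) pairs
   (outcomes may repeat; the probability of an outcome is the total weight). *)
Definition fdist (T : Type) := seq (T * R).

Definition fprob (T : Type) (d : fdist T) (E : T -> bool) : R :=
  \sum_(x <- d) (if E x.1 then x.2 else 0).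

Definition fexp (T : Type) (d : fdist T) (g : T -> R) : R :=
  \sum_(x <- d) x.2 * g x.1.

(* ---------- Chinese restaurant process ----------
   A partition of {1,..,n} is a list of blocks (each a list of its elements),
   blocks listed in order of creation. *)
Definition crp_step (a theta : R) (n : nat) (p : seq (seq nat)) (w : R)
  : fdist (seq (seq nat)) :=
  rcons
    [seq (set_nth [::] p i (rcons (nth [::] p i) n.+1),
          w * (((size (nth [::] p i))%:R - a) / (n%:R + theta)))
    | i <- iota 0 (size p)]
    (rcons p [:: n.+1], w * ((theta + (size p)%:R * a) / (n%:R + theta))).

(* crp a theta n : law of the partition of {1,..,n} at time n (n >= 1);
   crp a theta 0 is the (irrelevant) empty partition. *)
Fixpoint crp (a theta : R) (n : nat) : fdist (seq (seq nat)) :=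
  match n with
  | 0 => [:: ([::], 1)]
  | m.+1 =>
    match m with
    | 0 => [:: ([:: [:: 1%N]], 1)]
    | _ => flatten [seq crp_step a theta m x.1 x.2 | x <- crp a theta m]
    end
  end.

Definition crp_C (p : seq (seq nat)) (j : nat) : nat :=
  count (fun b => size b == j) p.

(* ---------- growth process of T_{alpha,beta} ----------
   A tree with labels 0..n (root 0) is encoded by its parent list ps of
   length n: the parent of node i (1 <= i <= n) is nth 0 ps (i-1) < i. *)
Definition parent (ps : seq nat) (v : nat) : nat :=
  if v is u.+1 then nth 0%N ps u else 0%N.

Definition outdeg (ps : seq nat) (v : nat) : nat := count (pred1 v) ps.

Definition tree_step (alpha beta : R) (ps : seq nat) (w : R) : fdist (seq nat) :=
  let n := size ps in
  [seq (rcons ps v,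
        w * (((outdeg ps v)%:R + (if v == 0%N then beta else alpha))
             / (beta + (alpha + 1) * n%:R)))
  | v <- iota 0 n.+1].

(* tree_dist alpha beta n : law of the random tree of size n+1 (labels 0..n) *)
Fixpoint tree_dist (alpha beta : R) (n : nat) : fdist (seq nat) :=
  match n with
  | 0 => [:: ([::], 1)]
  | m.+1 => flatten [seq tree_step alpha beta x.1 x.2 | x <- tree_dist alpha beta m]
  end.

Definition in_subtree (ps : seq nat) (c w : nat) : bool :=
  has (fun k => iter k (parent ps) w == c) (iota 0 w.+1).

Definition subtree_size (ps : seq nat) (c : nat) : nat :=
  count (in_subtree ps c) (iota 1 (size ps)).

Definition root_children (ps : seq nat) : seq nat :=
  [seq c <- iota 1 (size ps) | parent ps c == 0%N].

Definition tree_X (ps : seq nat) (j : nat) : nat :=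
  count (fun c => subtree_size ps c == j) (root_children ps).

Definition ffact (x : R) (s : nat) : R := \prod_(i < s) (x - i%:R).

Definition gbinom (x : R) (k : nat) : R := (\prod_(i < k) (x - i%:R)) / (k`!)%:R.

Definition Gamma (x : R) : R :=
  fine (\int[lebesgue_measure]_(t in `]0%R, +oo[%classic)
          ((t `^ (x - 1)) * expR (- t))%:E).

Definition lambda (alpha : R) (n j : nat) : R :=
  (n%:R `^ (1 / (alpha + 1))) * gbinom (j.-1%:R - 1 / (alpha + 1)) j.-1
  / ((alpha + 1) * j%:R).

Definition Zmom (alpha beta : R) (s : nat) : R :=
  Gamma (s%:R + beta) * Gamma (beta / (alpha + 1))
  / (Gamma beta * Gamma ((beta + s%:R) / (alpha + 1))).

End Defs.

(* Main.v *)
(** Both processes have the same Markov chain of block sizes: in the tree, a branch with m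
    nodes has total attachment weight (m - 1) + alpha m = (1 + alpha)(m - a), and a root with
    k branches has weight k + beta = (1 + alpha)(theta + k a).

    For this chain, the mean of a product of falling factorials of the block counts,
    multiplied by a rising factorial of beta plus the number of blocks, satisfies a closed
    recursion in n with an explicit product solution.  With r(x, n) = x (x + 1) ... (x + n - 1)
    and r(x, n) ~ n! n^(x - 1) / Gamma(x) this gives the asymptotics of the factorial moments,
    hence the limits of all moments of X / lambda when lambda tends to infinity.

    The mixing law is an ultrafilter limit of the laws of X_{n+1,1} / lambda_{n,1}; its
    moments are recovered from layer-cake sums, uniform integrability coming from the next
    moments.  The moments m_s satisfy t^s m_s / s! -> 0 for every t, so Taylor expansion of
    exp(- k x) gives convergence of Laplace transforms, and Bernstein polynomials in exp(- x)
    approximate bounded continuous functions: this is (i).  For (ii), lambda tends to rho and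
    the Bonferroni inequalities give P(X = l) -> P(Y = l), with tails controlled by moments. *)

Require Import Defs.
From HB Require Import structures.
From mathcomp Require Import all_boot all_order all_algebra.
From mathcomp Require Import all_classical all_reals all_analysis.
From mathcomp Require Import measurable_realfun.
From mathcomp Require Import ring lra zify.
Import Order.TTheory GRing.Theory Num.Theory.
Import numFieldNormedType.Exports.
Local Open Scope classical_set_scope.
Local Open Scope ring_scope.
Set Implicit Arguments.
Unset Strict Implicit.
Unset Printing Implicit Defensive.

(** * Block sizes of the two processes *)

(** The equality in law is proved without a coupling: both laws, evaluated on functions of the list
    of block sizes in order of creation, equal the same iterated operator. The moment computation
    closes because theta = beta a: a new block appears with weight theta + k a = a (beta + k), and
    beta + k is exactly the factor that lengthens a rising factorial in the number k of blocks.

    The obstacle after that is that Z is given only by its moments, so a law having them must be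
    produced. It comes from the process itself: the limits of the moments do not depend on the size
    j, so one sequence with lambda tending to infinity suffices. Determinacy by moments is never
    invoked as a theorem; consecutive moments of Z have a ratio of order at most s^(1 - a), less
    than linear, and this makes the exponential series converge and gives convergence directly.

    Finite tree laws, the law of Z and its truncations are handled together as positive normalised
    linear functionals on functions of polynomial growth on the half-line. *)

Section FiniteLaws.
Context {R : realType}.

Lemma fexp_ext (T : Type) (d : fdist R T) (f g : T -> R) :
  f =1 g -> fexp d f = fexp d g.
Proof. by move=> fg; apply: eq_bigr => x _; rewrite fg. Qed.

Lemma fexp_flatten (S T : Type) (d : fdist R S) (k : S -> R -> fdist R T)
    (g : T -> R) :
  fexp (flatten [seq k x.1 x.2 | x <- d]) g = \sum_(x <- d) fexp (k x.1 x.2) g.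
Proof. by rewrite /fexp big_flatten big_map. Qed.

Lemma fprobE (T : Type) (d : fdist R T) (E : T -> bool) :
  fprob d E = fexp d (fun x => (E x)%:R).
Proof. by apply: eq_bigr => x _; case: (E _); rewrite ?mulr1 ?mulr0. Qed.

End FiniteLaws.

Section BlockSizeChain.
Context {R : realType}.
Implicit Types (a theta : R) (n : nat) (g : seq nat -> R) (s : seq nat).

(* The transition operator acting on a function g of the list of block sizes, in order of
   creation; block_exp is the resulting mean of g at time n. *)
Definition block_step a theta n g s : R :=
  \sum_(i < size s) ((nth 0%N s i)%:R - a) / (n%:R + theta) * g (incr_nth s i)
  + (theta + (size s)%:R * a) / (n%:R + theta) * g (rcons s 1%N).

Fixpoint block_exp a theta n g : R :=
  if n is m.+1 then block_exp a theta m (block_step a theta m g) else g [::].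

Lemma sumn_incr_nth s i : sumn (incr_nth s i) = (sumn s).+1.
Proof.
elim: s i => [|x s IH] [|i] //=; last by rewrite IH addnS.
by elim: i.
Qed.

Lemma block_step_ext a theta n g h s :
  (forall t, sumn t = (sumn s).+1 -> all (leq 1) t -> g t = h t) -> all (leq 1) s ->
  block_step a theta n g s = block_step a theta n h s.
Proof.
move=> gh s1; rewrite /block_step; congr (_ + _ * _).
  apply: eq_bigr => i _; congr (_ * _); apply: gh.
    by rewrite sumn_incr_nth.
  elim: s i s1 => [[]//|x s IH] [[|i] ilt] //=; case/andP=> x1 s1; rewrite ?x1 //.
  by rewrite (IH (Ordinal (ilt : (i < size s)%N))) // x1.
apply: gh; first by rewrite sumn_rcons addn1.
by rewrite all_rcons s1.
Qed.

(** Only reachable states matter: at time n the sizes are positive and sum to n. Identities for the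
    transition operator that hold on such lists alone can thus be used under [block_exp]. *)
Lemma eq_block_exp a theta n g h :
  (forall s, sumn s = n -> all (leq 1) s -> g s = h s) ->
  block_exp a theta n g = block_exp a theta n h.
Proof.
elim: n g h => [|n IH] g h gh /=; first exact: gh.
apply: IH => s sn s1; apply: block_step_ext => // t tn t1.
by apply: gh => //; rewrite tn sn.
Qed.

Lemma block_expD a theta n g h :
  block_exp a theta n (fun s => g s + h s) = block_exp a theta n g + block_exp a theta n h.
Proof.
elim: n g h => [//|n IH] g h /=.
rewrite -IH; apply: eq_block_exp => s _ _; rewrite /block_step mulrDr addrACA -big_split/=.
by congr (_ + _); apply: eq_bigr => i _; rewrite mulrDr.
Qed.

Lemma block_expZ a theta n (c : R) g :
  block_exp a theta n (fun s => c * g s) = c * block_exp a theta n g.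
Proof.
elim: n g => [//|n IH] g /=.
rewrite -IH; apply: eq_block_exp => s _ _; rewrite /block_step mulrDr big_distrr/= mulrCA.
by congr (_ + _); apply: eq_bigr => i _; rewrite mulrCA.
Qed.

Lemma block_exp_sum a theta n (I : Type) (r : seq I) (g : I -> seq nat -> R) :
  block_exp a theta n (fun s => \sum_(i <- r) g i s) = \sum_(i <- r) block_exp a theta n (g i).
Proof.
elim: r => [|i r IH].
  rewrite big_nil -[RHS](mul0r (block_exp a theta n (fun=> 0))) -block_expZ.
  by apply: eq_block_exp => s _ _; rewrite big_nil mulr0.
rewrite big_cons -IH -block_expD; apply: eq_block_exp => s _ _.
by rewrite big_cons.
Qed.

End BlockSizeChain.

Section RestaurantSizes.
Context {R : realType}.
Implicit Types (a theta : R) (p : seq (seq nat)).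

Lemma map_size_set_nth p i x : (i < size p)%N ->
  [seq size b | b <- set_nth [::] p i (rcons (nth [::] p i) x)]
  = incr_nth [seq size b | b <- p] i.
Proof.
elim: p i => [|b p IH] [|i] //= ip; first by rewrite size_rcons.
by rewrite IH.
Qed.

Lemma fexp_crp_step a theta n p (w : R) (g : seq nat -> R) :
  fexp (crp_step a theta n p w) (fun q => g [seq size b | b <- q])
  = w * block_step a theta n g [seq size b | b <- p].
Proof.
rewrite /fexp /crp_step big_rcons/= big_map /block_step !size_map map_rcons/=.
rewrite mulrDr big_distrr/=; congr (_ + _); last by rewrite -mulrA.
set r := [seq size b | b <- p].
rewrite -(big_mkord xpredT (fun i => w * (((nth 0%N r i)%:R - a) / (n%:R + theta)
  * g (incr_nth r i)))) /index_iota subn0 /r.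
apply: eq_big_seq => i; rewrite mem_iota add0n => /andP[_ ip].
by rewrite map_size_set_nth // -mulrA (nth_map [::]).
Qed.

Lemma fexp_crp a theta n (g : seq nat -> R) : 0 < theta -> (1 <= n)%N ->
  fexp (crp a theta n) (fun q => g [seq size b | b <- q]) = block_exp a theta n g.
Proof.
move=> th0; elim: n g => [//|[|n] IH] g _.
  (* [crp] starts with one block at time 1, [block_exp] with none at time 0; they agree because the
     first step has probability theta / theta = 1. *)
  rewrite /= /fexp big_seq1 /= /block_step big_ord0 add0r mul0r addr0 add0r.
  by rewrite divff ?gt_eqF.
set m := n.+1; rewrite [LHS](_ : _ = fexp (flatten [seq crp_step a theta m x.1 x.2 | x <- crp a theta m])
   (fun q => g [seq size b | b <- q])) // fexp_flatten.
under eq_bigr do rewrite fexp_crp_step.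
exact: IH.
Qed.

End RestaurantSizes.

(** * Branches of the root, followed node by node *)

Section Branches.
Implicit Types (ps : seq nat) (c u v w : nat).

(** Entry u belongs to node u + 1 and is the root child whose branch contains it. Unlike
    [in_subtree], this table only gains one entry when a node is attached; a child of the root is
    its own label. *)
Definition branch_labels ps : seq nat :=
  foldl (fun acc v => rcons acc (if v is u.+1 then nth 0%N acc u else (size acc).+1))
    [::] ps.

Definition branch_sizes ps : seq nat := [seq subtree_size ps c | c <- root_children ps].

(** The default 0 of [nth] makes the bound trivial beyond the end of the list. *)
Definition is_tree ps := forall u, (nth 0%N ps u <= u)%N.

Lemma size_branch_labels ps : size (branch_labels ps) = size ps.
Proof.
elim/last_ind: ps => [//|ps v IH].
by rewrite /branch_labels foldl_rcons !size_rcons; congr S.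
Qed.

Lemma branch_labels_rcons ps v : branch_labels (rcons ps v) =
  rcons (branch_labels ps) (if v is u.+1 then nth 0%N (branch_labels ps) u else (size ps).+1).
Proof.
rewrite {1}/branch_labels foldl_rcons -/(branch_labels ps).
by case: v => [|//]; rewrite size_branch_labels.
Qed.

Lemma is_tree_rcons ps v : is_tree (rcons ps v) <-> is_tree ps /\ (v <= size ps)%N.
Proof.
split=> [h|[h vn] u].
  split=> [u|]; last by have := h (size ps); rewrite nth_rcons ltnn eqxx.
  have := h u; rewrite nth_rcons; case: (ltnP u (size ps)) => // ?.
  by rewrite nth_default.
by rewrite nth_rcons; case: ltngtP => // ->.
Qed.

Lemma parent_rcons ps v w : (w <= size ps)%N -> parent (rcons ps v) w = parent ps w.
Proof. by case: w => //= u un; rewrite nth_rcons un. Qed.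

(** Each passage to the parent lowers the label until the root is reached, so a positive ancestor of
    w is met in fewer than w + 1 passages and the bounded search in [in_subtree] is complete. *)
Lemma iter_parent_le ps w k : is_tree ps -> (iter k (parent ps) w <= w - k)%N.
Proof.
move=> pst; elim: k => [|k IH] /=; first by rewrite subn0.
case: (iter k _ w) IH => [|u] //= uk.
by apply: (leq_trans (pst u)); lia.
Qed.

Lemma in_subtreeP ps c w : is_tree ps -> (0 < c)%N ->
  reflect (exists k, iter k (parent ps) w = c) (in_subtree ps c w).
Proof.
move=> pst c0; apply: (iffP hasP) => [[k _ /eqP] kc|[k kc]]; first by exists k.
exists k; last exact/eqP.
by have := iter_parent_le w k pst; rewrite mem_iota kc; lia.
Qed.

Lemma nth_branch_labels ps u : is_tree ps -> (u < size ps)%N ->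
  nth 0%N (branch_labels ps) u =
  if nth 0%N ps u is p.+1 then nth 0%N (branch_labels ps) p else u.+1.
Proof.
elim/last_ind: ps => [//|ps v IH] /is_tree_rcons[pst vn].
rewrite size_rcons ltnS leq_eqVlt branch_labels_rcons !nth_rcons size_branch_labels.
case/orP => [/eqP ->|un].
  rewrite ltnn eqxx; case: v vn => [//|p pn].
  by rewrite nth_rcons size_branch_labels pn.
rewrite un IH //; have := pst u; case: (nth _ ps u) => [//|p pu].
by rewrite nth_rcons size_branch_labels (leq_trans pu) // ltnW.
Qed.

(** Strong induction along the chain of parents. If the parent is the root, only the node itself can
    equal c, since the root has no ancestor but itself; otherwise the node differs from c, whose
    parent is the root, and the question passes to the parent. *)
Lemma in_subtree_label ps c w : is_tree ps -> (0 < c)%N -> parent ps c = 0%N ->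
  (w < size ps)%N -> in_subtree ps c w.+1 = (nth 0%N (branch_labels ps) w == c).
Proof.
move=> pst c0 pc; elim/ltn_ind: w => w IH wn.
rewrite nth_branch_labels //.
have inS : in_subtree ps c w.+1 = (w.+1 == c) || in_subtree ps c (nth 0%N ps w).
  apply/(in_subtreeP _ pst c0)/orP => [[[|k]]|[/eqP|/(in_subtreeP _ pst c0) [k kc]]].
  - by move=> <-; left.
  - by rewrite iterSr /= => kc; right; apply/(in_subtreeP _ pst c0); exists k.
  - by exists 0%N.
  - by exists k.+1; rewrite iterSr.
rewrite inS; have := pst w; case E : (nth 0%N ps w) => [|p] pw.
  case: (in_subtreeP 0 pst c0) => [[k kc]|_]; last by rewrite orbF.
  by have := iter_parent_le 0 k pst; rewrite kc sub0n leqNgt c0.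
rewrite -IH //; last by rewrite (leq_trans pw) // ltnW.
suff /negPf -> : w.+1 != c by [].
by apply: contraTneq c0 => wc; move: pc; rewrite -wc /= E.
Qed.

Lemma root_childrenP ps c : c \in root_children ps ->
  [/\ (0 < c)%N, (c <= size ps)%N & parent ps c = 0%N].
Proof.
rewrite mem_filter mem_iota => /andP[/eqP pc /andP[c0 cn]].
by split.
Qed.

Lemma subtree_size_label ps c : is_tree ps -> c \in root_children ps ->
  subtree_size ps c = count_mem c (branch_labels ps).
Proof.
move=> pst /root_childrenP[c0 cn pc]; rewrite /subtree_size.
rewrite -[branch_labels ps](mkseq_nth 0%N) /mkseq size_branch_labels count_map.
rewrite -[1%N]/(1 + 0)%N iotaDl count_map; apply: eq_in_count => w.
by rewrite mem_iota /= add0n add1n => wn; exact: in_subtree_label.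
Qed.

Lemma root_children_rcons ps v : root_children (rcons ps v) =
  if v == 0%N then rcons (root_children ps) (size ps).+1 else root_children ps.
Proof.
rewrite /root_children size_rcons -[X in iota 1 X]addn1 iotaD filter_cat /= add1n.
rewrite nth_rcons ltnn eqxx.
rewrite (_ : [seq c <- iota 1 (size ps) | _] = root_children ps).
  by case: eqP; rewrite ?cats1 ?cats0.
apply: eq_in_filter => c; rewrite mem_iota add1n ltnS => /andP[_ cn].
by rewrite parent_rcons.
Qed.

Lemma uniq_root_children ps : uniq (root_children ps).
Proof. by rewrite filter_uniq // iota_uniq. Qed.

Lemma branch_labels_sub ps w : is_tree ps -> (w < size ps)%N ->
  nth 0%N (branch_labels ps) w \in root_children ps.
Proof.
elim/last_ind: ps w => [//|ps v IH] w /is_tree_rcons[pst vn].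
rewrite size_rcons ltnS leq_eqVlt branch_labels_rcons nth_rcons size_branch_labels.
rewrite root_children_rcons => /orP[/eqP ->|wn].
  rewrite ltnn eqxx; case: v vn => [|p] vn /=; last exact: IH.
  by rewrite mem_rcons mem_head.
by rewrite wn; case: ifP => _; rewrite ?mem_rcons ?inE IH ?orbT.
Qed.

Lemma branch_sizesE ps : is_tree ps ->
  branch_sizes ps = [seq count_mem c (branch_labels ps) | c <- root_children ps].
Proof. by move=> pst; apply/eq_in_map => c cr; exact: subtree_size_label. Qed.

Lemma new_label ps : count_mem (size ps).+1 (branch_labels ps) = 0%N.
Proof.
suff h w : (nth 0%N (branch_labels ps) w <= size ps)%N.
  apply/eqP; rewrite -leqn0 leqNgt -has_count; apply/hasPn => x /(nthP 0%N)[w _ <-].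
  by rewrite /= neq_ltn ltnS h.
elim/last_ind: ps w => [|ps v IH] w; first by rewrite nth_nil.
rewrite branch_labels_rcons nth_rcons size_rcons size_branch_labels.
case: ifP => _; first exact: leqW.
by case: ifP => // _; case: v => [//|p]; exact: leqW.
Qed.

(** Root children are listed by increasing label, that is by date of creation, so a new branch comes
    last, as a new block does in [block_step]. *)
Lemma branch_sizes_rcons0 ps : is_tree ps ->
  branch_sizes (rcons ps 0%N) = rcons (branch_sizes ps) 1%N.
Proof.
move=> pst; rewrite !branch_sizesE //; last exact/is_tree_rcons.
rewrite root_children_rcons /= map_rcons branch_labels_rcons -!cats1 count_cat /=.
rewrite new_label eqxx; congr (_ ++ _); apply/eq_in_map => c /root_childrenP[_ cn _].
by rewrite count_cat /= gtn_eqF //= !addn0.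
Qed.

Lemma branch_sizes_rconsS ps u : is_tree ps -> (u < size ps)%N ->
  branch_sizes (rcons ps u.+1) =
  incr_nth (branch_sizes ps) (index (nth 0%N (branch_labels ps) u) (root_children ps)).
Proof.
move=> pst un; rewrite !branch_sizesE //; last exact/is_tree_rcons.
rewrite root_children_rcons /= branch_labels_rcons.
set b := nth _ _ u; have br : b \in root_children ps by exact: branch_labels_sub.
apply: (@eq_from_nth _ 0%N); first by rewrite size_incr_nth !size_map index_mem br.
move=> i; rewrite size_map => ir.
rewrite nth_incr_nth !(nth_map 0%N) // -cats1 count_cat /= addn0 addnC; congr (_ + _)%N.
rewrite eq_sym; congr nat_of_bool; apply/eqP/eqP => <-.
  by rewrite index_uniq // uniq_root_children.
by rewrite nth_index.
Qed.

End Branches.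

(** * The growth process as the block size chain *)

Section TreeSizes.
Context {R : realType}.
Implicit Types (alpha beta : R) (ps : seq nat) (G : nat -> R) (g : seq nat -> R).

Lemma outdeg_rcons ps u v : outdeg (rcons ps u) v = (outdeg ps v + (u == v))%N.
Proof. by rewrite /outdeg -cats1 count_cat /= addn0. Qed.

Lemma outdeg_new ps : is_tree ps -> outdeg ps (size ps).+1 = 0%N.
Proof.
move=> pst; apply/eqP; rewrite -leqn0 leqNgt -has_count; apply/hasPn => x /(nthP 0%N)[w wn <-].
by rewrite /= neq_ltn ltnS (leq_trans (pst w)) // ltnW.
Qed.

(* A branch with m nodes has m - 1 edges, hence total weight m - 1 + alpha m. *)
Lemma branch_weight alpha ps G : is_tree ps ->
  \sum_(v <- iota 1 (size ps)) ((outdeg ps v)%:R + alpha) * G (nth 0%N (branch_labels ps) v.-1)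
  = \sum_(c <- root_children ps) ((1 + alpha) * (count_mem c (branch_labels ps))%:R - 1) * G c.
Proof.
elim/last_ind: ps => [_|ps u IH] /=; first by rewrite !big_nil.
move=> ut; have /is_tree_rcons[pst un] := ut; have {IH}IH := IH pst.
rewrite size_rcons -[X in iota 1 X]addn1 iotaD big_cat big_seq1 add1n /=.
rewrite outdeg_rcons outdeg_new // add0n.
rewrite branch_labels_rcons nth_rcons size_branch_labels ltnn eqxx root_children_rcons.
have -> : \sum_(v <- iota 1 (size ps)) ((outdeg (rcons ps u) v)%:R + alpha) *
     G (nth 0%N (rcons (branch_labels ps)
          (if u is u0.+1 then nth 0%N (branch_labels ps) u0 else (size ps).+1)) v.-1) =
   \sum_(v <- iota 1 (size ps)) ((outdeg ps v)%:R + alpha) * G (nth 0%N (branch_labels ps) v.-1)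
   + \sum_(v <- iota 1 (size ps)) (u == v)%:R * G (nth 0%N (branch_labels ps) v.-1).
  rewrite -big_split; apply: eq_big_seq => -[|v]; rewrite mem_iota // => /andP[_ vn].
  have {}vn : (v < size ps)%N by [].
  by rewrite nth_rcons size_branch_labels /= vn outdeg_rcons natrD /=; ring.
(* A new child of the root opens a branch of weight (1 + alpha) - 1 = alpha. Any other new node
   brings alpha for itself and 1 for the outdegree of its parent, both to the same branch. *)
rewrite IH; case: u un ut => [|u] un ut /=.
  rewrite big_rcons /= -cats1 count_cat new_label /= eqxx addn0 add0n.
  rewrite [X in _ + X + _]big1_seq ?addr0; last first.
    by move=> [|v]; rewrite mem_iota //= mul0r.
  congr (_ + _ * _); last by rewrite mulr1 addrAC subrr.
  apply: eq_big_seq => c /root_childrenP[_ cn _].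
  by rewrite count_cat /= gtn_eqF //= !addn0.
set b := nth _ _ u; have br : b \in root_children ps by exact: branch_labels_sub.
have -> : \sum_(v <- iota 1 (size ps)) (u.+1 == v)%:R * G (nth 0%N (branch_labels ps) v.-1) = G b.
  rewrite (bigD1_seq u.+1) ?iota_uniq ?mem_iota //= eqxx mul1r big1 ?addr0 // => v vu.
  by rewrite eq_sym (negPf vu) mul0r.
rewrite eqSS (ltn_eqF un) add0r.
under [RHS]eq_bigr do rewrite -cats1 count_cat /= addn0 natrD mulrDr addrAC mulrDl.
rewrite big_split /= -addrA; congr (_ + _).
rewrite (bigD1_seq b) ?uniq_root_children //= eqxx mulr1 big1 ?addr0 => [|c cb].
  by rewrite mulrDl mul1r.
by rewrite eq_sym (negPf cb) mulr0 mul0r.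
Qed.

Lemma outdeg_root ps : outdeg ps 0 = size (root_children ps).
Proof.
elim/last_ind: ps => [//|ps v IH].
rewrite outdeg_rcons root_children_rcons IH; case: eqP => _; last by rewrite addn0.
by rewrite size_rcons addn1.
Qed.

Lemma fexp_tree_step alpha beta ps (w : R) g : 0 < alpha -> 0 < beta -> is_tree ps ->
  fexp (tree_step alpha beta ps w) (fun qs => g (branch_sizes qs))
  = w * block_step (1 / (1 + alpha)) (beta / (1 + alpha)) (size ps) g (branch_sizes ps).
Proof.
move=> al0 be0 pst; rewrite /fexp /tree_step big_map /= big_cons eqxx addrC /=.
rewrite branch_sizes_rcons0 // outdeg_root mulrDr /block_step size_map.
set n := size ps; set rc := root_children ps.
have a1 : 1 + alpha != 0 by rewrite gt_eqF // addr_gt0.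
have DE x : x / (beta + (alpha + 1) * n%:R) = x / (1 + alpha) / (n%:R + beta / (1 + alpha)).
  by rewrite -mulrA -invfM; congr (_ / _); field.
rewrite !DE; congr (_ + _); last first.
  by rewrite -mulrA; congr (_ * (_ / _ * _)); field.
rewrite -[RHS]mulr1; set t := n%:R + _ in DE *.
have t0 : t != 0 by rewrite gt_eqF // ltr_wpDl // divr_gt0 // addr_gt0.
(* The effect of attaching to a node depends only on its branch, so [branch_weight] collapses the
   sum over nodes to a sum over branches. *)
pose G c := g (incr_nth (branch_sizes ps) (index c rc)).
rewrite [LHS](_ : _ = w / (1 + alpha) / t *
  \sum_(v <- iota 1 n) ((outdeg ps v)%:R + alpha) * G (nth 0%N (branch_labels ps) v.-1)).
  rewrite branch_weight // -/rc (big_nth 0%N) big_mkord mulr1 !big_distrr /=.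
  apply: eq_bigr => i _.
  rewrite branch_sizesE // (nth_map 0%N) // /G index_uniq ?uniq_root_children //.
  by rewrite branch_sizesE // !mulrA; congr (_ * g _); field; rewrite a1 t0.
rewrite big_distrr /=; apply: eq_big_seq => -[|v]; rewrite mem_iota //= => vn.
by rewrite branch_sizes_rconsS // DE /G -/rc; ring.
Qed.

Lemma tree_dist_is_tree alpha beta n x : x \in tree_dist alpha beta n ->
  is_tree x.1 /\ size x.1 = n.
Proof.
elim: n x => [|n IH] x /=; first by rewrite inE => /eqP -> /=; split => // -[].
case/flatten_mapP => y /IH[yt yn] /mapP[v]; rewrite mem_iota yn => /andP[_ vn] -> /=.
by rewrite size_rcons yn; split => //; apply/is_tree_rcons; rewrite yn.
Qed.

Lemma fexp_tree alpha beta n g : 0 < alpha -> 0 < beta ->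
  fexp (tree_dist alpha beta n) (fun qs => g (branch_sizes qs))
  = block_exp (1 / (1 + alpha)) (beta / (1 + alpha)) n g.
Proof.
move=> al0 be0; elim: n g => [|n IH] g; first by rewrite /fexp big_seq1 /= mul1r.
rewrite [LHS]fexp_flatten /= -IH; apply: eq_big_seq => x xd.
have [xt xn] := tree_dist_is_tree xd.
by rewrite fexp_tree_step // xn.
Qed.

Lemma tree_XE ps j : tree_X ps j = count_mem j (branch_sizes ps).
Proof. by rewrite /tree_X count_map. Qed.

Lemma crp_CE p j : crp_C p j = count_mem j [seq size b | b <- p].
Proof. by rewrite /crp_C count_map. Qed.

Lemma crp_tree_eq alpha beta n j m : 0 < alpha -> 0 < beta -> (1 <= n)%N ->
  fprob (crp (1 / (1 + alpha)) (beta / (1 + alpha)) n) (fun p => crp_C p j == m)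
  = fprob (tree_dist alpha beta n) (fun t => tree_X t j == m).
Proof.
move=> al0 be0 n1; rewrite !fprobE.
under fexp_ext do rewrite crp_CE.
under [RHS]fexp_ext do rewrite tree_XE.
rewrite (fexp_crp _ (fun s => (count_mem j s == m)%:R)) ?divr_gt0 ?addr_gt0 //.
by rewrite (fexp_tree n (fun s => (count_mem j s == m)%:R)).
Qed.

Lemma tree_dist_ge0 alpha beta n x : 0 < alpha -> 0 < beta ->
  x \in tree_dist alpha beta n -> 0 <= x.2.
Proof.
move=> al0 be0; elim: n x => [|n IH] x /=; first by rewrite inE => /eqP -> /=.
case/flatten_mapP => y /IH y0 /mapP[v _ ->] /=.
rewrite mulr_ge0 // divr_ge0 //; first by case: ifP => _; rewrite addr_ge0 // ltW.
by rewrite addr_ge0 ?mulr_ge0 ?addr_ge0 // ltW.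
Qed.

End TreeSizes.

(** * Factorial moments *)

Section FallingProducts.
Context {R : realType}.
Implicit Types (C : nat -> R) (L s : seq nat) (b l r n : nat).

Definition rising (x : R) n : R := \prod_(i < n) (x + i%:R).

Lemma risingS x n : rising x n.+1 = rising x n * (x + n%:R).
Proof. by rewrite /rising big_ord_recr. Qed.

Lemma risingSl x n : rising x n.+1 = x * rising (x + 1) n.
Proof.
rewrite /rising big_ord_recl addr0; congr (_ * _); apply: eq_bigr => i _.
by rewrite -addrA nat1r.
Qed.

Lemma rising_gt0 x n : 0 < x -> 0 < rising x n.
Proof. by move=> x0; apply: prodr_gt0 => i _; rewrite ltr_pwDl. Qed.

(* For L listing each l with multiplicity m_l this is the product over l of
   the falling factorials C_l (C_l - 1) ... (C_l - m_l + 1). *)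
Fixpoint falling L C : R :=
  if L is l :: L' then (C l - (count_mem l L')%:R) * falling L' C else 1.

Lemma eq_falling L C D : C =1 D -> falling L C = falling L D.
Proof. by move=> CD; elim: L => [//|l L IH] /=; rewrite CD IH. Qed.

Lemma falling_swap l b L C : falling (l :: b :: L) C = falling (b :: l :: L) C.
Proof.
rewrite /=; case: (eqVneq b l) => [-> //|bl].
by rewrite !add0n; ring.
Qed.

Lemma falling_rem b L C : b \in L -> falling L C = falling (b :: rem b L) C.
Proof.
elim: L => [//|l L IH] bL /=; case: (eqVneq l b) => [-> //|lb].
rewrite inE eq_sym (negPf lb) /= in bL.
have -> : count_mem l L = count_mem l (b :: rem b L) by exact/permP/perm_to_rem.
by rewrite IH // -[RHS]falling_swap.
Qed.

(** The rule (x + 1)_m = x_m + m x_(m-1) for falling factorials, applied to the factor of b. *)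
Lemma falling_incr b L C : falling L (fun l => C l + (l == b)%:R)
  = falling L C + (count_mem b L)%:R * falling (rem b L) C.
Proof.
elim: L => [|l L IH] /=; first by rewrite mul0r addr0.
rewrite IH; case: (eqVneq l b) => [->|lb] /=.
  have [bL|/count_memPn ->] := boolP (b \in L); last by rewrite addn0; ring.
  have cb : (count_mem b (rem b L))%:R = (count_mem b L)%:R - 1 :> R.
    by rewrite count_rem bL /= eqxx natrB // -has_count has_pred1.
  by rewrite (falling_rem _ bL) /= cb natrD; ring.
by rewrite add0n addr0 count_rem /= [b == l]eq_sym (negPf lb) andbF subn0; ring.
Qed.

(** The rule x (x - 1)_m = x_(m+1) for the factor of b. *)
Lemma falling_decr b L C :
  C b * falling L (fun l => C l - (l == b)%:R) = falling (b :: L) C.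
Proof.
elim: L => [|l L IH]; first by rewrite /= subr0.
rewrite [RHS]falling_swap [LHS]/= mulrCA IH [RHS]/=; congr (_ * _).
by rewrite [b == l]eq_sym natrD opprD addrA.
Qed.

(** The total effect of one of the [C b] blocks of size b growing to size b + 1: it leaves the count
    of b and enters the count of b + 1. *)
Lemma falling_move b L C :
  C b * falling L (fun l => C l - (l == b)%:R + (l == b.+1)%:R)
  = (C b - (count_mem b L)%:R) * falling L C
    + (count_mem b.+1 L)%:R * falling (b :: rem b.+1 L) C.
Proof.
by rewrite falling_incr mulrDr falling_decr mulrCA falling_decr.
Qed.

(** The last entry of L contributes the factor 0 - 0. *)
Lemma falling0 L : L != [::] -> falling L (fun=> 0) = 0 :> R.
Proof.
elim: L => [//|l [|b L] IH] _; first by rewrite /= !subr0 mul0r.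
by rewrite [LHS]/= [X in _ * X]IH // mulr0.
Qed.

Lemma sum_count s N (f : nat -> R) : all (fun x => 0 < x < N)%N s ->
  \sum_(x <- s) f x = \sum_(1 <= b < N) (count_mem b s)%:R * f b.
Proof.
elim: s => [_|x s IH /= /andP[xN sN]].
  by rewrite big_nil big1 // => b _; rewrite mul0r.
rewrite big_cons IH //.
under [RHS]eq_bigr do rewrite natrD mulrDl.
rewrite big_split /=; congr (_ + _).
rewrite (bigD1_seq x) ?iota_uniq ?mem_index_iota //= eqxx mul1r big1 ?addr0 // => b bx.
by rewrite eq_sym (negPf bx) mul0r.
Qed.

Lemma count_incr_nth s i l : (i < size s)%N ->
  (count_mem l (incr_nth s i))%:R = (count_mem l s)%:R - (l == nth 0%N s i)%:R
     + (l == (nth 0%N s i).+1)%:R :> R.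
Proof.
elim: s i => [//|x s IH] [|i] /= il; last by rewrite natrD IH // !natrD; ring.
by rewrite !natrD [l == _]eq_sym [l == _.+1]eq_sym; ring.
Qed.

Lemma count_rcons s x l :
  (count_mem l (rcons s x))%:R = (count_mem l s)%:R + (l == x)%:R :> R.
Proof. by rewrite -cats1 count_cat natrD /= addn0 [x == l]eq_sym. Qed.

End FallingProducts.

(** * Exact joint factorial moments of the block counts *)

Section BlockMoments.
Context {R : realType}.
Variables (a beta : R).
Hypotheses (a0 : 0 < a) (beta0 : 0 < beta).
Implicit Types (L s : seq nat) (b l r n : nat).

Let theta := beta * a.

(** [a * block_weight l] equals (-1)^(l-1) binom(a, l), the Sibuya probability of l. *)
Definition block_weight l : R := rising (1 - a) l.-1 / (l`!)%:R.

(* The rising factorial in the number of blocks closes the family under the transition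
   operator: in block_step_moment the dependence on the number of blocks cancels. *)
Definition moment_fun L r s : R :=
  rising (beta + (size s)%:R) r * falling L (fun l => (count_mem l s)%:R).

(** For r = 0 this is the count of ordered choices of disjoint sets with sizes in L times the
    probability that all of them are blocks; the remaining n - |L| elements form a restaurant with
    theta raised by a for each chosen block. If n is smaller than |L|, the falling factorial
    vanishes, so the truncated subtraction is harmless. *)
Definition moment_val n L r : R :=
  (n ^_ (sumn L))%:R * a ^+ size L * rising beta (size L + r)
  * (\prod_(l <- L) block_weight l)
  * rising (theta + (size L + r)%:R * a) (n - sumn L) / rising theta n.

Lemma all_lt_sumn s N : all (leq 1) s -> (sumn s < N)%N -> all (fun x => 0 < x < N)%N s.
Proof.
elim: s => [//|x s IH] /= /andP[x1 s1] sN.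
by rewrite x1 IH //= ?(leq_ltn_trans _ sN) ?leq_addr ?leq_addl.
Qed.

(** Joining a block of size b has weight b - a and acts through [falling_move]; opening a block has
    weight a (beta + K), which lengthens the rising factorial by one. The term - K a of the former
    cancels K a in the last factor beta + K + r of the latter. N is a cutoff beyond every size that
    occurs. *)
Lemma block_step_moment n L r s N : all (leq 1) L -> all (leq 1) s ->
  (sumn L < N)%N -> (n < N)%N -> sumn s = n -> (n%:R + theta != 0) ->
  block_step a theta n (moment_fun L r) s =
  (n%:R + theta)^-1 * ((n%:R - (sumn L)%:R + theta + (size L + r)%:R * a) * moment_fun L r s
   + \sum_(1 <= b < N) (b%:R - a) * (count_mem b.+1 L)%:R * moment_fun (b :: rem b.+1 L) r s
   + a * (count_mem 1%N L)%:R * moment_fun (rem 1%N L) r.+1 s).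
Proof.
move=> L1 s1 LN nN sn nth0; pose C l : R := (count_mem l s)%:R.
pose F := falling L C; pose K : R := (size s)%:R.
have sumE t : all (leq 1) t -> (sumn t < N)%N ->
    \sum_(1 <= b < N) (count_mem b t)%:R * (b%:R - a) = (sumn t)%:R - (size t)%:R * a.
  move=> t1 tN; rewrite -(@sum_count _ t N (fun b => b%:R - a)) ?all_lt_sumn //.
  elim: t {t1 tN} => [|x t IH]; first by rewrite big_nil mul0r subr0.
  by rewrite big_cons IH /= natrD -natr1; ring.
have S1 : \sum_(i < size s) ((nth 0%N s i)%:R - a) * falling L (fun l => (count_mem l (incr_nth s i))%:R)
  = (n%:R - K * a - ((sumn L)%:R - (size L)%:R * a)) * F
    + \sum_(1 <= b < N) (b%:R - a) * ((count_mem b.+1 L)%:R * falling (b :: rem b.+1 L) C).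
  pose f b := (b%:R - a) * falling L (fun l => C l - (l == b)%:R + (l == b.+1)%:R).
  transitivity (\sum_(x <- s) f x).
    rewrite (big_nth 0%N) big_mkord; apply: eq_bigr => i _; congr (_ * _).
    by apply: eq_falling => l; rewrite count_incr_nth.
  rewrite (@sum_count _ s N) ?all_lt_sumn ?sn //.
  rewrite -sumE // -sn -sumE ?sn // -sumrB mulr_suml -big_split /=.
  by apply: eq_bigr => b _; rewrite /f mulrCA -/(C b) falling_move -/F /=; ring.
rewrite /block_step /moment_fun.
transitivity ((n%:R + theta)^-1 * (rising (beta + K) r * (\sum_(i < size s)
   ((nth 0%N s i)%:R - a) * falling L (fun l => (count_mem l (incr_nth s i))%:R))
  + a * rising (beta + K) r.+1 * falling L (fun l => C l + (l == 1%N)%:R))).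
  rewrite mulrDr; congr (_ + _).
    rewrite !big_distrr /=; apply: eq_bigr => i _.
    by rewrite size_incr_nth ltn_ord /K; ring.
  rewrite size_rcons risingSl -addrA natr1 /K (eq_falling _ (count_rcons s 1%N)) /theta; ring.
congr (_ * _); rewrite S1 falling_incr -/F risingS.
have -> : \sum_(1 <= b < N) (b%:R - a) * (count_mem b.+1 L)%:R *
     (rising (beta + (size s)%:R) r * falling (b :: rem b.+1 L) (fun l => (count_mem l s)%:R))
  = rising (beta + K) r * \sum_(1 <= b < N) (b%:R - a) * ((count_mem b.+1 L)%:R * falling (b :: rem b.+1 L) C).
  by rewrite big_distrr /=; apply: eq_bigr => b _; rewrite /C /K; ring.
by rewrite natrD /theta /F /C /K; ring.
Qed.

Lemma block_weightS b : (0 < b)%N ->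
  (b%:R - a) * block_weight b = b.+1%:R * block_weight b.+1.
Proof.
case: b => [//|b] _; rewrite /block_weight /= risingS (factS b.+1) natrM.
have : b.+2%:R != 0 :> R by rewrite pnatr_eq0.
have : (b.+1`!)%:R != 0 :> R by rewrite pnatr_eq0 -lt0n fact_gt0.
by rewrite -natr1 => h1 h2; field; rewrite h1 nat1r.
Qed.

(** Induction on time. Apart from the diagonal term, every term of [block_step_moment] lowers the
    sum of L by one and keeps [size L + r], so all are multiples of one quantity [T], and by
    [block_weightS] the multiplicities add up to the sum of L. *)
Lemma block_exp_moment n L r : all (leq 1) L ->
  block_exp a theta n (moment_fun L r) = moment_val n L r.
Proof.
have th0 : 0 < theta by rewrite mulr_gt0.
elim: n L r => [|n IH] L r L1.
  rewrite /= /moment_fun /moment_val /= addr0.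
  case: L L1 => [|l L] L1; first by
    rewrite /= big_nil expr0 ffactn0 !add0n subn0 /rising !big_ord0 divr1 !mulr1 mul1r.
  rewrite [falling _ _](@falling0 _ (l :: L)) //.
  by case: l L1 => // l _; rewrite /= addSn ffactnS /= mul0n !mul0r mulr0.
have nth0 : n%:R + theta != 0 by rewrite gt_eqF // ltr_wpDl.
set N := (n + sumn L).+1.
rewrite /= (@eq_block_exp _ _ _ _ _ (fun s => (n%:R + theta)^-1 *
   ((n%:R - (sumn L)%:R + theta + (size L + r)%:R * a) * moment_fun L r s
   + \sum_(1 <= b < N) (b%:R - a) * (count_mem b.+1 L)%:R * moment_fun (b :: rem b.+1 L) r s
   + a * (count_mem 1%N L)%:R * moment_fun (rem 1%N L) r.+1 s))); last first.
  by move=> s sn s1; rewrite (block_step_moment _ (N := N)) // /N ltnS ?leq_addr ?leq_addl.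
rewrite block_expZ !block_expD !block_expZ block_exp_sum IH //.
pose D := sumn L; pose x := theta + (size L + r)%:R * a.
pose A := a ^+ size L * rising beta (size L + r) * (\prod_(l <- L) block_weight l).
pose T := (n ^_ D.-1)%:R * A * rising x (n - D.-1) / rising theta n.
have E1 b : (0 < b)%N ->
    block_exp a theta n (fun s => (b%:R - a) * (count_mem b.+1 L)%:R * moment_fun (b :: rem b.+1 L) r s)
    = (count_mem b.+1 L)%:R * b.+1%:R * T.
  move=> b0; rewrite block_expZ; have [bL|/count_memPn ->] := boolP (b.+1 \in L); last first.
    by rewrite mulr0 !mul0r.
  have pL := perm_to_rem bL.
  have L1' : all (leq 1) (b :: rem b.+1 L).
    by move: L1; rewrite (perm_all _ pL) /= b0.
  rewrite IH // /moment_val.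
  have -> : size (b :: rem b.+1 L) = size L by rewrite (perm_size pL).
  have -> : sumn (b :: rem b.+1 L) = D.-1 by rewrite /D (perm_sumn pL).
  rewrite /T /A (perm_big _ pL) /= !big_cons -/x.
  transitivity ((count_mem b.+1 L)%:R * ((b%:R - a) * block_weight b) *
     ((n ^_ D.-1)%:R * a ^+ size L * rising beta (size L + r)
     * (\prod_(j <- rem b.+1 L) block_weight j) * rising x (n - D.-1) / rising theta n)); first by ring.
  by rewrite block_weightS //; ring.
have E2 : a * (count_mem 1%N L)%:R * block_exp a theta n (moment_fun (rem 1%N L) r.+1)
    = (count_mem 1%N L)%:R * T.
  have [L1'|/count_memPn ->] := boolP (1%N \in L); last by rewrite mulr0 !mul0r.
  have pL := perm_to_rem L1'.
  have L1'' : all (leq 1) (rem 1%N L) by move: L1; rewrite (perm_all _ pL).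
  have sL : size L = (size (rem 1%N L)).+1 by rewrite (perm_size pL).
  rewrite IH // /moment_val /T /A sL (perm_big _ pL) big_cons /=.
  have -> : sumn (rem 1%N L) = D.-1 by rewrite /D (perm_sumn pL).
  rewrite /x sL addSnnS exprS /block_weight /= /rising big_ord0 divr1; ring.
rewrite E2 (eq_big_nat _ _ (F2 := fun b => (count_mem b.+1 L)%:R * b.+1%:R * T)); last first.
  by move=> b /andP[b0 _]; exact: E1.
have E3 : \sum_(1 <= b < N) (count_mem b.+1 L)%:R * b.+1%:R * T + (count_mem 1%N L)%:R * T = D%:R * T.
  rewrite -mulr_suml -mulrDl; congr (_ * _).
  have LN : all (fun y => 0 < y < N.+1)%N L.
    by apply: all_lt_sumn => //; rewrite /N ltnS leqW // leq_addl.
  have := sum_count (fun b => b%:R : R) LN.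
  rewrite big_ltn // mulr1 big_add1 /= addrC => <-; rewrite /D.
  by elim: (L) => [|y t IHt]; rewrite ?big_nil // big_cons /= natrD IHt.
rewrite -addrA E3 /T /moment_val -/D -/x -/A.
have rn : rising theta n != 0 by rewrite gt_eqF // rising_gt0.
rewrite risingS.
(* After a common rising factorial is taken out this is Pascal's rule for falling factorials, (n +
   1)_D = n_D + D n_(D-1); the cases D > n are degenerate and treated apart. *)
suff E4 : (n%:R - D%:R + x) * (n ^_ D)%:R * rising x (n - D)
      + D%:R * (n ^_ D.-1)%:R * rising x (n - D.-1)
      = (n.+1 ^_ D)%:R * rising x (n.+1 - D).
  transitivity ((n%:R + theta)^-1 * A / rising theta n *
    ((n%:R - D%:R + x) * (n ^_ D)%:R * rising x (n - D)
      + D%:R * (n ^_ D.-1)%:R * rising x (n - D.-1))).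
    by rewrite /A /x; ring.
  rewrite E4 /A; field.
  by rewrite rn addrC nth0.
case: (D) => [|d]; first by rewrite !ffactn0 !subn0 risingS; ring.
rewrite succnK subSS ffactnSr ffactSS !natrM.
case: (ltngtP d n) => [dn|dn|->].
- rewrite natrB ?(ltnW dn) // (_ : n - d = (n - d.+1).+1)%N; last by rewrite subnSK.
  by rewrite risingS natrB // -!natr1; ring.
- by rewrite ffact_small // !(mul0r, mulr0) addr0.
- by rewrite subnn /= mulr0 mulr0 mul0r add0r.
Qed.

End BlockMoments.

Section TreeMoments.
Context {R : realType}.
Implicit Types (alpha beta : R) (j n s : nat).

Lemma falling_nseq s j (C : nat -> R) : falling (nseq s j) C = ffact (C j) s.
Proof.
elim: s => [|s IH]; first by rewrite /ffact big_ord0.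
rewrite /ffact big_ord_recr /= -[\prod_(i < s) _]/(ffact (C j) s) -IH mulrC.
by rewrite count_nseq /= eqxx mul1n.
Qed.

(** The case of s equal entries j and r = 0. *)
Lemma tree_factorial_moment alpha beta n j s : 0 < alpha -> 0 < beta -> (0 < j)%N ->
  let a := 1 / (1 + alpha) in
  fexp (tree_dist alpha beta n) (fun t => ffact (tree_X t j)%:R s)
  = (n ^_ (s * j))%:R * (a * block_weight a j) ^+ s * rising beta s
    * rising (beta * a + s%:R * a) (n - s * j) / rising (beta * a) n.
Proof.
move=> al0 be0 j0 a.
have a0 : 0 < a by rewrite divr_gt0 // addr_gt0.
under fexp_ext do rewrite tree_XE.
rewrite (fexp_tree n (fun t => ffact (count_mem j t)%:R s)) //.
rewrite (_ : beta / (1 + alpha) = beta * a); last by rewrite /a mul1r.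
rewrite (@eq_block_exp _ _ _ _ _ (moment_fun beta (nseq s j) 0)); last first.
  by move=> t _ _; rewrite /moment_fun {1}/rising big_ord0 mul1r falling_nseq.
rewrite block_exp_moment //; last by elim: (s) => //= k ->; rewrite j0.
rewrite /moment_val size_nseq sumn_nseq addn0 [(j * s)%N]mulnC.
by rewrite big_nseq iter_mulr_1 -/a [(a * _) ^+ s]exprMn; ring.
Qed.

(** The upper bound compares the rising factorial of 1 - a with (j - 1)!. It limits how fast j may
    grow while lambda stays away from 0. *)
Lemma block_weight_le (a : R) j : 0 < a < 1 -> (0 < j)%N ->
  0 < block_weight a j <= j%:R^-1.
Proof.
case: j => [//|j] /andP[a0 a1] _; rewrite /block_weight /= factS natrM invfM.
have f0 : 0 < (j`!)%:R :> R by rewrite ltr0n fact_gt0.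
have r0 : 0 < rising (1 - a) j by rewrite rising_gt0 // subr_gt0.
rewrite !mulr_gt0 ?invr_gt0 // mulrCA ger_pMr ?invr_gt0 // ler_pdivrMr // mul1r.
rewrite andTb; elim: (j) => [|k IH]; first by rewrite /rising big_ord0 fact0.
rewrite risingS factS natrM mulrC ler_pM //.
- by rewrite addr_ge0 // subr_ge0 ltW.
- by rewrite ltW // rising_gt0 // subr_gt0.
- by rewrite -nat1r lerD2r lerBlDr lerDl ltW.
Qed.

End TreeMoments.

(** * The Gamma function *)

Section GammaFunction.
Context {R : realType}.
Implicit Types (x y t u : R) (n k : nat).
Local Notation mu := (@lebesgue_measure R).

Definition gamma_fun x u : R := u `^ (x - 1) * expR (- u).

(** Kept in the extended reals so that the functional equation and comparisons precede the proof of
    finiteness. *)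
Definition egamma x : \bar R := (\int[mu]_(u in `]0%R, +oo[) (gamma_fun x u)%:E)%E.

Lemma gamma_fun_ge0 x u : 0 <= gamma_fun x u.
Proof. by rewrite mulr_ge0 ?powR_ge0 ?expR_ge0. Qed.

Lemma measurable_gamma_fun x (D : set R) : measurable_fun D (gamma_fun x).
Proof.
apply: measurable_funTS; apply: measurable_funM; first exact: measurable_powR.
by apply: measurableT_comp => //; exact: measurable_funN.
Qed.

Lemma continuous_gamma_fun x u : 0 < u -> {for u, continuous (gamma_fun x)}.
Proof.
move=> u0; apply: continuousM.
  apply/differentiable_continuous/derivable1_diffP.
  by apply: derivable_powR; rewrite in_itv /= u0.
by apply: continuous_comp; [exact: opp_continuous|exact: continuous_expR].
Qed.

Lemma gamma_fun_cvgy x : gamma_fun x u @[u --> +oo] --> 0.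
Proof.
(* m exceeds x - 1, so u^(x-1) is at most u^m for u at least 1, while exp(u) is at least u^(m+1) /
   (m+1)!. *)
pose m := (Num.bound `|x - 1|).+1.
apply: (@squeeze_cvgr _ _ _ _ (fun=> 0) (fun u => m.+1`!%:R / u)).
- near=> u; rewrite gamma_fun_ge0 /=.
  have u0 : 0 < u by near: u; apply: nbhs_pinfty_gt; exact: num_real.
  have u1 : 1 <= u by near: u; apply: nbhs_pinfty_ge; exact: num_real.
  rewrite ler_pdivlMr // /gamma_fun expRN mulrAC ler_pdivrMr ?expR_gt0 //.
  have := expR_ge1Dxn m (ltW u0) => /(le_trans _) H.
  have /H {}H : u ^+ m.+1 / m.+1`!%:R <= 1 + u ^+ m.+1 / m.+1`!%:R by rewrite lerDr.
  rewrite ler_pdivrMr ?ltr0n ?fact_gt0 // in H.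
  rewrite [_ * _%:R]mulrC in H; apply: le_trans H.
  rewrite exprSr ler_wpM2r ?(ltW u0) // -powR_mulrn ?(ltW u0) // ler_powR //.
  rewrite (le_trans (ler_norm _)) // (le_trans (ltW (archi_boundP (normr_ge0 _)))) //.
  by rewrite ler_nat.
- exact: cvg_cst.
- rewrite -[X in _ --> X](mulr0 (m.+1`!%:R)); apply: cvgM; first exact: cvg_cst.
  by apply/gtr0_cvgV0; [near=> u|exact: cvg_id].
Unshelve. all: by end_near. Qed.

(** Compact intervals exhausting ]0, +oo[. They avoid the singularity at 0; the shift by 2 keeps the
    endpoints distinct. *)
Let I k : set R := `[(k.+2%:R)^-1, k.+2%:R].

Let IltI k : (k.+2%:R)^-1 < k.+2%:R :> R.
Proof.
rewrite (lt_trans (y := 1)) ?ltr1n // invf_lt1 ?ltr0n //.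
by rewrite ltr1n.
Qed.

Let I_gt0 k u : I k u -> 0 < u.
Proof.
by rewrite /I /= in_itv /= => /andP[+ _]; apply: lt_le_trans; rewrite invr_gt0 ltr0n.
Qed.

Let bigcupI : \bigcup_k I k = `]0, +oo[%classic.
Proof.
apply/seteqP; split=> u /=.
  by move=> [k _ /I_gt0 u0]; rewrite in_itv /= u0.
rewrite in_itv /= andbT => u0.
pose k := maxn (Num.bound u) (Num.bound u^-1); exists k => //.
have ku v : 0 < v -> (Num.bound v <= k)%N -> v <= k.+2%:R.
  move=> v0 vk; rewrite (le_trans (ltW (archi_boundP (ltW v0)))) // ler_nat.
  by rewrite (leq_trans vk) // leqW.
rewrite /I /= in_itv /= ku ?leq_maxl // andbT.
by rewrite invf_ple ?posrE ?ltr0n // ku ?leq_maxr // invr_gt0.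
Qed.

Let egamma_cvg x : (\int[mu]_(u in I k) (gamma_fun x u)%:E)%E @[k --> \oo] --> egamma x.
Proof.
rewrite /egamma -bigcupI; apply: ge0_nondecreasing_set_cvg_integral => //.
- move=> m n mn; apply/subsetPset => u; rewrite /I /= !in_itv /= => /andP[mu1 um].
  rewrite (le_trans _ mu1) ?(le_trans um) ?ler_nat //.
  by rewrite lef_pV2 ?posrE ?ltr0n // ler_nat.
- by move=> k; exact: measurable_itv.
- by move=> k; apply/measurable_EFinP; exact: measurable_gamma_fun.
- by move=> k u _; rewrite lee_fin gamma_fun_ge0.
Qed.

Let within_I (f : R -> R) k : (forall u, 0 < u -> {for u, continuous f}) ->
  {within I k, continuous f}.
Proof.
by move=> cf; apply: continuous_in_subspaceT => u /set_mem /I_gt0; exact: cf.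
Qed.

Lemma is_derive_gamma_fun x u : 0 < u ->
  is_derive u 1 (gamma_fun (x + 1)) (x * gamma_fun x u - gamma_fun (x + 1) u).
Proof.
move=> u0; rewrite /gamma_fun addrK.
have := is_derive1_powR x u0 => d1.
have d2 : is_derive u 1 (fun t => expR (- t)) (- expR (- u)).
  by apply: is_derive_eq; rewrite mulrN1.
have := @is_deriveM _ _ _ _ _ _ _ _ d1 d2.
move/is_derive_eq; apply; rewrite /GRing.scale /=; ring.
Qed.

Let gamma_by_parts x k : (0 < x) ->
  (\int[mu]_(u in I k) (gamma_fun (x + 1) u)%:E =
   (gamma_fun (x + 1) (k.+2%:R)^-1 - gamma_fun (x + 1) k.+2%:R)%:E
   + x%:E * \int[mu]_(u in I k) (gamma_fun x u)%:E)%E.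
Proof.
move=> x0.
have cg y : {within I k, continuous (gamma_fun y)}.
  by apply: within_I => u; exact: continuous_gamma_fun.
have ig y : mu.-integrable (I k) (EFin \o gamma_fun y).
  by apply: continuous_compact_integrable => //; exact: segment_compact.
have cv y u : 0 < u -> gamma_fun y t @[t --> u] --> gamma_fun y u.
  by exact: continuous_gamma_fun.
have k0 : 0 < (k.+2%:R : R) by rewrite ltr0n.
have ki0 : 0 < (k.+2%:R : R)^-1 by rewrite invr_gt0.
have H : (\int[mu]_(u in I k) (x * gamma_fun x u - gamma_fun (x + 1) u)%:E =
    (gamma_fun (x + 1) k.+2%:R)%:E - (gamma_fun (x + 1) (k.+2%:R)^-1)%:E)%E.
  apply: continuous_FTC2 => //.
  - apply: within_I => u u0; apply: cvgB; last exact: cv.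
    by apply: cvgM; [exact: cvg_cst|exact: cv].
  - split.
    + move=> u; rewrite in_itv /= => /andP[ku _].
      by apply: ex_derive; exact: (is_derive_gamma_fun x (lt_trans ki0 ku)).
    + by apply: cvg_at_right_filter; exact: cv.
    + by apply: cvg_at_left_filter; exact: cv.
  - move=> u; rewrite in_itv /= => /andP[ku _].
    by rewrite derive1E; apply: derive_val; exact: (is_derive_gamma_fun x (lt_trans ki0 ku)).
have mI : measurable (I k : set (measurableTypeR R)) by exact: measurable_itv.
have xg y : (\int[mu]_(u in I k) (gamma_fun y u)%:E)%E \is a fin_num.
  by apply: integrable_fin_num => //; exact: ig.
have igx : mu.-integrable (I k) (EFin \o (fun u => x * gamma_fun x u)).
  exact: (integrableZl mI x (ig x)).
have : (\int[mu]_(u in I k) (x * gamma_fun x u - gamma_fun (x + 1) u)%:E =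
   x%:E * \int[mu]_(u in I k) (gamma_fun x u)%:E - \int[mu]_(u in I k) (gamma_fun (x + 1) u)%:E)%E.
  rewrite -(integralZl mI (ig x)).
  exact: (integralB_EFin mI igx (ig (x + 1))).
rewrite {}H; have := xg x; have := xg (x + 1).
case: (\int[mu]_(u in I k) (gamma_fun x u)%:E)%E => // v _.
case: (\int[mu]_(u in I k) (gamma_fun (x + 1) u)%:E)%E => // w _ [E].
by congr EFin; rewrite -[RHS](subrK w) -[w in RHS]opprK; nra.
Qed.

Let succ2_cvg : (k.+2%:R : R) @[k --> \oo] --> +oo.
Proof.
under eq_fun do rewrite -addn2.
by apply: (@cvg_comp _ _ _ (addn^~ 2%N) (fun n => n%:R : R)); [exact: cvg_addnr|exact: cvgr_idn].
Qed.

(** Integration by parts on [I k], then k to infinity. The boundary term at the left end vanishes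
    because x > 0, the one at the right by exponential decay. *)
Lemma egammaS x : 0 < x -> (egamma (x + 1) = x%:E * egamma x)%E.
Proof.
move=> x0; have := @egamma_cvg (x + 1).
suff : (\int[mu]_(u in I k) (gamma_fun (x + 1) u)%:E)%E @[k --> \oo] --> (x%:E * egamma x)%E.
  by move=> + h; move: h; exact: cvg_unique.
under eq_fun do rewrite gamma_by_parts //.
rewrite -[(x%:E * egamma x)%E]add0e; apply: cvgeD.
- by rewrite fin_num_adde_defr.
- apply: cvg_EFin; first by apply: nearW.
  rewrite /= -[0](subrr 0); apply: cvgB.
    rewrite /gamma_fun addrK; apply: (@squeeze_cvgr _ _ _ _ (fun=> 0) (fun k => (k.+2%:R^-1) `^ x)).
    + near=> k; rewrite mulr_ge0 ?powR_ge0 ?expR_ge0 //=.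
      by rewrite ler_piMr ?powR_ge0 // expR_le1 oppr_le0 invr_ge0.
    + exact: cvg_cst.
    + have /cvg_at_rightP := powR_cvg0 x0; apply; split; first by move=> n; rewrite invr_gt0.
      by apply/gtr0_cvgV0; [near=> n|exact: succ2_cvg].
  have /cvg_pinftyP := gamma_fun_cvgy (x + 1); apply; exact: succ2_cvg.
- by apply: cvgeZl => //; exact: egamma_cvg.
Unshelve. all: by end_near. Qed.

Lemma egamma_ge0 x : (0 <= egamma x)%E.
Proof. by apply: integral_ge0 => u _; rewrite lee_fin gamma_fun_ge0. Qed.

Lemma egamma1 : (egamma 1 = 1)%E.
Proof.
transitivity (\int[mu]_(u in `]0%R, +oo[) (expR (- u))%:E)%E.
  apply: eq_integral => /=; move=> u /set_mem /=; rewrite in_itv /= andbT => u0.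
  by rewrite /gamma_fun subrr powRr0 mul1r.
rewrite integral_itv_obnd_cbnd; last first.
  by apply/measurable_EFinP; apply: measurable_funTS; apply: measurableT_comp => //; exact: measurable_funN.
rewrite (@ge0_continuous_FTC2y _ _ (fun u => - expR (- u)) _ 0) //.
- by rewrite oppr0 expR0 sub0e EFinN oppeK.
- apply: continuous_subspaceT => u.
  by apply: continuous_comp; [exact: opp_continuous|exact: continuous_expR].
- by rewrite -oppr0; apply: cvgN; exact: cvgr_expR.
- by apply: cvg_at_right_filter; apply: cvgN; apply: continuous_comp; [exact: opp_continuous|exact: continuous_expR].
- move=> u _; rewrite derive1E; apply: derive_val; apply: is_derive_eq.
  by rewrite mulrN1 opprK.
Qed.

Lemma le_egamma x y t (c d : R) : 0 <= c -> 0 <= d ->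
  (forall u, 0 < u -> gamma_fun x u <= c * gamma_fun y u + d * gamma_fun t u) ->
  (egamma x <= c%:E * egamma y + d%:E * egamma t)%E.
Proof.
move=> c0 d0 h.
have mg z : measurable_fun (`]0%R, +oo[%classic : set (measurableTypeR R)) (fun u => (gamma_fun z u)%:E).
  by apply/measurable_EFinP; exact: measurable_gamma_fun.
have pg z u : (`]0%R, +oo[%classic : set R) u -> (0 <= (gamma_fun z u)%:E)%E.
  by rewrite lee_fin gamma_fun_ge0.
have mc z e : measurable_fun (`]0%R, +oo[%classic : set (measurableTypeR R))
    (fun u => (e%:E * (gamma_fun z u)%:E)%E).
  suff : measurable_fun (`]0%R, +oo[%classic : set (measurableTypeR R))
    (EFin \o (fun u => e * gamma_fun z u)) by exact.
  apply/measurable_EFinP; apply: measurable_funM; first exact: measurable_cst.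
  exact: measurable_gamma_fun.
have pc z e u : 0 <= e -> (0 <= e%:E * (gamma_fun z u)%:E)%E.
  by move=> e0; rewrite mule_ge0 // lee_fin gamma_fun_ge0.
rewrite /egamma -!ge0_integralZl_EFin //; try exact: pg; try exact: mg.
rewrite -ge0_integralD //; try exact: mc; try by move=> u _; exact: pc.
apply: ge0_le_integral => //; try exact: pg; try exact: mg.
  by apply: emeasurable_funD; exact: mc.
by move=> u /=; rewrite in_itv /= andbT => u0; rewrite -!EFinM -EFinD lee_fin h.
Qed.

End GammaFunction.

(** * Positivity of Gamma and the Gauss limit formula *)

Section GammaAsymptotics.
Context {R : realType}.
Implicit Types (x y t u v : R) (n k : nat).

Lemma eq_ler x y : x = y -> x <= y.
Proof. by move=> ->. Qed.

Lemma egamma_natS_lty n : (egamma (n.+1%:R : R) < +oo)%E.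
Proof.
elim: n => [|n IH]; first by rewrite egamma1 ltry.
rewrite -natr1 egammaS //; have := egamma_ge0 (n.+1%:R : R).
by case: (egamma _) IH => // r _ _; rewrite -EFinM ltry.
Qed.

(** Passing to x + 1 makes the exponent positive: u^x is at most 1 on ]0, 1] and at most u^n beyond,
    and integer arguments are known. The functional equation brings finiteness back to x. *)
Lemma egamma_fin_num x : 0 < x -> egamma x \is a fin_num.
Proof.
move=> x0; rewrite ge0_fin_numE ?egamma_ge0 //.
suff : (egamma (x + 1) < +oo)%E.
  rewrite egammaS //; have := egamma_ge0 x.
  by case: (egamma x) => [r _ _||//]; rewrite ?ltry // gt0_muley ?lte_fin.
pose n := Num.bound x.
apply: (@le_lt_trans _ _ (1%:E * egamma 1 + 1%:E * egamma n.+1%:R)%E); last first.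
  by rewrite !mul1e egamma1 lte_add_pinfty ?ltry ?egamma_natS_lty.
apply: le_egamma => // u u0.
rewrite !mul1r /gamma_fun -mulrDl ler_wpM2r ?expR_ge0 // addrK subrr powRr0 -natr1 addrK.
have [u1|/ltW u1] := leP u 1.
  rewrite -[leLHS]addr0 lerD ?powR_ge0 //.
  by rewrite -(powRr0 u) ger_powR ?u0 ?u1 // ltW.
rewrite -[leLHS]add0r lerD // ler_powR //.
by rewrite ltW // (archi_boundP (ltW x0)).
Qed.

Lemma GammaE x : Gamma x = fine (egamma x).
Proof. by []. Qed.

Lemma Gamma_ge0 x : 0 <= Gamma x.
Proof. by rewrite GammaE fine_ge0 // egamma_ge0. Qed.

Lemma GammaS x : 0 < x -> Gamma (x + 1) = x * Gamma x.
Proof.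
by move=> x0; rewrite !GammaE egammaS // fineM // egamma_fin_num.
Qed.

Lemma Gamma1 : Gamma (1 : R) = 1.
Proof. by rewrite GammaE egamma1. Qed.

Lemma Gamma_natS n : Gamma (n.+1%:R : R) = n`!%:R.
Proof.
elim: n => [|n IH]; first by rewrite Gamma1.
by rewrite -natr1 GammaS // IH factS natrM.
Qed.

(** Weighted arithmetic-geometric inequality for v and 1: with A the right-hand side, ln z <= z - 1
    is used at v / A and 1 / A, and the weighted sum of the bounds is 0. *)
Lemma powR_le_affine v t : 0 < v -> 0 <= t <= 1 -> v `^ t <= t * v + (1 - t).
Proof.
move=> v0 /andP[t0 t1]; set A := t * v + (1 - t).
have A0 : 0 < A.
  rewrite /A; have [->|tn0] := eqVneq t 0; first by rewrite mul0r add0r subr0.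
  by rewrite ltr_pwDl ?subr_ge0 // mulr_gt0 // lt0r tn0.
have B (z : R) : 0 < z -> ln z <= z - 1.
  by move=> z0; rewrite -[z in ln z](subrK 1) addrC le_ln1Dx // ltrBrDl subrr.
rewrite /powR gt_eqF // -[leRHS]lnK // ler_expR.
have h1 := B _ (divr_gt0 v0 A0); have h2 := B A^-1.
rewrite invr_gt0 in h2; have {}h2 := h2 A0.
rewrite ln_div // in h1; rewrite lnV // in h2.
have E : t * (v / A - 1) + (1 - t) * (A^-1 - 1) = 0.
  transitivity ((t * v + (1 - t)) / A - 1); first by ring.
  by rewrite -/A divff ?gt_eqF // subrr.
have := ler_wpM2l t0 h1; have : 0 <= 1 - t by rewrite subr_ge0.
move=> t1' H1; have H2 := ler_wpM2l t1' h2.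
by have := lerD H1 H2; rewrite E; nra.
Qed.

(** In place of the Hoelder inequality: u^t <= y^t (t u / y + 1 - t) is integrated against the
    density for y, and Gamma (y + 1) = y Gamma y makes the bracket integrate to Gamma y exactly. *)
Lemma Gamma_add_le y t : 0 < y -> 0 <= t <= 1 -> Gamma (y + t) <= y `^ t * Gamma y.
Proof.
move=> y0 t01; have /andP[t0 t1] := t01.
have yt0 : 0 < y + t by rewrite ltr_pwDl.
have : (egamma (y + t) <= (y `^ t * t / y)%:E * egamma (y + 1) + (y `^ t * (1 - t))%:E * egamma y)%E.
  apply: le_egamma; first by rewrite mulr_ge0 ?mulr_ge0 ?powR_ge0 // invr_ge0 ltW.
    by rewrite mulr_ge0 ?powR_ge0 // subr_ge0.
  move=> u u0; rewrite /gamma_fun !mulrA -mulrDl ler_wpM2r ?expR_ge0 //.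
  have -> : y + t - 1 = (y - 1) + t by ring.
  have -> : y + 1 - 1 = (y - 1) + 1 by ring.
  rewrite (@powRD _ u (y - 1) t) ?(@powRD _ u (y - 1) 1) ?(gt_eqF u0) ?implybT //.
  rewrite (powRr1 (ltW u0)).
  have p0 := powR_ge0 u (y - 1).
  suff : u `^ t <= y `^ t * (t * (u / y) + (1 - t)).
    move=> /(ler_wpM2l p0) /le_trans; apply; apply: eq_ler; ring.
  have uy : 0 < u / y by rewrite divr_gt0.
  rewrite -{1}[u](divfK (lt0r_neq0 y0)) powRM ?(ltW uy) ?(ltW y0) // mulrC ler_wpM2l ?powR_ge0 //.
  exact: powR_le_affine.
rewrite egammaS // -(fineK (egamma_fin_num y0)) -(fineK (egamma_fin_num yt0)).
rewrite -!GammaE -!EFinM -EFinD lee_fin => /le_trans; apply; apply: eq_ler.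
by field; rewrite gt_eqF.
Qed.

(** On ]0, 1] the previous inequality with t = 1 - x bounds Gamma 1 = 1 by a multiple of Gamma x;
    larger x follow by the functional equation. *)
Lemma Gamma_gt0 x : 0 < x -> 0 < Gamma x.
Proof.
move=> x0; have : x <= (Num.bound x).+1%:R.
  by rewrite (le_trans (ltW (archi_boundP (ltW x0)))) // ler_nat.
move: (Num.bound x) => n; elim: n x x0 => [|n IH] x x0 xn.
  have := @Gamma_add_le x (1 - x) x0; rewrite subr_ge0 xn lerBlDr lerDl ltW // => /(_ isT).
  rewrite addrC subrK Gamma1; rewrite lt0r Gamma_ge0 andbT.
  by move=> h; apply: contraTneq h => ->; rewrite mulr0 -ltNge.
have [x1|x1] := leP x 1; first by apply: IH => //; rewrite (le_trans x1) // ler1n.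
rewrite -[x](subrK 1) GammaS ?subr_gt0 // mulr_gt0 ?subr_gt0 // IH ?subr_gt0 //.
by rewrite lerBlDr natr1.
Qed.

Lemma Gamma_rising x n : 0 < x -> Gamma (x + n%:R) = rising x n * Gamma x.
Proof.
move=> x0; elim: n => [|n IH]; first by rewrite addr0 /rising big_ord0 mul1r.
by rewrite -natr1 addrA GammaS ?ltr_wpDr // IH risingS; ring.
Qed.

(** Two uses of [Gamma_add_le]: from t + n up to n + 1 for the lower bound, and from n up to n + t
    for the upper one. *)
Lemma rising_Gamma_bounds t n : 0 < t <= 1 -> (0 < n)%N ->
  n%:R / n.+1%:R / Gamma t <= rising t n / (n`!%:R * n%:R `^ (t - 1)) <= (Gamma t)^-1.
Proof.
case: n => [//|n] /andP[t0 t1] _; set N := n.+1.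
have N0 : 0 < N%:R :> R by rewrite ltr0n.
have G0 := Gamma_gt0 t0; have r0 := @rising_gt0 R t N t0.
have f0 : 0 < N`!%:R :> R by rewrite ltr0n fact_gt0.
have p0 : 0 < N%:R `^ (t - 1) :> R by rewrite powR_gt0.
have tN : 0 < t + N%:R by rewrite addr_gt0.
have l1 : 0 <= 1 - t <= 1 by rewrite subr_ge0 t1 lerBlDr lerDl ltW.
have t01 : 0 <= t <= 1 by rewrite ltW.
pose q : R := N%:R `^ (1 - t).
have q0 : 0 < q by rewrite powR_gt0.
have qE : N%:R `^ (t - 1) = q^-1 :> R by rewrite -powRN opprB.
apply/andP; split.
  have := Gamma_add_le tN l1.
  have -> : t + N%:R + (1 - t) = N.+1%:R by rewrite -natr1; ring.
  rewrite Gamma_natS Gamma_rising // qE => h.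
  have pw : (t + N%:R) `^ (1 - t) <= N.+1%:R / N%:R * q.
    rewrite -{1}[t + N%:R](divfK (lt0r_neq0 N0)) powRM ?divr_ge0 ?(ltW tN) ?(ltW N0) // mulrC.
    rewrite mulrC ler_wpM2r ?(ltW q0) //; apply: (@le_trans _ _ ((t + N%:R) / N%:R)).
      rewrite ler1_powR //; last by case/andP: l1.
      by rewrite ler_pdivlMr // mul1r lerDr ltW.
    by rewrite ler_wpM2r ?invr_ge0 ?(ltW N0) // -nat1r lerD2r.
  have {}h : N`!%:R <= N.+1%:R / N%:R * q * (rising t N * Gamma t).
    by rewrite (le_trans h) // ler_wpM2r // mulr_ge0 ?ltW.
  have -> : rising t N / (N`!%:R / q) = (N.+1%:R / N%:R * q * (rising t N * Gamma t))
      / N`!%:R * (N%:R / N.+1%:R / Gamma t).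
    by field; rewrite !lt0r_neq0 // natr1 lt0r_neq0 // ltr0n.
  rewrite ler_peMl; [by []|by rewrite !divr_ge0 // ltW|].
  by rewrite ler_pdivlMr // mul1r.
have := Gamma_add_le N0 t01.
rewrite [N%:R + t]addrC Gamma_rising // Gamma_natS => h.
rewrite ler_pdivrMr ?mulr_gt0 // mulrC ler_pdivlMr // (le_trans h) //.
rewrite -(mulr_powRB1 (ltW N0) t0) factS natrM -/N; apply: eq_ler; ring.
Qed.

(** Gauss's limit for Gamma: a squeeze for x in ]0, 1], then unit steps, each multiplying the ratio
    by (1 + (x - 1) / n) / (x - 1). *)
Lemma rising_Gamma_cvg x : 0 < x ->
  rising x n / (n`!%:R * n%:R `^ (x - 1)) @[n --> \oo] --> (Gamma x)^-1.
Proof.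
move=> x0; have : x <= (Num.bound x).+1%:R.
  by rewrite (le_trans (ltW (archi_boundP (ltW x0)))) // ler_nat.
move: (Num.bound x) => k; elim: k x x0 => [|k IH] x x0 xk.
  apply: (@squeeze_cvgr _ _ _ _ (fun n => n%:R / n.+1%:R / Gamma x) (fun=> (Gamma x)^-1)).
  - near=> n; apply: rising_Gamma_bounds; first by rewrite x0.
    by near: n; exact: nbhs_infty_gt.
  - rewrite -[(Gamma x)^-1 in X in _ --> X]mul1r.
    apply: cvgMr_tmp.
    rewrite (_ : (fun n => _) = (fun n => 1 - harmonic n)).
      by rewrite -[1 in X in _ --> X]subr0; apply: cvgB; [exact: cvg_cst|exact: cvg_harmonic].
    by apply/funext => n; rewrite /harmonic /= -[n.+1%:R]natr1; field; rewrite natr1.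
  - exact: cvg_cst.
have [x1|x1] := leP x 1; first by apply: IH => //; rewrite (le_trans x1) // ler1n.
have y0 : 0 < x - 1 by rewrite subr_gt0.
have {IH} := IH _ y0; rewrite lerBlDr natr1 => /(_ xk) IH.
have -> : (Gamma x)^-1 = (Gamma (x - 1))^-1 * ((1 + (x - 1) * 0) / (x - 1)).
  by rewrite -{1}[x](subrK 1) GammaS // mulr0 addr0 invfM; ring.
have : rising (x - 1) n / (n`!%:R * n%:R `^ (x - 1 - 1)) * ((1 + (x - 1) * (n%:R)^-1) / (x - 1))
    @[n --> \oo] --> (Gamma (x - 1))^-1 * ((1 + (x - 1) * 0) / (x - 1)).
  apply: cvgM => //; apply: cvgMr_tmp; apply: cvgD; first exact: cvg_cst.
  apply: cvgMl_tmp; apply/gtr0_cvgV0; last exact: cvgr_idn.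
  by near=> n; rewrite ltr0n; near: n; exact: nbhs_infty_gt.
apply: cvg_trans; apply: near_eq_cvg; near=> n.
have n0 : 0 < n%:R :> R by rewrite ltr0n; near: n; exact: nbhs_infty_gt.
have rE : rising x n * (x - 1) = rising (x - 1) n * (x - 1 + n%:R).
  by rewrite -risingS risingSl subrK mulrC.
rewrite -(mulr_powRB1 (ltW n0) y0).
have p0 : n%:R `^ (x - 1 - 1) != 0 :> R by rewrite gt_eqF // powR_gt0.
have f0 : n`!%:R != 0 :> R by rewrite gt_eqF // ltr0n fact_gt0.
have -> : rising x n = rising (x - 1) n * (x - 1 + n%:R) / (x - 1).
  by rewrite -rE mulfK // gt_eqF.
by field; rewrite p0 f0 !gt_eqF.
Unshelve. all: by end_near. Qed.

End GammaAsymptotics.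

Section FactorialMomentAsymptotics.
Context {R : realType}.
Variables (alpha beta : R).
Hypotheses (alpha0 : 0 < alpha) (beta0 : 0 < beta).
Implicit Types (j : nat -> nat) (n s : nat).

Let a := 1 / (1 + alpha).

Let a_gt0 : 0 < a. Proof. by rewrite divr_gt0 // addr_gt0. Qed.

Let a_lt1 : a < 1.
Proof. by rewrite ltr_pdivrMr ?addr_gt0 // mul1r ltrDl. Qed.

Lemma lambdaE n k : (0 < k)%N -> lambda alpha n k = n%:R `^ a * (a * block_weight a k).
Proof.
case: k => [//|k] _; rewrite /lambda /block_weight [alpha + 1]addrC -/a /=.
have -> : gbinom (k%:R - a) k = rising (1 - a) k / k`!%:R.
  (* The product defining the binomial, read backwards, is the rising factorial of 1 - a. *)
  congr (_ / _); rewrite (reindex_inj rev_ord_inj) /=; apply: eq_bigr => i _.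
  by rewrite natrB // -natr1; ring.
have k0 : k.+1%:R != 0 :> R by rewrite pnatr_eq0.
have f0 : k`!%:R != 0 :> R by rewrite pnatr_eq0 -lt0n fact_gt0.
rewrite factS natrM -mulrA -mulrA; congr (_ * _); rewrite /a; field.
by rewrite f0 nat1r k0 gt_eqF // addr_gt0.
Qed.

Lemma lambda_gt0 n k : (0 < n)%N -> (0 < k)%N -> 0 < lambda alpha n k.
Proof.
move=> n0 k0; rewrite lambdaE // mulr_gt0 ?powR_gt0 ?ltr0n // mulr_gt0 ?a_gt0 //.
by have /andP[] := @block_weight_le _ a k (introT andP (conj a_gt0 a_lt1)) k0.
Qed.

Lemma invn_powR_cvg0 (b : R) : 0 < b -> (n%:R : R)^-1 `^ b @[n --> \oo] --> 0.
Proof.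
move=> b0; rewrite -(@cvg_shiftS _ (fun n => (n%:R : R)^-1 `^ b)).
have /cvg_at_rightP := powR_cvg0 b0; apply; split; first by move=> n; rewrite invr_gt0.
exact: cvg_harmonic.
Qed.

Lemma lambda_cvgy k : (0 < k)%N -> lambda alpha n k @[n --> \oo] --> +oo.
Proof.
move=> k0.
pose c := a * block_weight a k.
have c0 : 0 < c.
  by rewrite mulr_gt0 //; have /andP[] := @block_weight_le _ a k (introT andP (conj a_gt0 a_lt1)) k0.
apply/(@gtr0_cvgV0 R).
  by near=> n; apply: lambda_gt0 => //; near: n; exact: nbhs_infty_gt.
rewrite -(mul0r c^-1).
have : (n%:R : R)^-1 `^ a * c^-1 @[n --> \oo] --> 0 * c^-1.
  by apply: cvgMr_tmp; exact: invn_powR_cvg0.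
apply: cvg_trans; apply: near_eq_cvg; near=> n.
rewrite /= lambdaE // -/c [RHS]invfM; congr (_ * _).
by rewrite -powR_inv1 // -powRrM mulN1r powRN.
Unshelve. all: by end_near. Qed.

(** By [block_weight_le], lambda is at most a n^a / j, so j is at most (a / c) n^a with a < 1. Both
    limit regimes therefore fall under the asymptotics for j = o(n). *)
Lemma index_small j (c : R) : 0 < c -> (forall n, (1 <= j n)%N) ->
  (\forall n \near \oo, c <= lambda alpha n (j n)) ->
  (j n)%:R / n%:R @[n --> \oo] --> (0 : R).
Proof.
move=> c0 j1 cl.
apply: (@squeeze_cvgr _ _ _ _ (fun=> 0) (fun n => a / c * (n%:R^-1 `^ (1 - a)))).
- near=> n; rewrite divr_ge0 //=.
  have n0 : 0 < n%:R :> R by rewrite ltr0n; near: n; exact: nbhs_infty_gt.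
  have : c <= lambda alpha n (j n) by near: n.
  rewrite lambdaE // => h.
  have /andP[_ w] := @block_weight_le _ a (j n) (introT andP (conj a_gt0 a_lt1)) (j1 n).
  have jn0 : 0 < (j n)%:R :> R by rewrite ltr0n.
  have {}h : c <= n%:R `^ a * (a / (j n)%:R).
    by rewrite (le_trans h) // ler_wpM2l ?powR_ge0 // ler_wpM2l // ltW.
  have -> : n%:R^-1 `^ (1 - a) = n%:R `^ a / n%:R :> R.
    rewrite -powR_inv1 ?(ltW n0) // -powRrM mulN1r opprB powRB; last first.
      by rewrite (gt_eqF n0) implybT.
    by rewrite powR_inv1 ?powRr1 // ltW.
  rewrite mulrA ler_wpM2r ?invr_ge0 ?(ltW n0) //.
  by move: h; rewrite mulrA ler_pdivlMr // mulrC => h; rewrite mulrAC ler_pdivlMr // [leRHS]mulrC.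
- exact: cvg_cst.
- rewrite -(mulr0 (a / c)); apply: cvgMl_tmp; apply: invn_powR_cvg0.
  by rewrite subr_gt0.
Unshelve. all: by end_near. Qed.

(** In the exact formula n_(sj) = n! / N! with N = n - s j. The Gauss limit for both rising
    factorials cancels n! and N!, leaving n^(s a), which belongs to lambda^s, and a power of N / n,
    which tends to 1. *)
Lemma factorial_moment_cvg j s : (forall n, (1 <= j n)%N) ->
  (j n)%:R / n%:R @[n --> \oo] --> (0 : R) ->
  fexp (tree_dist alpha beta n) (fun t => ffact (tree_X t (j n))%:R s) / lambda alpha n (j n) ^+ s
    @[n --> \oo] --> Zmom alpha beta s.
Proof.
move=> j1 jn.
pose th := beta * a; pose x := th + s%:R * a.
have th0 : 0 < th by rewrite mulr_gt0.
have x0 : 0 < x by rewrite ltr_wpDr // mulr_ge0 // ltW.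
pose N n := (n - s * j n)%N.
have sj0 : (s * j n)%:R / n%:R @[n --> \oo] --> (0 : R).
  under eq_fun do rewrite natrM -mulrA.
  by rewrite -(mulr0 s%:R); apply: cvgMl_tmp.
(* Eventually N is at least n / 2: it tends to infinity and the subtraction in it is genuine. *)
have sjn : \forall n \near \oo, (s * j n)%:R <= (2^-1 : R) * n%:R.
  have := sj0 => /cvgrPdist_le /(_ 2^-1); rewrite invr_gt0 ltr0n => /(_ isT) h.
  near=> n; have n0 : 0 < n%:R :> R by rewrite ltr0n; near: n; exact: nbhs_infty_gt.
  rewrite -ler_pdivrMr // -[leLHS]ger0_norm ?divr_ge0 // -normrN -[- _]add0r.
  by near: n.
have Noo : N n @[n --> \oo] --> \oo.
  apply/(@cvgrnyP R); apply/cvgryPge => A; near=> n.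
  have h : (s * j n)%:R <= (2^-1 : R) * n%:R by near: n.
  have n2A : 2 * A <= n%:R by near: n; have /cvgryPge := @cvgr_idn R; apply.
  have le : (s * j n <= n)%N.
    by rewrite -(ler_nat R) (le_trans h) // ler_piMl // invf_le1 ?ler1n.
  by rewrite /N natrB //; lra.
have NnE : \forall n \near \oo, (N n)%:R / n%:R = 1 - (s * j n)%:R / n%:R :> R.
  near=> n; have n0 : 0 < n%:R :> R by rewrite ltr0n; near: n; exact: nbhs_infty_gt.
  have h : (s * j n)%:R <= (2^-1 : R) * n%:R by near: n.
  rewrite /N natrB; first by rewrite mulrBl divff ?gt_eqF.
  by rewrite -(ler_nat R) (le_trans h) // ler_piMl // invf_le1 ?ler1n.
have Nn1 : ((N n)%:R / n%:R) `^ (x - 1) @[n --> \oo] --> (1 : R).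
  suff : ((N n)%:R / n%:R) `^ (x - 1) @[n --> \oo] --> (1 : R) `^ (x - 1) by rewrite powR1.
  apply: (@cvg_comp _ _ _ (fun n => (N n)%:R / n%:R) (fun u => u `^ (x - 1)) _ (nbhs (1 : R))).
    have : 1 - (s * j n)%:R / n%:R @[n --> \oo] --> (1 - 0 : R) by apply: cvgB => //; exact: cvg_cst.
    rewrite subr0; apply: cvg_trans; apply: near_eq_cvg; near=> n.
    by apply/esym; near: n.
  suff : {for (1 : R), continuous (fun u : R => u `^ (x - 1))} by exact.
  apply/differentiable_continuous/derivable1_diffP.
  by apply: derivable_powR; rewrite in_itv /= ltr01.
have ZE : Zmom alpha beta s = rising beta s * (Gamma x)^-1 / (Gamma th)^-1 * 1.
  rewrite /Zmom addrC Gamma_rising // [alpha + 1]addrC.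
  have -> : beta / (1 + alpha) = th by rewrite /th /a mul1r.
  have -> : (beta + s%:R) / (1 + alpha) = x by rewrite /x /th /a; ring.
  by field; rewrite !gt_eqF ?Gamma_gt0.
rewrite ZE.
have : rising beta s * (rising x (N n) / ((N n)`!%:R * (N n)%:R `^ (x - 1)))
   / (rising th n / (n`!%:R * n%:R `^ (th - 1))) * ((N n)%:R / n%:R) `^ (x - 1)
   @[n --> \oo] --> rising beta s * (Gamma x)^-1 / (Gamma th)^-1 * 1.
  apply: cvgM => //; apply: cvgM.
    apply: cvgMl_tmp.
    exact: (cvg_comp N (fun m => rising x m / (m`!%:R * m%:R `^ (x - 1))) Noo (rising_Gamma_cvg x0)).
  apply: cvgV; first by rewrite invr_eq0 gt_eqF // Gamma_gt0.
  exact: rising_Gamma_cvg.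
apply: cvg_trans; apply: near_eq_cvg; near=> n.
have n0' : (0 < n)%N by near: n; exact: nbhs_infty_gt.
have n0 : 0 < n%:R :> R by rewrite ltr0n.
have N0 : 0 < (N n)%:R :> R by rewrite ltr0n; near: n; exact: Noo (nbhs_infty_gt 0).
have sjN : (s * j n <= n)%N by move: N0; rewrite ltr0n subn_gt0 => /ltnW.
have nf0 m : m`!%:R != 0 :> R by rewrite pnatr_eq0 -lt0n fact_gt0.
have fE : (n ^_ (s * j n))%:R = n`!%:R / (N n)`!%:R :> R.
  by rewrite -(ffact_fact sjN) natrM mulfK.
have w0 : a * block_weight a (j n) != 0.
  have /andP[w _] := @block_weight_le _ a (j n) (introT andP (conj a_gt0 a_lt1)) (j1 n).
  by rewrite gt_eqF // mulr_gt0.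
have nx : n%:R `^ (x - 1) = n%:R `^ (th - 1) * (n%:R `^ a) ^+ s :> R.
  rewrite -powR_mulrn ?powR_ge0 // -powRrM -powRD ?(gt_eqF n0) ?implybT //.
  by congr (_ `^ _); rewrite /x; ring.
have Nx : ((N n)%:R / n%:R) `^ (x - 1) = (N n)%:R `^ (x - 1) / n%:R `^ (x - 1) :> R.
  rewrite powRM ?invr_ge0 ?(ltW N0) ?(ltW n0) //; congr (_ * _).
  by rewrite -powR_inv1 ?(ltW n0) // -powRrM mulN1r powRN.
rewrite tree_factorial_moment // -/a lambdaE // fE Nx nx.
have p1 : n%:R `^ (th - 1) != 0 :> R by rewrite gt_eqF // powR_gt0.
have p2 : (n%:R `^ a) ^+ s != 0 :> R by rewrite expf_neq0 // gt_eqF // powR_gt0.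
have p3 : (N n)%:R `^ (x - 1) != 0 :> R by rewrite gt_eqF // powR_gt0.
have p4 : rising th n != 0 by rewrite gt_eqF // rising_gt0.
have p5 : (a * block_weight a (j n)) ^+ s != 0 by rewrite expf_neq0.
rewrite -/th -/x -/(N n) [(n%:R `^ a * _) ^+ s]exprMn.
move: p1 p2 p3 p4 p5 (nf0 n) (nf0 (N n)).
move: (n%:R `^ (th - 1)) ((n%:R `^ a) ^+ s) ((N n)%:R `^ (x - 1)) (rising th n)
  ((a * block_weight a (j n)) ^+ s) (n`!%:R) ((N n)`!%:R) => v1 v2 v3 v4 v5 v6 v7.
by move=> q1 q2 q3 q4 q5 q6 q7; field; rewrite q1 q2 q3 q4 q5 q6 q7.
Unshelve. all: by end_near. Qed.

End FactorialMomentAsymptotics.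

(** * The method of moments *)

Section Expectations.
Context {R : realType}.
Implicit Types (f g : R -> R) (c t x y : R) (k n i : nat).

(** Growth is restricted on the half-line only, where all laws live; this admits exp(- t x) next to
    monomials and tail indicators. *)
Definition moderate f : Prop :=
  measurable_fun [set: R] f /\
  exists c k, forall x, 0 <= x -> `|f x| <= c * (1 + x) ^+ k.

(** Only finite linearity, monotonicity on the half-line and mass 1 are asked, so finite laws and
    integrals share one theory; limits are always controlled by moments. *)
Record is_expectation (E : (R -> R) -> R) : Prop := IsExpectation {
  expectationD : forall f g, moderate f -> moderate g ->
    E (fun x => f x + g x) = E f + E g;
  expectationZ : forall c f, moderate f -> E (fun x => c * f x) = c * E f;
  expectation_le : forall f g, moderate f -> moderate g ->
    (forall x, 0 <= x -> f x <= g x) -> E f <= E g;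
  expectation1 : E (fun=> 1) = 1 }.

Lemma moderate_bounded c f : measurable_fun [set: R] f ->
  (forall x, 0 <= x -> `|f x| <= c) -> moderate f.
Proof.
by move=> mf fc; split=> //; exists c, 0%N => x x0; rewrite expr0 mulr1 fc.
Qed.

Lemma moderate_cst c : moderate (fun=> c).
Proof. by apply: (@moderate_bounded `|c|) => //; exact: measurable_cst. Qed.

Lemma moderateM f g : moderate f -> moderate g -> moderate (fun x => f x * g x).
Proof.
move=> [mf [c [k fc]]] [mg [d [l gd]]]; split; first exact: measurable_funM.
by exists (c * d), (k + l)%N => x x0; rewrite normrM exprD mulrACA ler_pM ?fc ?gd.
Qed.

Lemma moderateZ c f : moderate f -> moderate (fun x => c * f x).
Proof. by move=> mf; apply: moderateM => //; exact: moderate_cst. Qed.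

Lemma moderateD f g : moderate f -> moderate g -> moderate (fun x => f x + g x).
Proof.
move=> [mf [c [k fc]]] [mg [d [l gd]]]; split; first exact: measurable_funD.
have ge0 e h m : (forall x, 0 <= x -> `|h x| <= e * (1 + x) ^+ m) -> 0 <= e.
  by move=> /(_ 0 (lexx _)); rewrite addr0 expr1n mulr1; apply: le_trans.
exists (c + d), (k + l)%N => x x0.
have x1 : 1 <= 1 + x by rewrite lerDl.
rewrite (le_trans (ler_normD _ _)) // mulrDl lerD //.
  by rewrite (le_trans (fc _ x0)) //; apply: ler_wpM2l; [exact: ge0 fc|apply: ler_weXn2l; rewrite ?leq_addr].
by rewrite (le_trans (gd _ x0)) //; apply: ler_wpM2l; [exact: ge0 gd|apply: ler_weXn2l; rewrite ?leq_addl].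
Qed.

Lemma moderateB f g : moderate f -> moderate g -> moderate (fun x => f x - g x).
Proof.
move=> mf mg; have := moderateD mf (moderateZ (-1) mg).
by under eq_fun do rewrite mulN1r.
Qed.

Lemma moderate_sum (I : Type) (r : seq I) (f : I -> R -> R) :
  (forall i : I, moderate (f i)) -> moderate (fun x => \sum_(i <- r) f i x).
Proof.
move=> mf; elim: r => [|i r IH].
  by under eq_fun do rewrite big_nil; exact: moderate_cst.
by under eq_fun do rewrite big_cons; exact: moderateD.
Qed.

Lemma moderateX n : moderate (fun x => x ^+ n).
Proof.
split; first exact: measurable_funX.
exists 1, n => x x0; rewrite mul1r ger0_norm ?exprn_ge0 // lerXn2r ?nnegrE ?addr_ge0 //.
by rewrite lerDr.
Qed.

Lemma moderate_expN t : 0 <= t -> moderate (fun x => expR (- (t * x))).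
Proof.
move=> t0; apply: (@moderate_bounded 1).
  apply: measurableT_comp => //; apply: measurable_funN; exact: measurable_funM.
by move=> x x0; rewrite ger0_norm ?expR_ge0 // expR_le1 oppr_le0 mulr_ge0.
Qed.

Lemma moderate_tail c : moderate (fun x => (c < x)%R%:R).
Proof.
apply: (@moderate_bounded 1); last by move=> x _; rewrite normr_nat lern1 leq_b1.
have -> : (fun x => (c < x)%R%:R) = \1_(`]c, +oo[%classic) :> (R -> R).
  apply/funeqP => x; rewrite indicE; congr (nat_of_bool _)%:R.
  by apply/idP/idP => [cx|/set_mem /=]; [apply/mem_set|]; rewrite /= in_itv /= andbT.
exact: measurable_indic.
Qed.

Lemma moderate_continuous f M : continuous f -> (forall x, `|f x| <= M) -> moderate f.
Proof.
by move=> cf fM; apply: (@moderate_bounded M) => //; exact: continuous_measurable_fun.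
Qed.

Section ExpectationTheory.
Variable E : (R -> R) -> R.
Hypothesis hE : is_expectation E.

Lemma expectation_ext f g : moderate f -> moderate g ->
  (forall x, 0 <= x -> f x = g x) -> E f = E g.
Proof.
move=> mf mg fg; apply/eqP; rewrite eq_le !(expectation_le hE) // => x x0;
by rewrite fg.
Qed.

Lemma expectation_cst c : E (fun=> c) = c.
Proof.
by have := expectationZ hE c (moderate_cst 1); rewrite (expectation1 hE) mulr1.
Qed.

Lemma expectationB f g : moderate f -> moderate g -> E (fun x => f x - g x) = E f - E g.
Proof.
move=> mf mg; have := expectationD hE mf (moderateZ (-1) mg).
by rewrite (expectationZ hE) // mulN1r; under eq_fun do rewrite mulN1r.
Qed.

Lemma expectation_sum (I : Type) (r : seq I) (f : I -> R -> R) :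
  (forall i : I, moderate (f i)) -> E (fun x => \sum_(i <- r) f i x) = \sum_(i <- r) E (f i).
Proof.
move=> mf; elim: r => [|i r IH].
  by under eq_fun do rewrite big_nil; rewrite expectation_cst big_nil.
under eq_fun do rewrite big_cons.
by rewrite (expectationD hE) // ?big_cons ?IH //; exact: moderate_sum.
Qed.

Lemma expectation_norm_le f g : moderate f -> moderate g ->
  (forall x, 0 <= x -> `|f x| <= g x) -> `|E f| <= E g.
Proof.
move=> mf mg fg; rewrite ler_norml; apply/andP; split.
  rewrite -mulN1r -(expectationZ hE) //; apply: (expectation_le hE) => //.
    exact: moderateZ.
  by move=> x x0; have := fg _ x0; rewrite mulN1r ler_norml => /andP[].
apply: (expectation_le hE) => // x x0.
by rewrite (le_trans _ (fg _ x0)) // ler_norm.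
Qed.

Lemma expectation_ge0 f : moderate f -> (forall x, 0 <= x -> 0 <= f x) -> 0 <= E f.
Proof.
by move=> mf f0; rewrite -(expectation_cst 0); apply: (expectation_le hE) => //; exact: moderate_cst.
Qed.

End ExpectationTheory.

Definition exp_taylor I y : R := \sum_(i < I) (- y) ^+ i / i`!%:R.

Lemma is_derive_exprN n x :
  is_derive x 1 (fun y : R => (- y) ^+ n.+1) (- (n.+1%:R * (- x) ^+ n)).
Proof.
have d1 : is_derive x 1 (fun y : R => - y) (-1) by exact: is_deriveN.
elim: n => [|n IH]; first by rewrite expr0 mulr1.
have -> : (fun y : R => (- y) ^+ n.+2) = (fun y => - y) * (fun y => (- y) ^+ n.+1).
  by apply/funeqP => y; rewrite exprS.
apply: (is_derive_eq (is_deriveM d1 IH)).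
by rewrite /GRing.scale /= -[n.+2%:R]natr1 exprS; ring.
Qed.

Lemma is_derive_exp_taylor I x : is_derive x 1 (exp_taylor I.+1) (- exp_taylor I x).
Proof.
elim: I => [|I IH].
  have -> : exp_taylor 1 = cst 1.
    by apply/funeqP => y; rewrite /exp_taylor big_ord1 expr0 fact0 divr1.
  by rewrite /exp_taylor big_ord0 oppr0; exact: is_derive_cst.
have -> : exp_taylor I.+2 = exp_taylor I.+1 + (I.+1`!%:R)^-1 *: (fun y => (- y) ^+ I.+1).
  by apply/funeqP => y; rewrite /exp_taylor big_ord_recr /= mulrC.
apply: (is_derive_eq (is_deriveD IH (is_deriveZ _ (is_derive_exprN I x)))).
rewrite {2}/exp_taylor big_ord_recr /= -/(exp_taylor I x) opprD; congr (_ + _).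
have f0 : I`!%:R != 0 :> R by rewrite pnatr_eq0 -lt0n fact_gt0.
have i0 : I.+1%:R != 0 :> R by rewrite pnatr_eq0.
by rewrite /GRing.scale /= factS natrM; field; rewrite nat1r i0 f0.
Qed.

(* The successive remainders are derivatives of one another up to sign, so by induction
   all of them are monotone on [0, +oo[. *)
Lemma exp_taylor_sign I y : 0 <= y -> 0 <= (-1) ^+ I * (expR (- y) - exp_taylor I y).
Proof.
elim: I y => [|I IH] y y0.
  by rewrite expr0 mul1r /exp_taylor big_ord0 subr0 expR_ge0.
pose P : R -> R := (-1) ^+ I.+1 *: ((fun y => expR (- y)) - exp_taylor I.+1).
have dP x : is_derive x 1 P ((-1) ^+ I * (expR (- x) - exp_taylor I x)).
  have d1 : is_derive x 1 (fun t => expR (- t)) (- expR (- x)).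
    by apply: is_derive_eq; rewrite mulrN1.
  apply: (is_derive_eq (is_deriveZ _ (is_deriveB d1 (is_derive_exp_taylor I x)))).
  rewrite /GRing.scale /= exprS; ring.
have P0 : P 0 = 0.
  rewrite /P /= [LHS](_ : _ = (-1) ^+ I.+1 * (expR (- 0) - exp_taylor I.+1 0)) //.
  rewrite oppr0 expR0 /exp_taylor big_ord_recl expr0 fact0 divr1 big1 ?addr0 ?subrr ?mulr0 // => i _.
  by rewrite oppr0 expr0n mul0r.
suff : P 0 <= P y by rewrite P0.
apply: (@ger0_derive1_ndecry _ P 0) => //.
- move=> x; rewrite in_itv /= andbT => x0; rewrite derive1E; have [_ ->] := dP x.
  by apply: IH; exact: ltW.
- by apply: derivable_within_continuous => x _; have [] := dP x.
Qed.

(** Remainders of consecutive orders have opposite signs, so each is bounded by the first omitted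
    term. *)
Lemma exp_taylor_le I y : 0 <= y -> `|expR (- y) - exp_taylor I y| <= y ^+ I / I`!%:R.
Proof.
move=> y0; have h1 := exp_taylor_sign I y0; have := exp_taylor_sign I.+1 y0.
have -> : `|expR (- y) - exp_taylor I y| = (-1) ^+ I * (expR (- y) - exp_taylor I y).
  by rewrite -[RHS](ger0_norm h1) normrM normrX normrN1 expr1n mul1r.
rewrite {1}/exp_taylor big_ord_recr /= -/(exp_taylor I y) => h2; rewrite -subr_ge0.
apply: (le_trans h2); apply: eq_ler; rewrite [in LHS]exprS.
have -> : y ^+ I = (-1) ^+ I * (- y) ^+ I by rewrite -exprMn mulN1r opprK.
ring.
Qed.

Section Laplace.
Variable E : (R -> R) -> R.
Hypothesis hE : is_expectation E.

Lemma moderateX_expN l t : 0 <= t -> moderate (fun x => x ^+ l * expR (- (t * x))).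
Proof. by move=> t0; apply: moderateM; [exact: moderateX|exact: moderate_expN]. Qed.

(** The factor x^l serves the mixed Poisson probabilities; l = 0 gives Laplace transforms. *)
Lemma expectation_taylor l t I : 0 <= t ->
  `|E (fun x => x ^+ l * expR (- (t * x))) - \sum_(i < I) (- t) ^+ i / i`!%:R * E (fun x => x ^+ (l + i))|
  <= t ^+ I / I`!%:R * E (fun x => x ^+ (l + I)).
Proof.
move=> t0.
have mi (i : 'I_I) : moderate (fun x => (- t) ^+ i / i`!%:R * x ^+ (l + i)).
  by apply: moderateZ; exact: moderateX.
rewrite (eq_bigr (fun i : 'I_I => E (fun x => (- t) ^+ i / i`!%:R * x ^+ (l + i)))); last first.
  by move=> i _; rewrite (expectationZ hE) //; exact: moderateX.
rewrite -(expectation_sum hE) // -(expectationB hE); [|exact: moderateX_expN|exact: moderate_sum].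
rewrite -(expectationZ hE); last exact: moderateX.
apply: (expectation_norm_le hE).
- by apply: moderateB; [exact: moderateX_expN|exact: moderate_sum].
- by apply: moderateZ; exact: moderateX.
move=> x x0.
have -> : \sum_(i < I) (- t) ^+ i / i`!%:R * x ^+ (l + i) = x ^+ l * exp_taylor I (t * x).
  rewrite /exp_taylor mulr_sumr; apply: eq_bigr => i _.
  by rewrite exprD -mulNr exprMn; ring.
rewrite -mulrBr normrM (ger0_norm (exprn_ge0 _ x0)).
rewrite (le_trans (ler_wpM2l (exprn_ge0 l x0) (exp_taylor_le I (mulr_ge0 t0 x0)))) //.
by apply: eq_ler; rewrite exprD exprMn; ring.
Qed.

End Laplace.

End Expectations.

Section WeakConvergence.
Context {R : realType}.
Implicit Types (f g : R -> R) (c t x y u v : R) (k n l s : nat).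

Lemma cvg_approx (a : nat -> R) (L : R) :
  (forall e, 0 < e -> exists b : nat -> R, exists2 w : R, b n @[n --> \oo] --> w &
     `|L - w| <= e /\ \forall n \near \oo, `|a n - b n| <= e) ->
  a n @[n --> \oo] --> L.
Proof.
move=> h; apply/cvgrPdist_le => e e0.
have e3 : 0 < e / 3 by rewrite divr_gt0.
have [b [w bw [Lw ab]]] := h _ e3.
have {}bw := (cvgrPdist_le _ _).1 bw _ e3.
near=> n.
have h1 : `|a n - b n| <= e / 3 by near: n.
have h2 : `|w - b n| <= e / 3 by near: n; exact: bw.
rewrite (_ : L - a n = (L - w) + (w - b n) - (a n - b n)); last by ring.
rewrite (le_trans (ler_normB _ _)) // (le_trans (lerD (ler_normD _ _) h1)) //.
by rewrite (le_trans (lerD (lerD Lw h2) (lexx _))) //; lra.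
Unshelve. all: by end_near. Qed.

Lemma cvg_sum_fin (I : Type) (r : seq I) (a : I -> nat -> R) (L : I -> R) :
  (forall i, a i n @[n --> \oo] --> L i) ->
  \sum_(i <- r) a i n @[n --> \oo] --> \sum_(i <- r) L i.
Proof.
move=> h; elim: r => [|i r IH].
  by rewrite big_nil; under eq_fun do rewrite big_nil; exact: cvg_cst.
by rewrite big_cons; under eq_fun do rewrite big_cons; exact: cvgD.
Qed.

Section MomentMethod.
Variables (E_ : nat -> (R -> R) -> R) (E : (R -> R) -> R) (m : nat -> R).
Hypotheses (hE_ : forall n, is_expectation (E_ n)) (hE : is_expectation E).
Hypothesis mE_ : forall s, E_ n (fun x => x ^+ s) @[n --> \oo] --> m s.
Hypothesis mE : forall s, E (fun x => x ^+ s) = m s.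
Hypothesis m_small : forall l t, 0 <= t -> t ^+ I / I`!%:R * m (l + I)%N @[I --> \oo] --> 0.

(** The order I0 is fixed by the limit moments; since the moment in the remainder converges as well,
    the same order eventually works for every [E_ n]. *)
Lemma laplace_cvg l t : 0 <= t ->
  E_ n (fun x => x ^+ l * expR (- (t * x))) @[n --> \oo] --> E (fun x => x ^+ l * expR (- (t * x))).
Proof.
move=> t0; apply: cvg_approx => e e0.
have /cvgrPdist_lt /(_ _ e0) := m_small l t0.
move=> [I0 _ /(_ I0 (leqnn _))] /=; rewrite sub0r normrN => hI.
exists (fun n => \sum_(i < I0) (- t) ^+ i / i`!%:R * E_ n (fun x => x ^+ (l + i))).
exists (\sum_(i < I0) (- t) ^+ i / i`!%:R * m (l + i)%N).
  by apply: cvg_sum_fin => i; apply: cvgMl_tmp; exact: mE_.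
split.
  under eq_bigr do rewrite -mE.
  rewrite (le_trans (expectation_taylor hE _ _ t0)) // mE.
  by rewrite (le_trans (ler_norm _)) // ltW.
have c : t ^+ I0 / I0`!%:R * E_ n (fun x => x ^+ (l + I0)) @[n --> \oo] --> t ^+ I0 / I0`!%:R * m (l + I0)%N.
  by apply: cvgMl_tmp; exact: mE_.
near=> n; rewrite (le_trans (expectation_taylor (hE_ n) _ _ t0)) // ltW //.
near: n; apply: (cvgr_lt _ c).
by rewrite (le_lt_trans (ler_norm _)).
Unshelve. all: by end_near. Qed.

Lemma moderate_poly_exp (q : {poly R}) : moderate (fun x => q.[expR (- x)]).
Proof.
under eq_fun do rewrite horner_coef.
apply: moderate_sum => i; apply: moderateZ.
under eq_fun do rewrite -expRM_natl mulrN.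
exact: moderate_expN.
Qed.

(** A power of exp(- x) is again an exponential, so this is a finite combination of Laplace
    transforms at integers. *)
Lemma poly_exp_cvg (q : {poly R}) :
  E_ n (fun x => q.[expR (- x)]) @[n --> \oo] --> E (fun x => q.[expR (- x)]).
Proof.
have mk k c : moderate (fun x => c * (x ^+ 0 * expR (- (k%:R * x)))).
  by apply: moderateZ; exact: moderateX_expN.
have Eq F : is_expectation F -> F (fun x => q.[expR (- x)]) =
    \sum_(i < size q) q`_i * F (fun x => x ^+ 0 * expR (- (i%:R * x))).
  move=> hF; rewrite [RHS](eq_bigr (fun i : 'I_(size q) => F (fun x => q`_i * (x ^+ 0 * expR (- (i%:R * x)))))).
    rewrite -(expectation_sum hF) //; congr F; apply/funeqP => x.
    rewrite horner_coef; apply: eq_bigr => i _.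
    by rewrite expr0 mul1r -expRM_natl mulrN.
  by move=> i _; rewrite (expectationZ hF q`_i (moderateX_expN 0 (ler0n _ i))).
rewrite Eq //; under eq_fun do rewrite Eq //.
by apply: cvg_sum_fin => i; apply: cvgMl_tmp; exact: laplace_cvg.
Qed.

End MomentMethod.

(* Recursion on the first of n coin flips: the value at u is the mean of phi at a
   Binomial(n, u) variable. *)
Fixpoint bernstein n (phi : nat -> R) : {poly R} :=
  if n is n'.+1 then
    'X * bernstein n' (fun k => phi k.+1) + (1 - 'X) * bernstein n' phi
  else (phi 0%N)%:P.

Lemma bernsteinS n phi u : (bernstein n.+1 phi).[u] =
  u * (bernstein n (fun k => phi k.+1)).[u] + (1 - u) * (bernstein n phi).[u].
Proof. by rewrite /= !hornerE. Qed.

Lemma bernsteinD n phi psi u : (bernstein n (fun k => phi k + psi k)).[u]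
  = (bernstein n phi).[u] + (bernstein n psi).[u].
Proof.
elim: n phi psi => [|n IH] phi psi; first by rewrite /= !hornerE.
by rewrite !bernsteinS !IH; ring.
Qed.

Lemma bernsteinZ n c phi u : (bernstein n (fun k => c * phi k)).[u]
  = c * (bernstein n phi).[u].
Proof.
elim: n phi => [|n IH] phi; first by rewrite /= !hornerE.
by rewrite !bernsteinS !IH; ring.
Qed.

Lemma bernstein_cst n c u : (bernstein n (fun=> c)).[u] = c.
Proof.
elim: n => [|n IH]; first by rewrite /= !hornerE.
by rewrite !bernsteinS !IH; ring.
Qed.

Lemma bernstein_le n phi psi u : 0 <= u <= 1 -> (forall k, phi k <= psi k) ->
  (bernstein n phi).[u] <= (bernstein n psi).[u].
Proof.
move=> /andP[u0 u1]; elim: n phi psi => [|n IH] phi psi h; first by rewrite /= !hornerE.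
by rewrite !bernsteinS lerD // ler_wpM2l ?subr_ge0 // IH.
Qed.

Lemma bernstein_norm n phi psi u : 0 <= u <= 1 -> (forall k, `|phi k| <= psi k) ->
  `|(bernstein n phi).[u]| <= (bernstein n psi).[u].
Proof.
move=> u01 h; rewrite ler_norml; apply/andP; split.
  rewrite -mulN1r -bernsteinZ; apply: bernstein_le => // k.
  by have := h k; rewrite mulN1r ler_norml => /andP[].
by apply: bernstein_le => // k; rewrite (le_trans _ (h k)) // ler_norm.
Qed.

(** The shift c lets the induction pass: the first flip moves the centring by 1 - u or by - u. *)
Lemma bernstein_variance n u c :
  (bernstein n (fun k => (k%:R - n%:R * u + c) ^+ 2)).[u] = n%:R * (u * (1 - u)) + c ^+ 2.
Proof.
elim: n c => [|n IH] c; first by rewrite /= hornerE !mul0r subrr !add0r.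
rewrite bernsteinS.
under [X in u * (bernstein n X).[u]]eq_fun => k.
  rewrite (_ : _ + c = k%:R - n%:R * u + (c + 1 - u)); last by rewrite -!natr1; ring.
  over.
under [X in (1 - u) * (bernstein n X).[u]]eq_fun => k.
  rewrite (_ : _ + c = k%:R - n%:R * u + (c - u)); last by rewrite -!natr1; ring.
  over.
by rewrite !IH -natr1; ring.
Qed.

(** Only x is confined to the segment: the nodes k / n at which y is taken may lie outside it. *)
Lemma uniform_cont_segment g p q e : (forall x, x \in `[p, q] -> {for x, continuous g}) -> 0 < e ->
  exists2 d, 0 < d & forall x y, x \in `[p, q] -> `|x - y| < d -> `|g x - g y| <= e.
Proof.
move=> cg e0; have := @segment_compact R p q => /compact_near_coveringP.
move=> /(_ R (0^'+) (fun d x => forall y, `|x - y| < d -> `|g x - g y| <= e) _) h.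
have : \forall d \near (0 : R)^'+, `[p, q]%classic `<=` (fun x => forall y, `|x - y| < d -> `|g x - g y| <= e).
  apply: h => x xpq.
  have e2 : 0 < e / 2 by rewrite divr_gt0.
  have : \forall z \near x, `|g x - g z| <= e / 2.
    by have /cvgrPdist_le /(_ _ e2) := cg x xpq.
  move=> /nbhs_ballP [r /= r0 hr].
  have r2 : 0 < r / 2 by rewrite divr_gt0.
  exists (ball x (r / 2), [set d | d < r / 2]).
    split; first exact: nbhsx_ballx.
    exact: nbhs_right_lt.
  move=> [x' d] /= [xx' dr] y x'y.
  have h1 : `|g x - g x'| <= e / 2.
    by apply: hr; apply: lt_le_trans xx' _; lra.
  have h2 : `|g x - g y| <= e / 2.
    apply: hr; rewrite /ball /= (_ : x - y = (x - x') + (x' - y)); last by ring.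
    by rewrite (le_lt_trans (ler_normD _ _)) //; move: xx'; rewrite /ball /=; lra.
  rewrite (_ : g x' - g y = (g x - g y) - (g x - g x')); last by ring.
  by rewrite (le_trans (ler_normB _ _)) //; lra.
move=> H; near (0 : R)^'+ => d; exists d.
  by near: d; exact: nbhs_right_gt.
move=> x y xpq; move: y.
have : `[p, q]%classic `<=` (fun x => forall y, `|x - y| < d -> `|g x - g y| <= e) by near: d.
by apply.
Unshelve. all: by end_near. Qed.

(** In the variable v = exp(- x) the function need not extend continuously to v = 0, so uniform
    approximation is obtained only for x <= B. Beyond, the error is at most 2 M, hence at most 2 M x
    / B, which a first moment controls. The default value of [ln] at the node 0 is harmless because
    f is bounded everywhere. *)
Lemma bernstein_approx f M B e : continuous f -> (forall x, `|f x| <= M) ->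
  0 < M -> 0 < B -> 0 < e ->
  exists q : {poly R}, forall x, 0 <= x -> `|f x - q.[expR (- x)]| <= e + 2 * M / B * x.
Proof.
move=> cf fM M0 B0 e0; pose g v := f (- ln v).
have e2 : 0 < e / 2 by rewrite divr_gt0.
have [d d0 hd] : exists2 d, 0 < d & forall x y, x \in `[expR (- B), 1] ->
    `|x - y| < d -> `|g x - g y| <= e / 2.
  apply: uniform_cont_segment => // v; rewrite in_itv /= => /andP[v0 _].
  have {}v0 : 0 < v by apply: lt_le_trans v0; exact: expR_gt0.
  apply: (@continuous_comp _ _ _ (fun v => - ln v) f); last exact: cf.
  by apply: continuousN; exact: continuous_ln.
(* Makes the Chebyshev term 2 M / (d^2 n) at most e / 2. *)
pose n := (Num.bound (4 * M / (d ^+ 2 * e))).+1.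
have n0 : 0 < n%:R :> R by rewrite ltr0n.
have d20 : 0 < d ^+ 2 by rewrite exprn_gt0.
have nM : 4 * M / (d ^+ 2 * e) <= n%:R.
  rewrite (le_trans (ltW (archi_boundP _))) ?ler_nat //.
  by rewrite divr_ge0 // mulr_ge0 // ltW.
exists (bernstein n (fun k => g (k%:R / n%:R))) => x x0.
set u := expR (- x).
have u01 : 0 <= u <= 1 by rewrite expR_ge0 expR_le1 oppr_le0.
have fu : f x = g u by rewrite /g expRK opprK.
have [xB|/ltW xB] := leP x B; last first.
  have qM : `|(bernstein n (fun k => g (k%:R / n%:R))).[u]| <= M.
    rewrite -[leRHS](bernstein_cst n M u); apply: bernstein_norm => // k.
    exact: fM.
  rewrite (le_trans (ler_normB _ _)) // (le_trans (lerD (fM _) qM)) //.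
  have xB' : 1 <= x / B by rewrite ler_pdivlMr // mul1r.
  have : 2 * M * 1 <= 2 * M * (x / B) by rewrite ler_wpM2l // mulr_ge0 // ltW.
  by rewrite mulr1 => h; rewrite mulrAC -[2 * M * x / B]mulrA; lra.
have uK : u \in `[expR (- B), 1].
  by rewrite in_itv /= ler_expR lerN2 xB; case/andP: u01.
(* With this c the quadratic term is at least 2 M as soon as u and k / n are d apart. *)
pose c := 2 * M / (d ^+ 2 * n%:R ^+ 2).
have c0 : 0 <= c by rewrite divr_ge0 ?mulr_ge0 ?exprn_ge0 // ltW.
have -> : f x - (bernstein n (fun k => g (k%:R / n%:R))).[u] =
    (bernstein n (fun k => g u + -1 * g (k%:R / n%:R))).[u].
  by rewrite bernsteinD bernsteinZ bernstein_cst mulN1r fu.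
have key : `|(bernstein n (fun k => g u + -1 * g (k%:R / n%:R))).[u]| <=
   (bernstein n (fun k => e / 2 + c * (k%:R - n%:R * u + 0) ^+ 2)).[u].
  apply: bernstein_norm => // k; rewrite mulN1r addr0.
  have [ukd|ukd] := ltP `|u - k%:R / n%:R| d.
    by rewrite (le_trans (hd _ _ uK ukd)) // lerDl mulr_ge0 // sqr_ge0.
  rewrite (le_trans (ler_normB _ _)) // (le_trans (lerD (fM _) (fM _))) //.
  have -> : k%:R - n%:R * u = - (n%:R * (u - k%:R / n%:R)).
    by rewrite mulrBr mulrCA divff ?gt_eqF // mulr1 opprB.
  have h : d ^+ 2 <= (u - k%:R / n%:R) ^+ 2.
    by rewrite -[leRHS]real_normK ?num_real // lerXn2r ?nnegrE ?(ltW d0).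
  have -> : c * (- (n%:R * (u - k%:R / n%:R))) ^+ 2 = 2 * M * ((u - k%:R / n%:R) ^+ 2 / d ^+ 2).
    by rewrite /c sqrrN exprMn; field; rewrite !gt_eqF.
  have : 2 * M * 1 <= 2 * M * ((u - k%:R / n%:R) ^+ 2 / d ^+ 2).
    by rewrite ler_wpM2l ?mulr_ge0 ?(ltW M0) // ler_pdivlMr // mul1r.
  by rewrite mulr1 => h2; lra.
rewrite (le_trans key) // bernsteinD bernstein_cst bernsteinZ bernstein_variance expr0n addr0.
have xB0 : 0 <= 2 * M / B * x by rewrite mulr_ge0 // divr_ge0 ?mulr_ge0 // ltW.
suff : c * (n%:R * (u * (1 - u))) <= e / 2 by lra.
have uu : u * (1 - u) <= 1.
  by case/andP: u01 => ? ?; rewrite mulr_ile1 // ?subr_ge0 // lerBlDr lerDl.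
rewrite (@le_trans _ _ (c * (n%:R * 1))) //; first by rewrite !ler_wpM2l // ltW.
rewrite (_ : c * (n%:R * 1) = 2 * M / d ^+ 2 / n%:R); last by rewrite /c; field; rewrite !gt_eqF.
rewrite ler_pdivrMr // -ler_pdivrMl //.
by apply: le_trans nM; apply: eq_ler; field; rewrite !gt_eqF.
Qed.

Section MomentMethod.
Variables (E_ : nat -> (R -> R) -> R) (E : (R -> R) -> R) (m : nat -> R).
Hypotheses (hE_ : forall n, is_expectation (E_ n)) (hE : is_expectation E).
Hypothesis mE_ : forall s, E_ n (fun x => x ^+ s) @[n --> \oo] --> m s.
Hypothesis mE : forall s, E (fun x => x ^+ s) = m s.
Hypothesis m_small : forall l t, 0 <= t -> t ^+ I / I`!%:R * m (l + I)%N @[I --> \oo] --> 0.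

(** One polynomial in exp(- x) approximates f with the same error e under every expectation whose
    first moment is at most [m 1 + 1], which includes the limit and almost all [E_ n]. *)
Lemma moment_method f M : continuous f -> (forall x, `|f x| <= M) ->
  E_ n f @[n --> \oo] --> E f.
Proof.
move=> cf fM; pose M1 := M + 1.
have M0 : 0 <= M by rewrite (le_trans _ (fM 0)).
have M10 : 0 < M1 by rewrite ltr_wpDl.
have fM1 x : `|f x| <= M1 by rewrite (le_trans (fM x)) // lerDl.
have mX : moderate (fun x : R => x) by exact: (moderateX 1).
have m1E : E (fun x => x) = m 1%N by rewrite -mE.
have m1E_ : E_ n (fun x => x) @[n --> \oo] --> m 1%N.
  by exact: (@mE_ 1%N).
have m10 : 0 <= m 1%N by rewrite -m1E; apply: (expectation_ge0 hE).
have mf : moderate f by exact: moderate_continuous fM.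
apply: cvg_approx => e e0.
have e2 : 0 < e / 2 by rewrite divr_gt0.
(* Chosen so that the linear error term is e / 2 at first moment [m 1 + 1]. *)
pose B := 2 * M1 * (m 1%N + 1) / (e / 2).
have B0 : 0 < B by rewrite divr_gt0 // mulr_gt0 ?mulr_gt0 // ltr_wpDl.
have [q qf] := bernstein_approx cf fM1 M10 B0 e2.
have mq := moderate_poly_exp q.
have bound F : is_expectation F -> F (fun x => x) <= m 1%N + 1 ->
    `|F f - F (fun x => q.[expR (- x)])| <= e.
  move=> hF Fx; rewrite -(expectationB hF) //.
  have mb : moderate (fun x => e / 2 + 2 * M1 / B * x).
    by apply: moderateD; [exact: moderate_cst|exact: moderateZ].
  rewrite (le_trans (expectation_norm_le hF _ mb qf)) //; first exact: moderateB.
  rewrite (expectationD hF) ?(expectation_cst hF) ?(expectationZ hF) //; last 2 first.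
    exact: moderate_cst.
    exact: moderateZ.
  have : 2 * M1 / B * F (fun x => x) <= 2 * M1 / B * (m 1%N + 1).
    by rewrite ler_wpM2l // divr_ge0 ?(ltW B0) // mulr_ge0 // ltW.
  have -> : 2 * M1 / B * (m 1%N + 1) = e / 2.
    rewrite /B; field; rewrite !gt_eqF // ltr_wpDl //.
  by lra.
exists (fun n => E_ n (fun x => q.[expR (- x)])), (E (fun x => q.[expR (- x)])).
  exact: (poly_exp_cvg hE_ hE mE_ mE m_small).
split; first by apply: bound => //; rewrite m1E lerDl.
near=> n; apply: bound => //; apply: ltW.
by near: n; apply: (cvgr_lt _ m1E_); rewrite ltrDl.
Unshelve. all: by end_near. Qed.

End MomentMethod.

End WeakConvergence.

(** * The mixing distribution *)

Section ProbabilityFromCdf.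
Context {R : realType}.
Local Open Scope measure_display_scope.

Lemma probability_of_cdf (F : R -> R) :
  {homo F : x y / x <= y} -> (forall x, F @ at_right x --> F x) ->
  F @ -oo --> (0 : R) -> F @ +oo --> (1 : R) ->
  exists P : probability R R, forall c, P `]-oo, c]%classic = (F c)%:E.
Proof.
move=> Fnd Frc F0 F1.
pose G0 := F.
pose cF := HB.pack_for (cumulativeBounded (0 : R) (1 : R)) G0
  (isCumulative.Build R _ R G0 Fnd Frc) (isCumulativeBounded.Build R 0 1 G0 F0 F1).
(* The Lebesgue-Stieltjes measure lives on another copy of the real line; its image under the
   identity is a law on [R]. *)
pose lsf : probability (measurableTypeR R) R := lebesgue_stieltjes_measure (cF : cumulativeBounded (0 : R) (1 : R)).
pose idTR : measurableTypeR R -> R := idfun.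
pose X : {mfun measurableTypeR R >-> R} := HB.pack_for {mfun measurableTypeR R >-> R} idTR
  (@isMeasurableFun.Build _ _ _ _ idTR (@measurable_id _ _ setT)).
exists (distribution lsf X) => c.
exact: (@cdf_lebesgue_stieltjes_id R cF c).
Qed.

End ProbabilityFromCdf.

Section LayerCake.
Context {R : realType}.
Implicit Types (v h : R) (N : nat).

(** Counting the levels h, ..., N h below v is a lower Riemann sum for the truncated value;
    [layer_upper] uses the levels 0, ..., (N - 1) h. *)
Lemma layer_lower v h N : 0 <= v -> 0 <= h ->
  h * (\sum_(i < N) ((i.+1)%:R * h < v)%R%:R) <= Num.min v (N%:R * h).
Proof.
move=> v0 h0; elim: N => [|N IH]; first by rewrite big_ord0 mulr0 mul0r le_min v0 lexx.
rewrite big_ord_recr /= mulrDr; move: IH; rewrite !le_min => /andP[h1 h2].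
have [hv|hv] := ltP (N.+1%:R * h) v; last first.
  by rewrite mulr0 addr0 h1 (le_trans h2) // ler_wpM2r // ler_nat.
have h3 : h * \sum_(i < N) ((i.+1)%:R * h < v)%R%:R + h * 1 <= N.+1%:R * h.
  by rewrite -natr1 mulrDl mul1r mulr1 lerD2r.
by rewrite h3 (le_trans h3 (ltW hv)).
Qed.

Lemma layer_upper v h N : 0 <= v -> 0 <= h ->
  Num.min v (N%:R * h) <= h * (\sum_(i < N) (i%:R * h < v)%R%:R).
Proof.
move=> v0 h0; elim: N => [|N IH]; first by rewrite big_ord0 mulr0 mul0r ge_min lexx orbT.
rewrite big_ord_recr /= mulrDr.
have [hv|hv] := ltP (N%:R * h) v; last first.
  by rewrite mulr0 addr0 (le_trans _ IH) // le_min !ge_min lexx hv.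
move: IH; rewrite (min_idPr (ltW hv)) mulr1 => IH.
by rewrite ge_min -natr1 mulrDl mul1r lerD2r IH orbT.
Qed.

End LayerCake.

Section UltrafilterLimits.
Context {R : realType} {T : Type} (U : set_system T) {UU : UltraFilter U}.

(** The limit is the supremum of the thresholds exceeded on a set of U; the ultrafilter decides
    every threshold. *)
Lemma ultra_bounded_cvg (a : T -> R) (B C : R) : (forall n, B <= a n <= C) ->
  exists2 l, B <= l <= C & a n @[n --> U] --> l.
Proof.
move=> aB; pose S := [set y | U [set n | y <= a n]].
have SB : S B by apply: filterS filterT => n _ /=; case/andP: (aB n).
have Sub : ubound S C.
  move=> y Sy; have [n /= yn] := filter_ex Sy.
  by rewrite (le_trans yn) //; case/andP: (aB n).
have hS : has_sup S by split; [exists B|exists C].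
exists (sup S); first by rewrite (ub_le_sup hS.2 SB) ge_sup //; exists B.
apply/cvgrPdist_le => e e0.
have [y Sy ye] := sup_adherent e0 hS.
have nS : ~ S (sup S + e).
  by move=> h; have := ub_le_sup hS.2 h; rewrite gerDl leNgt e0.
have [//|nSU] := in_ultra_setVsetC [set n | sup S + e <= a n] UU.
near=> n.
have h1 : y <= a n by near: n.
have h2 : ~ (sup S + e <= a n) by near: n.
have {}h2 : a n < sup S + e by rewrite ltNge; apply/negP.
by rewrite ler_norml; apply/andP; split; lra.
Unshelve. all: by end_near. Qed.

End UltrafilterLimits.

Section MomentLimit.
Context {R : realType}.
Implicit Types (f g : R -> R) (c h x y : R) (n s N : nat).
Local Notation D := (`[0%R, +oo[%classic : set R).

Section LimitLaw.
Variables (E_ : nat -> (R -> R) -> R) (m : nat -> R).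
Hypothesis hE_ : forall n, is_expectation (E_ n).
Hypothesis mE_ : forall s, E_ n (fun x => x ^+ s) @[n --> \oo] --> m s.

Let tail n c := E_ n (fun x => (c < x)%R%:R).

Let tail01 n c : 0 <= tail n c <= 1.
Proof.
apply/andP; split; first by apply: expectation_ge0 => //; exact: moderate_tail.
rewrite -(expectation_cst (hE_ n) 1); apply: (expectation_le (hE_ n)).
- exact: moderate_tail.
- exact: moderate_cst.
- by move=> x _; rewrite lern1 leq_b1.
Qed.

Let tail_le n c d : c <= d -> tail n d <= tail n c.
Proof.
move=> cd; apply: (expectation_le (hE_ n)); try exact: moderate_tail.
move=> x _; rewrite ler_nat; case: (ltP d x) => //= dx.
by rewrite (le_lt_trans cd dx).
Qed.

Let tail_neg n c : c < 0 -> tail n c = 1.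
Proof.
move=> c0; rewrite -(expectation_cst (hE_ n) 1); apply: (expectation_ext (hE_ n)).
- exact: moderate_tail.
- exact: moderate_cst.
- by move=> x x0; rewrite (lt_le_trans c0 x0).
Qed.

Let mX1 : moderate (fun x : R => x). Proof. exact: (moderateX 1). Qed.

Let tail_markov n c : 0 < c -> tail n c <= E_ n (fun x => x) / c.
Proof.
move=> c0; rewrite mulrC -(expectationZ (hE_ n)) //; apply: (expectation_le (hE_ n)).
- exact: moderate_tail.
- exact: moderateZ.
- move=> x x0; case: ltP => /= cx; last by rewrite mulr_ge0 // invr_ge0 ltW.
  by rewrite mulrC ler_pdivlMr // mul1r ltW.
Qed.

(* An ultrafilter replaces Helly's selection of a subsequence. *)
Lemma tail_limit : exists U : set_system nat, exists T0 : R -> R,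
  [/\ UltraFilter U, \oo `<=` U & forall c, tail n c @[n --> U] --> T0 c].
Proof.
have [U [UU sU]] := @ultraFilterLemma nat \oo _.
have h c : {l : R | tail n c @[n --> U] --> l}.
  apply: cid; have [l _ hl] := @ultra_bounded_cvg R nat U UU (tail^~ c) 0 1 (tail01^~ c).
  by exists l.
exists U, (fun c => sval (h c)); split=> // c; exact: (svalP (h c)).
Qed.

(** The limit tail [T0] need not be right-continuous, so the distribution function is the
    right-continuous version of 1 - T0, and tails of P are only sandwiched between values of [T0].
    The Markov inequality prevents loss of mass at infinity. *)
Lemma limit_law : exists (P : probability R R) (U : set_system nat) (T0 : R -> R),
  [/\ UltraFilter U, \oo `<=` U, forall c, 0 <= T0 c <= 1 /\ tail n c @[n --> U] --> T0 c,
     P D = 1%E & forall c, exists2 t, P `]c, +oo[%classic = t%:E &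
       t <= T0 c /\ forall d, c < d -> T0 d <= t].
Proof.
have [U [T0 [UU sU T0E]]] := tail_limit.
have cU (z : R) : z @[_ --> U] --> z by exact: cvg_cst.
have T0_le c d : c <= d -> T0 d <= T0 c.
  by move=> cd; apply: (ler_cvg_to (T0E d) (T0E c)); apply: nearW => n; exact: tail_le.
have T0_ge0 c : 0 <= T0 c.
  apply: (ler_cvg_to (cU 0) (T0E c)); apply: nearW => n.
  by case/andP: (tail01 n c).
have T0_le1 c : T0 c <= 1.
  apply: (ler_cvg_to (T0E c) (cU 1)); apply: nearW => n.
  by case/andP: (tail01 n c).
have T0_neg c : c < 0 -> T0 c = 1.
  move=> c0; have : tail n c @[n --> U] --> (1 : R).
    have -> : tail^~ c = fun=> 1 by apply/funext => n; exact: tail_neg.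
    exact: cvg_cst.
  by move: (T0E c); exact: cvg_unique.
have T0_markov c : 0 < c -> T0 c <= m 1%N / c.
  move=> c0; apply: (@ler_cvg_to _ U _ _ _ (fun n => E_ n (fun x => x) / c) _ _ (T0E c)).
    apply: cvgMr_tmp; apply: cvg_trans (@mE_ 1%N) => A /= hA; exact: sU.
  by apply: nearW => n; exact: tail_markov.
pose S c := [set 1 - T0 y | y in [set y | c < y]].
pose F c := inf (S c).
have Slb c : lbound (S c) (1 - T0 c).
  by move=> _ [y /= cy <-]; rewrite lerD2l lerN2 T0_le // ltW.
have Sinf c : has_inf (S c).
  split; last by exists (1 - T0 c).
  by exists (1 - T0 (c + 1)); exists (c + 1) => //=; rewrite ltrDl.
have Fge c : 1 - T0 c <= F c by apply: lb_le_inf; [exact: (Sinf c).1|exact: Slb].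
have Fle c d : c < d -> F c <= 1 - T0 d.
  by move=> cd; apply: ge_inf; [exact: (Sinf c).2|exists d].
have Fnd : {homo F : x y / x <= y}.
  move=> x y; rewrite le_eqVlt => /predU1P[->//|xy].
  exact: le_trans (Fle _ _ xy) (Fge _).
have F1 c : F c <= 1.
  by rewrite (le_trans (Fle c (c + 1) _)) ?ltrDl // lerBlDr lerDl.
have Frc x : F @ at_right x --> F x.
  apply/cvgrPdist_le => e e0; have [_ [y /= xy <-] ye] := inf_adherent e0 (Sinf x).
  near=> z.
  have xz : x < z by near: z; exact: nbhs_right_gt.
  have zy : z < y by near: z; exact: nbhs_right_lt.
  have h1 := Fnd _ _ (ltW xz); have h2 := Fle _ _ zy.
  by rewrite distrC ger0_norm ?subr_ge0 // lerBlDl (le_trans h2) // ltW.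
have Fneg c : c < 0 -> F c = 0.
  move=> c0; apply/eqP; rewrite eq_le; apply/andP; split.
    rewrite (le_trans (Fle c (c / 2) _)) ?T0_neg ?subrr //; lra.
  by rewrite (le_trans _ (Fge c)) // T0_neg // subrr.
have FNy : F @ -oo --> (0 : R).
  have : (0 : R) @[_ --> (-oo : set_system R)] --> (0 : R) by exact: cvg_cst.
  apply: cvg_trans; apply: near_eq_cvg; near=> c.
  by rewrite Fneg //; near: c; exact: nbhs_ninfty_lt.
have m10 : 0 <= m 1%N.
  have c0 : (0 : R) @[_ --> \oo] --> (0 : R) by exact: cvg_cst.
  apply: (ler_cvg_to c0 (@mE_ 1%N)); apply: nearW => n.
  by apply: (expectation_ge0 (hE_ n)).
have Fy : F @ +oo --> (1 : R).
  apply/cvgrPdist_le => e e0; near=> c.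
  have c0 : 0 < c by near: c; exact: nbhs_pinfty_gt.
  rewrite ger0_norm ?subr_ge0 // lerBlDl -lerBlDr.
  apply: le_trans (Fge c); rewrite lerD2l lerN2 (le_trans (T0_markov _ c0)) //.
  rewrite ler_pdivrMr // mulrC -ler_pdivrMr //.
have [P PF] := probability_of_cdf Fnd Frc FNy Fy.
have Ptail c : P `]c, +oo[%classic = (1 - F c)%:E.
  rewrite -setCitvl probability_setC //.
  by rewrite PF EFinB.
exists P, U, T0; split => //; first by move=> c; rewrite T0_ge0 T0_le1.
  have -> : D = ~` `]-oo, 0[ by rewrite setCitvl.
  rewrite probability_setC //.
  suff -> : P `]-oo, 0[%classic = 0%E by rewrite sube0.
  have -> : `]-oo, 0%R[%classic = \bigcup_k `]-oo, - (k.+1%:R^-1 : R)]%classic.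
    apply/seteqP; split => x /=; last first.
      by move=> [k _]; rewrite /= !in_itv /= => xk; apply: (le_lt_trans xk); rewrite oppr_lt0 invr_gt0.
    rewrite in_itv /= => x0; exists (Num.bound (- x)^-1) => //.
    rewrite /= in_itv /= lerNr invf_ple ?posrE ?oppr_gt0 //.
    have x1 : 0 <= (- x)^-1 by rewrite invr_ge0 oppr_ge0 ltW.
    by rewrite (le_trans (ltW (archi_boundP x1))) // ler_nat.
  apply/negligibleP; first by apply: bigcup_measurable => k _; exact: measurable_itv.
  apply: negligible_bigcup => k; apply/negligibleP; first exact: measurable_itv.
  by have := PF (- (k.+1%:R)^-1); rewrite Fneg // oppr_lt0 invr_gt0.
move=> c; exists (1 - F c) => //; split; first by rewrite lerBlDl -lerBlDr.
by move=> d cd; rewrite lerBrDl -lerBrDr Fle.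
Unshelve. all: by end_near. Qed.

End LimitLaw.

End MomentLimit.

(** * Moments bracketed by sums of tail probabilities *)

Section RootLevels.
Context {R : realType}.
Implicit Types (c h x y : R) (n s N i : nat).

Definition nroot s c : R := c `^ (s%:R^-1).

Lemma nrootX s c : (0 < s)%N -> 0 <= c -> nroot s c ^+ s = c.
Proof.
move=> s0 c0; rewrite -powR_mulrn ?powR_ge0 // -powRrM mulVf ?powRr1 //.
by rewrite pnatr_eq0 -lt0n.
Qed.

(** Turns a layer of x^s into a tail event of x, the kind of event whose limit is available. *)
Lemma nroot_lt s c x : (0 < s)%N -> 0 <= c -> 0 <= x -> (nroot s c < x) = (c < x ^+ s).
Proof.
move=> s0 c0 x0; rewrite -{2}(nrootX s0 c0) ltr_pXn2r ?nnegrE ?powR_ge0 //.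
Qed.

Lemma nroot_mono s c d : (0 < s)%N -> 0 <= c -> c < d -> nroot s c < nroot s d.
Proof.
move=> s0 c0 cd; have d0 : 0 <= d by rewrite (le_trans c0) // ltW.
by rewrite nroot_lt ?powR_ge0 // nrootX.
Qed.

(** Moving all levels up by one step costs at most one layer; this pays for the gap in the sandwich
    of tails. *)
Lemma sum_shift_le (b : nat -> R) N : (forall i, 0 <= b i <= 1) ->
  \sum_(i < N) b i <= 1 + \sum_(i < N) b i.+1.
Proof.
move=> b01.
have : \sum_(i < N.+1) b i = \sum_(i < N) b i + b N by rewrite big_ord_recr.
have : \sum_(i < N.+1) b i = b 0%N + \sum_(i < N) b i.+1 by rewrite big_ord_recl.
have /andP[_ h0] := b01 0%N; have /andP[hN _] := b01 N; lra.
Qed.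

Section Bounds.
Variable F : (R -> R) -> R.
Hypothesis hF : is_expectation F.
Variables (s : nat) (h : R).
Hypotheses (s0 : (0 < s)%N) (h0 : 0 < h).

Let moderate_layers (k N : nat) :
  moderate (fun x => h * \sum_(i < N) (nroot s ((i + k)%:R * h) < x)%R%:R).
Proof. by apply: moderateZ; apply: moderate_sum => i; exact: moderate_tail. Qed.

Let expectation_layers (k N : nat) :
  F (fun x => h * \sum_(i < N) (nroot s ((i + k)%:R * h) < x)%R%:R)
  = h * \sum_(i < N) F (fun x => (nroot s ((i + k)%:R * h) < x)%R%:R).
Proof.
have mt (i : 'I_N) : moderate (fun x : R => (nroot s ((i + k)%:R * h) < x)%R%:R) by exact: moderate_tail.
by rewrite (expectationZ hF) ?(expectation_sum hF) //; exact: moderate_sum.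
Qed.

Let level k i x : 0 <= x -> (nroot s ((i + k)%:R * h) < x) = ((i + k)%:R * h < x ^+ s).
Proof. by move=> x0; rewrite nroot_lt // mulr_ge0 // ltW. Qed.

Lemma layers_le_moment N :
  h * \sum_(i < N) F (fun x => (nroot s ((i + 1)%:R * h) < x)%R%:R) <= F (fun x => x ^+ s).
Proof.
rewrite -expectation_layers; apply: (expectation_le hF) => //; first exact: moderateX.
move=> x x0; under eq_bigr do rewrite level // addn1.
by rewrite (le_trans (layer_lower _ (exprn_ge0 s x0) (ltW h0))) // ge_min lexx.
Qed.

(** Above the height N h one has x^s <= x^(2s) / (N h): the moment of order 2 s provides the uniform
    integrability. *)
Lemma moment_le_layers N : (0 < N)%N ->
  F (fun x => x ^+ s) <= h * \sum_(i < N) F (fun x => (nroot s ((i + 0)%:R * h) < x)%R%:R)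
     + (N%:R * h)^-1 * F (fun x => x ^+ (2 * s)).
Proof.
move=> N0; have B0 : 0 < N%:R * h by rewrite mulr_gt0 // ltr0n.
rewrite -expectation_layers -(expectationZ hF); last exact: moderateX.
have mX2 : moderate (fun x => (N%:R * h)^-1 * x ^+ (2 * s)) by apply: moderateZ; exact: moderateX.
rewrite -(expectationD hF) //; apply: (expectation_le hF).
- exact: moderateX.
- exact: moderateD.
move=> x x0; under eq_bigr do rewrite level // addn0.
have hm := layer_upper N (exprn_ge0 s x0) (ltW h0).
suff hv : x ^+ s <= Num.min (x ^+ s) (N%:R * h) + (N%:R * h)^-1 * x ^+ (2 * s).
  by rewrite (le_trans hv) // lerD2r.
have v0 := exprn_ge0 s x0; rewrite [(2 * s)%N]mulnC exprM.
have [vB|vB] := leP (x ^+ s) (N%:R * h).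
  by rewrite lerDl mulr_ge0 ?invr_ge0 ?(ltW B0) ?exprn_ge0.
rewrite (le_trans _ (lerD (ltW B0) (lexx _))) // add0r ler_pdivlMl //.
by rewrite expr2 ler_wpM2r // ltW.
Qed.

End Bounds.

End RootLevels.

Section MeanOperator.
Context {R : realType} (P : probability R R).
Local Notation D := (`[0%R, +oo[%classic : set R).
Hypothesis PD : P D = 1%E.
Implicit Types (f g : R -> R) (phi : R -> R).

Let PCD : P (~` D) = 0%E.
Proof. by rewrite probability_setC // PD subee. Qed.

Let DE : setT `\` ~` D = D. Proof. by rewrite setTD setCK. Qed.

(** phi is either the identity or a truncation at a level K. *)
Definition mean_of phi f : R := fine (\int[P]_x (f (phi x))%:E)%E.

Lemma mean_is_expectation phi : (forall x, 0 <= x -> 0 <= phi x) ->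
  (forall f, moderate f -> P.-integrable setT (fun x => (f (phi x))%:E)) ->
  is_expectation (mean_of phi).
Proof.
move=> phi0 iphi; split.
- move=> f g mf mg; rewrite /mean_of.
  have e : (\int[P]_x (f (phi x) + g (phi x))%:E =
      \int[P]_x (f (phi x))%:E + \int[P]_x (g (phi x))%:E)%E.
    exact: (integralD measurableT (iphi _ mf) (iphi _ mg)).
  by rewrite e fineD //; apply: integrable_fin_num => //; exact: iphi.
- move=> c f mf; rewrite /mean_of.
  have e : (\int[P]_x (c * f (phi x))%:E = c%:E * \int[P]_x (f (phi x))%:E)%E.
    exact: (integralZl measurableT (iphi _ mf)).
  by rewrite e fineM //; apply: integrable_fin_num => //; exact: iphi.
- move=> f g mf mg fg; rewrite /mean_of.
  have mCD : measurable (~` D) by apply: measurableC.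
  rewrite fine_le //; try by apply: integrable_fin_num => //; exact: iphi.
  rewrite (negligible_integral mCD _ (iphi _ mf)) // (negligible_integral mCD _ (iphi _ mg)) // DE.
  have iD : forall h, moderate h -> P.-integrable D (fun x => (h (phi x))%:E).
    by move=> h mh; apply: integrableS (iphi _ mh).
  apply: le_integral => //; try exact: iD.
  move=> x /set_mem /=; rewrite in_itv /= andbT => x0.
  by rewrite lee_fin fg // phi0.
- rewrite /mean_of integral_cst // mul1e.
  exact: (congr1 fine (@probability_setT _ _ _ P)).
Qed.

Lemma moderate_integrable f : (forall s, (\int[P]_(x in D) (x ^+ s)%:E < +oo)%E) ->
  moderate f -> P.-integrable setT (fun x => (f x)%:E).
Proof.
move=> hs [mf [c [k fk]]].
have mCD : measurable (~` D) by apply: measurableC.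
apply/(negligible_integrable mCD) => //; first exact/measurable_EFinP.
rewrite DE.
have iX s : P.-integrable D (fun x => (x ^+ s)%:E).
  apply/integrableP; split; first by apply/measurable_EFinP; apply: measurable_funTS; exact: measurable_funX.
  have -> : (\int[P]_(x in D) `|(x ^+ s)%:E| = \int[P]_(x in D) (x ^+ s)%:E)%E.
    apply: eq_integral => x /set_mem /=.
    by rewrite in_itv /= andbT => x0; rewrite ger0_norm // exprn_ge0.
  exact: hs.
have iB : P.-integrable D (fun x => \sum_(i < k.+1) (c * 'C(k, i)%:R)%:E * (x ^+ i)%:E)%E.
  by apply: integrable_sum => // i _; exact: (integrableZl _ _ (iX i)).
apply: (le_integrable _ _ _ iB) => //.
  by apply/measurable_EFinP; exact: measurable_funTS.
move=> x /=; rewrite in_itv /= andbT => x0.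
rewrite (eq_bigr (fun i : 'I_k.+1 => (c * 'C(k, i)%:R * x ^+ i)%:E)) // sumEFin lee_fin.
rewrite (le_trans (fk _ x0)) // (le_trans _ (ler_norm _)) // exprDn mulr_sumr.
apply: eq_ler; apply: eq_bigr => i _.
by rewrite expr1n mul1r -mulr_natr; ring.
Qed.

End MeanOperator.

Section LawOfMoments.
Context {R : realType}.
Implicit Types (f g : R -> R) (c h x y : R) (n s N K : nat).
Local Notation D := (`[0%R, +oo[%classic : set R).

Lemma bounded_integrable (P : probability R R) f c : P D = 1%E ->
  measurable_fun [set: R] f -> (forall x, 0 <= x -> `|f x| <= c) ->
  P.-integrable setT (fun x => (f x)%:E).
Proof.
move=> PD mf fc.
have mCD : measurable (~` D) by apply: measurableC.
have PCD : P (~` D) = 0%E by rewrite probability_setC // PD subee.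
apply/(negligible_integrable mCD) => //; first exact/measurable_EFinP.
rewrite setTD setCK.
have iB : P.-integrable D (fun x => (cst c x)%:E) by exact: finite_measure_integrable_cst.
apply: (le_integrable _ _ _ iB) => //.
  by apply/measurable_EFinP; exact: measurable_funTS.
move=> x /=; rewrite in_itv /= andbT => x0; rewrite lee_fin.
by rewrite (le_trans (fc _ x0)) // ler_norm.
Qed.

Lemma mean_tail (P : probability R R) c t : P `]c, +oo[%classic = t%:E ->
  mean_of P id (fun x => (c < x)%R%:R) = t.
Proof.
move=> Pt; rewrite /mean_of.
have -> : (\int[P]_x ((c < x)%R%:R)%:E = \int[P]_x (\1_(`]c, +oo[%classic) x)%:E)%E.
  apply: eq_integral => x _; rewrite indicE; congr (nat_of_bool _)%:R%:E.
  by apply/idP/idP => [cx|/set_mem /=]; [apply/mem_set|]; rewrite /= in_itv /= andbT.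
by rewrite integral_indic // setIT; exact: (congr1 fine Pt).
Qed.

(* Truncation gives bounded functions, so the upper bounds on the moments can be proved
   before integrability is known. *)
Lemma truncated_is_expectation (P : probability R R) K : P D = 1%E ->
  is_expectation (mean_of P (fun x => Num.min x K%:R)) /\
  forall f, moderate f -> P.-integrable setT (fun x => (f (Num.min x K%:R))%:E).
Proof.
move=> PD.
have iphi f : moderate f -> P.-integrable setT (fun x => (f (Num.min x K%:R))%:E).
  move=> [mf [c [k fk]]].
  apply: (@bounded_integrable P (fun x => f (Num.min x K%:R)) (c * (1 + K%:R) ^+ k)) => //.
    by apply: measurableT_comp => //; exact: measurable_minr.
  move=> x x0; have m0 : 0 <= Num.min x K%:R by rewrite le_min x0 ler0n.
  have c0 : 0 <= c by have := fk 0 (lexx _); rewrite addr0 expr1n mulr1; apply: le_trans.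
  rewrite (le_trans (fk _ m0)) // ler_wpM2l // lerXn2r ?nnegrE ?addr_ge0 //.
  by rewrite lerD2l ge_min lexx orbT.
split=> //; apply: mean_is_expectation => // x x0.
by rewrite le_min x0 ler0n.
Qed.

Section Existence.
Variables (E_ : nat -> (R -> R) -> R) (m : nat -> R).
Hypothesis hE_ : forall n, is_expectation (E_ n).
Hypothesis mE_ : forall s, E_ n (fun x => x ^+ s) @[n --> \oo] --> m s.

Lemma layers_count c (e : R) : 0 < e -> exists2 N, (0 < N)%N & (N%:R * e)^-1 * c <= e.
Proof.
move=> e0; exists (Num.bound `|c / (e * e)|).+1 => //.
set N := _.+1; have N0 : 0 < N%:R :> R by rewrite ltr0n.
rewrite ler_pdivrMl ?mulr_gt0 // -mulrA -ler_pdivrMr ?mulr_gt0 //.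
rewrite (le_trans (ler_norm _)) // (le_trans (ltW (archi_boundP (normr_ge0 _)))) //.
by rewrite ler_nat.
Qed.

(** The tail sandwich is inserted into layer-cake sums. The upper bound comes first, for
    truncations, and gives integrability by monotone convergence; only then is the reverse bound
    proved for P itself. *)
Lemma law_of_moments : exists P : probability R R, [/\ P D = 1%E,
  forall f, moderate f -> P.-integrable setT (fun x => (f x)%:E) &
  forall s, (\int[P]_x (x ^+ s)%:E = (m s)%:E)%E].
Proof.
have [P [U [T0 [UU sU T0E PD Ptail]]]] := limit_law hE_ mE_.
have m_cvgU s : E_ n (fun x => x ^+ s) @[n --> U] --> m s.
  by apply: cvg_trans (@mE_ s) => A /= hA; exact: sU.
have m_ge0 s : 0 <= m s.
  have c0 : (0 : R) @[_ --> \oo] --> (0 : R) by exact: cvg_cst.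
  apply: (ler_cvg_to c0 (@mE_ s)); apply: nearW => n.
  by apply: (expectation_ge0 (hE_ n)) => [|x x0]; [exact: moderateX|exact: exprn_ge0].
have layersU s (e : R) k N : e * \sum_(i < N) E_ n (fun x => (nroot s ((i + k)%:R * e) < x)%R%:R)
    @[n --> U] --> e * \sum_(i < N) T0 (nroot s ((i + k)%:R * e)).
  apply: cvgMl_tmp.
  elim: N => [|N IH]; first by rewrite big_ord0; under eq_fun do rewrite big_ord0; exact: cvg_cst.
  rewrite big_ord_recr; under eq_fun do rewrite big_ord_recr.
  by apply: cvgD => //; exact: (T0E _).2.
have lower s (e : R) N : (0 < s)%N -> 0 < e ->
    e * \sum_(i < N) T0 (nroot s ((i + 1)%:R * e)) <= m s.
  move=> s0 e0; apply: (ler_cvg_to (layersU s e 1%N N) (m_cvgU s)).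
  by apply: nearW => n; exact: layers_le_moment.
have upper s (e : R) N : (0 < s)%N -> 0 < e -> (0 < N)%N ->
    m s <= e * \sum_(i < N) T0 (nroot s ((i + 0)%:R * e)) + (N%:R * e)^-1 * m (2 * s)%N.
  move=> s0 e0 N0.
  have c : e * \sum_(i < N) E_ n (fun x => (nroot s ((i + 0)%:R * e) < x)%R%:R)
     + (N%:R * e)^-1 * E_ n (fun x => x ^+ (2 * s)) @[n --> U]
     --> e * \sum_(i < N) T0 (nroot s ((i + 0)%:R * e)) + (N%:R * e)^-1 * m (2 * s)%N.
    by apply: cvgD; [exact: layersU|apply: cvgMl_tmp; exact: m_cvgU].
  apply: (ler_cvg_to (m_cvgU s) c).
  by apply: nearW => n; exact: moment_le_layers.
have shift s (e : R) k N : 0 < e ->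
    e * \sum_(i < N) T0 (nroot s ((i + k)%:R * e)) <=
    e + e * \sum_(i < N) T0 (nroot s ((i + k.+1)%:R * e)).
  move=> e0; rewrite -[X in _ <= X + _]mulr1 -mulrDr ler_wpM2l ?(ltW e0) //.
  under [X in _ <= 1 + X]eq_bigr do rewrite addnS -addSn.
  by apply: (@sum_shift_le R (fun i => T0 (nroot s ((i + k)%:R * e)))) => i; exact: (T0E _).1.
have trunc K s : (0 < s)%N -> mean_of P (fun x => Num.min x K%:R) (fun x => x ^+ s) <= m s.
  move=> s0; have [hF iF] := truncated_is_expectation K PD.
  set F := mean_of _ _ in hF *.
  have tailF c : F (fun x => (c < x)%R%:R) <= T0 c.
    have [t Pt [tT0 _]] := Ptail c; rewrite (le_trans _ tT0) // -(mean_tail Pt).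
    have it : P.-integrable setT (fun x => ((c < x)%R%:R)%:E).
      apply: (@bounded_integrable P (fun x => (c < x)%R%:R) 1) => //.
        by have [] := @moderate_tail R c.
      by move=> x _; rewrite normr_nat lern1 leq_b1.
    rewrite /F /mean_of fine_le //.
    - by apply: integrable_fin_num => //; exact: (iF _ (moderate_tail c)).
    - exact: integrable_fin_num.
    apply: le_integral => //; first exact: (iF _ (moderate_tail c)).
    by move=> x _; rewrite lee_fin ler_nat lt_min; case: (c < x) => //=; case: (c < K%:R).
  (* One shift of levels and the part above the cut cost at most e / 2 each. *)
  apply/ler_addgt0Pr => e e0; have e2 : 0 < e / 2 by rewrite divr_gt0.
  have [N N0 hN] := layers_count (F (fun x => x ^+ (2 * s))) e2.
  have h1 := moment_le_layers hF s0 e2 N0.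
  have h2 : e / 2 * \sum_(i < N) F (fun x => (nroot s ((i + 0)%:R * (e / 2)) < x)%R%:R)
     <= e / 2 * \sum_(i < N) T0 (nroot s ((i + 0)%:R * (e / 2))).
    by rewrite ler_wpM2l ?(ltW e2) //; apply: ler_sum => i _; exact: tailF.
  have h3 := shift s (e / 2) 0%N N e2; have h4 := lower s (e / 2) N s0 e2.
  lra.
have moment_le s : (0 < s)%N -> (\int[P]_(x in D) (x ^+ s)%:E <= (m s)%:E)%E.
  move=> s0; pose g K x : \bar R := (Num.min x K%:R ^+ s)%:E.
  have mn x K : 0 <= x -> 0 <= Num.min x K%:R by move=> x0; rewrite le_min x0 ler0n.
  have mg K : measurable_fun D (g K).
    apply/measurable_EFinP; apply: measurable_funTS; apply: measurable_funX.
    exact: measurable_minr.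
  have g0 K x : D x -> (0 <= g K x)%E.
    by rewrite /= in_itv /= andbT => x0; rewrite lee_fin exprn_ge0 // mn.
  have gnd x : D x -> {homo g^~ x : n k / (n <= k)%N >-> (n <= k)%E}.
    rewrite /= in_itv /= andbT => x0 n k nk; rewrite lee_fin lerXn2r ?nnegrE ?mn //.
    rewrite le_min ge_min lexx /= ge_min; apply/orP; right.
    by rewrite ler_nat.
  have gK K : (\int[P]_(x in D) g K x <= (m s)%:E)%E.
    have [hF iF] := truncated_is_expectation K PD.
    have mCD : measurable (~` D) by apply: measurableC.
    have PCD : P (~` D) = 0%E by rewrite probability_setC // PD subee.
    have := negligible_integral mCD measurableT (iF _ (moderateX s)) PCD.
    rewrite setTD setCK => <-.
    rewrite -(fineK (integrable_fin_num measurableT (iF _ (moderateX s)))) lee_fin.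
    exact: (trunc K s s0).
  have mD : measurable D by exact: measurable_itv.
  have := @cvg_monotone_convergence _ _ _ P D mD g mg g0 gnd.
  have -> : (\int[P]_(x in D) limn (g^~ x) = \int[P]_(x in D) (x ^+ s)%:E)%E.
    apply: eq_integral => x /set_mem /=; rewrite in_itv /= andbT => x0.
    apply/cvg_lim => //.
    have c : ((x ^+ s)%:E : \bar R) @[_ --> \oo] --> (x ^+ s)%:E by exact: cvg_cst.
    apply: cvg_trans c; apply: near_eq_cvg; near=> K.
    rewrite /g; have /min_idPl -> // : x <= K%:R.
    by near: K; exact: nbhs_infty_ger.
  move=> h; rewrite -(cvg_lim _ h) //; apply: lime_le; first exact: cvgP h.
  exact: nearW.
have iP f : moderate f -> P.-integrable setT (fun x => (f x)%:E).
  apply: moderate_integrable => // -[|s]; last by rewrite (le_lt_trans (moment_le s.+1 isT)) // ltry.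
  have -> : (\int[P]_(x in D) (x ^+ 0)%:E = \int[P]_(x in D) (cst 1 x))%E by [].
  by rewrite integral_cst // mul1e (le_lt_trans (probability_le1 _ _)) // ltry.
exists P; split => // s.
have hM : is_expectation (mean_of P id) by apply: mean_is_expectation.
have fin := integrable_fin_num measurableT (iP _ (moderateX s)).
rewrite -(fineK fin) -[fine _]/(mean_of P id (fun x => x ^+ s)); congr EFin.
(* Roots of order s make no sense for s = 0; that case is normalisation. *)
case: s fin => [_|s fin].
  rewrite (expectation1 hM).
  have c1 : (1 : R) @[_ --> \oo] --> (1 : R) by exact: cvg_cst.
  have := @mE_ 0%N; under eq_fun do rewrite (expectation1 (hE_ _)).
  by move: c1; exact: cvg_unique.
apply/eqP; rewrite eq_le; apply/andP; split.
  rewrite -lee_fin /mean_of /= fineK //.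
  have mCD : measurable (~` D) by apply: measurableC.
  have PCD : P (~` D) = 0%E by rewrite probability_setC // PD subee.
  have := negligible_integral mCD measurableT (iP _ (moderateX s.+1)) PCD.
  by rewrite setTD setCK => ->; exact: moment_le.
(* Three errors of at most e / 4: the part above the cut and two shifts, the second because a tail
   of P dominates [T0] only at strictly higher levels. *)
apply/ler_addgt0Pr => e e0; have e4 : 0 < e / 4 by rewrite divr_gt0.
have [N N0 hN] := layers_count (m (2 * s.+1)%N) e4.
have h1 := upper s.+1 (e / 4) N isT e4 N0.
have h2 := shift s.+1 (e / 4) 0%N N e4; have h3 := shift s.+1 (e / 4) 1%N N e4.
have h4 := layers_le_moment hM (isT : (0 < s.+1)%N) e4 N.
have h5 : e / 4 * \sum_(i < N) T0 (nroot s.+1 ((i + 2)%:R * (e / 4)))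
   <= e / 4 * \sum_(i < N) mean_of P id (fun x => (nroot s.+1 ((i + 1)%:R * (e / 4)) < x)%R%:R).
  rewrite ler_wpM2l ?(ltW e4) //; apply: ler_sum => i _.
  have [t Pt [_ tT0]] := Ptail (nroot s.+1 ((i + 1)%:R * (e / 4))).
  rewrite (mean_tail Pt); apply: tT0; apply: nroot_mono => //.
    by rewrite mulr_ge0 // ltW.
  by rewrite ltr_pM2r // ltr_nat ltn_add2l.
lra.
Unshelve. all: by end_near. Qed.

End Existence.

End LawOfMoments.

(** * Mixed Poisson limits *)

Section FactorialPowers.
Context {R : realType}.
Implicit Types (x y : R) (k l s i I X : nat).

Fixpoint stirling2 s k : nat :=
  match s, k with
  | 0, 0 => 1
  | 0, _.+1 => 0
  | _.+1, 0 => 0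
  | s'.+1, k'.+1 => stirling2 s' k' + k'.+1 * stirling2 s' k'.+1
  end.

Lemma stirling2_small s k : (s < k)%N -> stirling2 s k = 0%N.
Proof. by elim: s k => [|s IH] [|k] //= sk; rewrite !IH ?muln0 // leqW. Qed.

Lemma stirling2_diag s : stirling2 s s = 1%N.
Proof. by elim: s => [|s IH] //=; rewrite IH stirling2_small // muln0. Qed.

Lemma ffactS x k : ffact x k.+1 = ffact x k * (x - k%:R).
Proof. by rewrite /ffact big_ord_recr. Qed.

Lemma exprn_ffact x s : x ^+ s = \sum_(k < s.+1) (stirling2 s k)%:R * ffact x k.
Proof.
elim: s => [|s IH]; first by rewrite big_ord1 /ffact big_ord0 mulr1.
rewrite exprS IH [RHS]big_ord_recl /= mul0r add0r.
have E1 : \sum_(k < s.+1) (stirling2 s k)%:R * (k%:R * ffact x k) =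
    \sum_(k < s.+1) (k.+1 * stirling2 s k.+1)%:R * ffact x k.+1.
  rewrite big_ord_recl mul0r mulr0 add0r [RHS]big_ord_recr /=.
  rewrite stirling2_small // muln0 mul0r addr0.
  by apply: eq_bigr => k _; rewrite /bump add1n natrM; ring.
under [RHS]eq_bigr do rewrite natrD mulrDl.
rewrite big_split /= -[X in _ = _ + X]E1 -big_split /= mulr_sumr.
by apply: eq_bigr => k _; rewrite ffactS; ring.
Qed.

Lemma ffact_nat X k : ffact (X%:R : R) k = (X ^_ k)%:R.
Proof.
elim: k => [|k IH]; first by rewrite /ffact big_ord0.
rewrite ffactS IH ffactnSr natrM.
have [kX|Xk] := leqP k X; first by rewrite natrB.
by rewrite ffact_small // !mul0r.
Qed.

(** For positive M the alternating sum telescopes to a single signed binomial of M - 1, and Pascal's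
    rule bounds it. *)
Lemma alternating_bin M I :
  `|(M == 0%N)%:R - \sum_(i < I) (-1) ^+ i * ('C(M, i))%:R| <= ('C(M, I))%:R :> R.
Proof.
case: M => [|M].
  case: I => [|I]; first by rewrite big_ord0 subr0 normr1 bin0.
  rewrite big_ord_recl expr0 mul1r bin0 big1 ?addr0 ?subrr ?normr0 // => i _.
  by rewrite bin0n mulr0.
have E J : \sum_(i < J.+1) (-1) ^+ i * ('C(M.+1, i))%:R = (-1) ^+ J * ('C(M, J))%:R :> R.
  elim: J => [|J IH]; first by rewrite big_ord1 !bin0.
  by rewrite big_ord_recr /= IH binS natrD exprS; ring.
case: I => [|I]; first by rewrite big_ord0 subr0 normr0.
rewrite E sub0r normrN normrM normrX normrN1 expr1n mul1r normr_nat ler_nat.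
by rewrite binS leq_addl.
Qed.

Lemma ffact_bin X l i : (X ^_ (l + i))%:R / (l`!%:R * i`!%:R) = ('C(X, l) * 'C(X - l, i))%:R :> R.
Proof.
have f0 k : k`!%:R != 0 :> R by rewrite pnatr_eq0 -lt0n fact_gt0.
apply/eqP; rewrite eq_sym -(inj_eq (mulIf (mulf_neq0 (f0 l) (f0 i)))) divfK ?mulf_neq0 //.
rewrite -!natrM; apply/eqP; congr (_%:R).
have -> : (X ^_ (l + i) = X ^_ l * (X - l) ^_ i)%N.
  elim: i => [|i IH]; first by rewrite addn0 ffactn0 muln1.
  by rewrite addnS !ffactnSr IH subnDA mulnA.
by rewrite -!bin_ffact; lia.
Qed.

(** The indicator of X = l is binom(X, l) times that of X - l = 0. For X < l the truncated
    difference is 0, but the binomial vanishes. *)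
Lemma bonferroni X l I :
  `|(X == l)%:R - \sum_(i < I) (-1) ^+ i / (l`!%:R * i`!%:R) * ffact (X%:R : R) (l + i)|
  <= ffact (X%:R : R) (l + I) / (l`!%:R * I`!%:R).
Proof.
rewrite ffact_nat ffact_bin.
rewrite (eq_bigr (fun i : 'I_I => 'C(X, l)%:R * ((-1) ^+ i * 'C(X - l, i)%:R))); last first.
  move=> i _; rewrite ffact_nat mulrCA -[X in _ = _ * X]natrM -ffact_bin; ring.
rewrite -mulr_sumr.
have [lX|Xl] := leqP l X; last first.
  by rewrite bin_small // mul0r subr0 mul0n (ltn_eqF Xl) normr0.
have -> : (X == l)%:R = 'C(X, l)%:R * ((X - l == 0)%N)%:R :> R.
  rewrite subn_eq0; case: (ltngtP X l) lX => // [lX _|->]; rewrite ?mulr0 //.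
  by rewrite binn mul1r.
by rewrite -mulrBr normrM normr_nat natrM ler_wpM2l // alternating_bin.
Qed.

End FactorialPowers.

Section FiniteLawTheory.
Context {R : realType} {T : eqType}.
Implicit Types (d : fdist R T) (f g : T -> R).

Lemma fexpD d f g : fexp d (fun x => f x + g x) = fexp d f + fexp d g.
Proof. by rewrite /fexp -big_split; apply: eq_bigr => x _; rewrite mulrDr. Qed.

Lemma fexpZ d (c : R) f : fexp d (fun x => c * f x) = c * fexp d f.
Proof. by rewrite /fexp mulr_sumr; apply: eq_bigr => x _; rewrite mulrCA. Qed.

Lemma fexp_sum d (I : Type) (r : seq I) (f : I -> T -> R) :
  fexp d (fun x => \sum_(i <- r) f i x) = \sum_(i <- r) fexp d (f i).
Proof.
rewrite /fexp exchange_big /=; apply: eq_bigr => x _.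
by rewrite mulr_sumr.
Qed.

Lemma fexp_le d f g : (forall x, x \in d -> 0 <= x.2) -> (forall x, f x <= g x) ->
  fexp d f <= fexp d g.
Proof.
move=> d0 fg; rewrite /fexp big_seq [leRHS]big_seq; apply: ler_sum => x xd.
by rewrite ler_wpM2l // d0.
Qed.

Lemma fexp_norm_le d f g : (forall x, x \in d -> 0 <= x.2) ->
  (forall x, `|f x| <= g x) -> `|fexp d f| <= fexp d g.
Proof.
move=> d0 fg; rewrite ler_norml; apply/andP; split.
  rewrite -mulN1r -fexpZ; apply: fexp_le => // x.
  by have := fg x; rewrite mulN1r ler_norml => /andP[].
by apply: fexp_le => // x; rewrite (le_trans _ (fg x)) // ler_norm.
Qed.

Lemma fexp_is_expectation d (V : T -> R) : (forall x, x \in d -> 0 <= x.2) ->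
  fexp d (fun=> 1) = 1 -> (forall x, 0 <= V x) ->
  is_expectation (fun f : R -> R => fexp d (fun t => f (V t))).
Proof.
move=> d0 d1 V0; split=> //.
- by move=> f g _ _; exact: fexpD.
- by move=> c f _; exact: fexpZ.
- by move=> f g _ _ fg; apply: fexp_le => // x; exact: fg.
Qed.

End FiniteLawTheory.

Section NaturalValuedLimits.
Context {R : realType} {T : eqType}.

(** Interchange of limits with a rate: the bound makes c a Cauchy sequence, so summability of the
    limiting series need not be known beforehand. *)
Lemma cvg_double (a : nat -> R) (b : nat -> nat -> R) (c : nat -> R) (K : R) :
  (forall N, b N n @[n --> \oo] --> c N) ->
  (forall N, \forall n \near \oo, `|a n - b N n| <= K / N.+1%:R) ->
  a n @[n --> \oo] --> limn c.
Proof.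
move=> bc ab.
have cc N M : `|c N - c M| <= K / N.+1%:R + K / M.+1%:R.
  have h : `|b N n - b M n| @[n --> \oo] --> `|c N - c M|.
    by apply: cvg_norm; apply: cvgB; exact: bc.
  have hc : K / N.+1%:R + K / M.+1%:R @[_ --> \oo] --> K / N.+1%:R + K / M.+1%:R by exact: cvg_cst.
  apply: (ler_cvg_to h hc); near=> n.
  have h1 : `|a n - b N n| <= K / N.+1%:R by near: n; exact: ab.
  have h2 : `|a n - b M n| <= K / M.+1%:R by near: n; exact: ab.
  rewrite (_ : b N n - b M n = (a n - b M n) - (a n - b N n)); last by ring.
  by rewrite (le_trans (ler_normB _ _)) // addrC lerD.
have K0 : 0 <= K.
  have := cc 0%N 0%N; rewrite subrr normr0 => h; move: h.
  by rewrite divr1; lra.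
have KN (e : R) : 0 < e -> \forall N \near \oo, K / N.+1%:R <= e.
  move=> e0; near=> N; rewrite ler_pdivrMr // -ler_pdivrMl // mulrC.
  have h : K / e <= N%:R by near: N; exact: nbhs_infty_ger.
  by rewrite (le_trans h) // ler_nat.
have cvg_c : cvgn c.
  apply/cauchy_cvgP; apply: cauchy_exP => e e0.
  have e4 : 0 < e / 4 by rewrite divr_gt0.
  have [N0 _ /(_ N0 (leqnn _)) /= hN0] := KN _ e4.
  exists (c N0); near=> N; rewrite /= /ball /=.
  have h : K / N.+1%:R <= e / 4 by near: N; exact: KN.
  by rewrite (le_lt_trans (cc N0 N)) // (le_lt_trans (lerD hN0 h)) //; lra.
have cL N : `|limn c - c N| <= K / N.+1%:R.
  have h : `|c M - c N| @[M --> \oo] --> `|limn c - c N|.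
    by apply: cvg_norm; apply: cvgB; [exact: cvg_c|exact: cvg_cst].
  have hK : K / M.+1%:R @[M --> \oo] --> (0 : R).
    by rewrite -(mulr0 K); apply: cvgMl_tmp; exact: cvg_harmonic.
  have hc : K / M.+1%:R + K / N.+1%:R @[M --> \oo] --> 0 + K / N.+1%:R.
    by apply: cvgD => //; exact: cvg_cst.
  rewrite add0r in hc.
  by apply: (ler_cvg_to h hc); apply: nearW => M; exact: cc.
apply: cvg_approx => e e0.
have [N _ /(_ N (leqnn _)) /= hN] := KN _ e0.
exists (b N), (c N); first exact: bc.
split; first by rewrite (le_trans (cL N)).
by near=> n; rewrite (le_trans _ hN) //; near: n; exact: ab.
Unshelve. all: by end_near. Qed.

Variables (d_ : nat -> fdist R T) (X_ : nat -> T -> nat) (w : nat -> R).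
Hypothesis d0 : forall n x, x \in d_ n -> 0 <= x.2.
Hypothesis w_cvg : forall k,
  fexp (d_ n) (fun t => ffact (X_ n t)%:R k) @[n --> \oo] --> w k.
Hypothesis w_small : forall l, w (l + I)%N / I`!%:R @[I --> \oo] --> 0.

Lemma natural_moment_cvg s : exists M : R, fexp (d_ n) (fun t => (X_ n t)%:R ^+ s) @[n --> \oo] --> M.
Proof.
exists (\sum_(k < s.+1) (stirling2 s k)%:R * w k).
have E n : fexp (d_ n) (fun t => (X_ n t)%:R ^+ s) =
    \sum_(k < s.+1) (stirling2 s k)%:R * fexp (d_ n) (fun t => ffact (X_ n t)%:R k).
  under fexp_ext do rewrite exprn_ffact.
  by rewrite fexp_sum; apply: eq_bigr => k _; rewrite fexpZ.
under eq_fun do rewrite E.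
by apply: cvg_sum_fin => k; apply: cvgMl_tmp; exact: w_cvg.
Qed.

Lemma natural_moment1_cvg s :
  exists M : R, fexp (d_ n) (fun t => (1 + (X_ n t)%:R) ^+ s) @[n --> \oo] --> M.
Proof.
have [M hM] := choice natural_moment_cvg.
exists (\sum_(k < s.+1) 'C(s, k)%:R * M k).
have E n : fexp (d_ n) (fun t => (1 + (X_ n t)%:R) ^+ s) =
    \sum_(k < s.+1) 'C(s, k)%:R * fexp (d_ n) (fun t => (X_ n t)%:R ^+ k).
  under fexp_ext do rewrite exprDn.
  rewrite fexp_sum; apply: eq_bigr => k _; rewrite -fexpZ; apply: fexp_ext => t.
  by rewrite expr1n mul1r mulr_natl.
under eq_fun do rewrite E.
by apply: cvg_sum_fin => k; apply: cvgMl_tmp; exact: hM.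
Qed.

(** p and the probabilities of X = l obey the same truncated expansion, so both lie within the next
    term, which is small. *)
Lemma natural_pmf_cvg l (p : R) :
  (forall I, `|p - \sum_(i < I) (-1) ^+ i / (l`!%:R * i`!%:R) * w (l + i)%N|
     <= w (l + I)%N / (l`!%:R * I`!%:R)) ->
  fexp (d_ n) (fun t => (X_ n t == l)%:R) @[n --> \oo] --> p.
Proof.
move=> hp; have l0 : 0 < l`!%:R :> R by rewrite ltr0n fact_gt0.
have small : w (l + I)%N / (l`!%:R * I`!%:R) @[I --> \oo] --> 0.
  under eq_fun do rewrite invfM mulrCA.
  by rewrite -(mulr0 (l`!%:R)^-1); apply: cvgMl_tmp; exact: w_small.
apply: cvg_approx => e e0.
have /cvgrPdist_lt /(_ _ e0) [I _ /(_ I (leqnn _))] := small.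
rewrite /= sub0r normrN => hI.
exists (fun n => \sum_(i < I) (-1) ^+ i / (l`!%:R * i`!%:R) *
   fexp (d_ n) (fun t => ffact (X_ n t)%:R (l + i))).
exists (\sum_(i < I) (-1) ^+ i / (l`!%:R * i`!%:R) * w (l + i)%N).
  by apply: cvg_sum_fin => i; apply: cvgMl_tmp; exact: w_cvg.
split; first by rewrite (le_trans (hp I)) // (le_trans (ler_norm _)) // ltW.
have c : (l`!%:R * I`!%:R)^-1 * fexp (d_ n) (fun t => ffact (X_ n t)%:R (l + I)) @[n --> \oo]
    --> (l`!%:R * I`!%:R)^-1 * w (l + I)%N.
  by apply: cvgMl_tmp; exact: w_cvg.
near=> n.
have -> : fexp (d_ n) (fun t => (X_ n t == l)%:R) - \sum_(i < I) (-1) ^+ i / (l`!%:R * i`!%:R) *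
     fexp (d_ n) (fun t => ffact (X_ n t)%:R (l + i)) =
   fexp (d_ n) (fun t => (X_ n t == l)%:R - \sum_(i < I) (-1) ^+ i / (l`!%:R * i`!%:R) *
     ffact (X_ n t)%:R (l + i)).
  rewrite -[in RHS](fexp_ext _ (f := fun t => (X_ n t == l)%:R + (-1) * \sum_(i < I) (-1) ^+ i / (l`!%:R * i`!%:R) *
     ffact (X_ n t)%:R (l + i))); last by move=> t; rewrite mulN1r.
  rewrite fexpD fexpZ fexp_sum mulN1r; congr (_ - _).
  by apply: eq_bigr => i _; rewrite fexpZ.
rewrite (le_trans (fexp_norm_le (d0 (n := n)) (fun t => bonferroni (X_ n t) l I))) //.
under fexp_ext do rewrite mulrC.
rewrite fexpZ ltW //; near: n; apply: (cvgr_lt _ c).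
by rewrite mulrC (le_lt_trans (ler_norm _)).
Unshelve. all: by end_near. Qed.

(** On X >= N one more power of 1 + X gains a factor 1 / (N + 1); convergence of the moment of order
    s + 1 turns this into the rate for [cvg_double]. *)
Lemma natural_limit (p : nat -> R) (g : nat -> R) (C : R) s :
  (forall l, fexp (d_ n) (fun t => (X_ n t == l)%:R) @[n --> \oo] --> p l) ->
  (forall l, `|g l| <= C * (1 + l%:R) ^+ s) ->
  fexp (d_ n) (fun t => g (X_ n t)) @[n --> \oo] --> limn (fun N => \sum_(l < N) p l * g l).
Proof.
move=> hp hg.
have C0 : 0 <= C by have := hg 0%N; rewrite addr0 expr1n mulr1; apply: le_trans.
have [M hM] := natural_moment1_cvg s.+1.
apply: (@cvg_double _ (fun N n => \sum_(l < N) fexp (d_ n) (fun t => (X_ n t == l)%:R) * g l)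
    _ (C * (M + 1))) => N.
  by apply: cvg_sum_fin => l; apply: cvgMr_tmp; exact: hp.
near=> n.
have -> : fexp (d_ n) (fun t => g (X_ n t)) - \sum_(l < N) fexp (d_ n) (fun t => (X_ n t == l)%:R) * g l
    = fexp (d_ n) (fun t => g (X_ n t) + -1 * \sum_(l < N) g l * (X_ n t == l)%:R).
  rewrite fexpD fexpZ fexp_sum mulN1r; congr (_ - _).
  by apply: eq_bigr => l _; rewrite fexpZ mulrC.
have bd t : `|g (X_ n t) + -1 * \sum_(l < N) g l * (X_ n t == l)%:R|
    <= C / N.+1%:R * (1 + (X_ n t)%:R) ^+ s.+1.
  set x := X_ n t; have x10 : 0 <= 1 + x%:R :> R by rewrite addr_ge0.
  rewrite mulN1r; have [xN|Nx] := ltnP x N.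
    rewrite (bigD1 (Ordinal xN)) //= eqxx mulr1 big1 ?addr0 ?subrr ?normr0.
      by rewrite mulr_ge0 ?divr_ge0 ?exprn_ge0.
    move=> l lx; suff /negPf -> : x != l by rewrite mulr0.
    by apply: contraNneq lx => xl; apply/eqP/val_inj; rewrite /= xl.
  rewrite big1 ?subr0 => [|l _]; last by rewrite gtn_eqF ?mulr0 // (leq_trans _ Nx).
  rewrite (le_trans (hg x)) // exprS mulrA ler_wpM2r ?exprn_ge0 //.
  by rewrite mulrAC ler_pdivlMr // ler_wpM2l // nat1r ler_nat.
rewrite (le_trans (fexp_norm_le (d0 (n := n)) bd)) // fexpZ mulrAC ler_wpM2r ?invr_ge0 //.
rewrite ler_wpM2l // ltW //; near: n; apply: (cvgr_lt _ hM); by rewrite ltrDl.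
Unshelve. all: by end_near. Qed.

End NaturalValuedLimits.

Section MixingMoments.
Context {R : realType}.
Variables (alpha beta : R).
Hypotheses (alpha0 : 0 < alpha) (beta0 : 0 < beta).

Let a := 1 / (1 + alpha).
Let a_gt0 : 0 < a. Proof. by rewrite divr_gt0 // addr_gt0. Qed.
Let a_lt1 : a < 1. Proof. by rewrite ltr_pdivrMr ?addr_gt0 // mul1r ltrDl. Qed.

Lemma cvg_half_ratio (q : nat -> R) : (forall I, 0 <= q I) ->
  (\forall I \near \oo, q I.+1 <= 2^-1 * q I) -> q I @[I --> \oo] --> 0.
Proof.
move=> q0 [I0 _ hI]; rewrite -(cvg_shiftn I0).
have qk k : q (k + I0)%N <= q I0 * 2^-1 ^+ k.
  elim: k => [|k IH]; first by rewrite mulr1.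
  have {}hI := hI (k + I0)%N (leq_addl _ _).
  rewrite (le_trans hI) // exprS mulrCA ler_wpM2l // invr_ge0 ler0n //.
apply: (@squeeze_cvgr _ _ _ _ (fun=> 0) (fun k => q I0 * 2^-1 ^+ k)).
- by apply: nearW => k; rewrite q0 qk.
- exact: cvg_cst.
- apply: (@cvg_geometric R (q I0) 2^-1).
  by rewrite ger0_norm ?invr_ge0 ?ler0n // invf_lt1 ?ltr0n // ltr1n.
Qed.

Lemma ZmomE s : Zmom alpha beta s =
  Gamma (s%:R + beta) * Gamma (beta * a) / (Gamma beta * Gamma ((beta + s%:R) * a)).
Proof. by rewrite /Zmom [alpha + 1]addrC /a !mul1r. Qed.

Lemma Zmom_gt0 s : 0 < Zmom alpha beta s.
Proof.
have s0 : 0 < beta + s%:R by rewrite ltr_wpDr.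
have s1 : 0 < s%:R + beta by rewrite addrC.
by rewrite ZmomE; apply: divr_gt0; apply: mulr_gt0; apply: Gamma_gt0 => //; apply: mulr_gt0.
Qed.

(** With y = (beta + s) a the ratio is (y / a) Gamma y / Gamma (y + a), and [Gamma_add_le] over the
    distance 1 - a from y + a to y + 1 bounds it. *)
Lemma Zmom_ratio s :
  Zmom alpha beta s.+1 <= Zmom alpha beta s * (a^-1 * ((beta + s.+1%:R) * a) `^ (1 - a)).
Proof.
pose y := (beta + s%:R) * a.
have s0 : 0 < beta + s%:R by rewrite ltr_wpDr.
have y0 : 0 < y by rewrite mulr_gt0.
have ya : (beta + s.+1%:R) * a = y + a by rewrite /y -natr1; ring.
have ya0 : 0 < y + a by rewrite addr_gt0.
have E : Zmom alpha beta s.+1 = Zmom alpha beta s * ((s%:R + beta) * Gamma y / Gamma (y + a)).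
  rewrite !ZmomE ya -/y -natr1 addrAC GammaS; last by rewrite addrC.
  by field; rewrite !gt_eqF ?Gamma_gt0.
rewrite E ya ler_wpM2l ?(ltW (Zmom_gt0 s)) //.
have h : y * Gamma y <= (y + a) `^ (1 - a) * Gamma (y + a).
  have t01 : 0 <= 1 - a <= 1 by rewrite subr_ge0 (ltW a_lt1) lerBlDr lerDl ltW.
  have := Gamma_add_le ya0 t01.
  have -> : y + a + (1 - a) = y + 1 by ring.
  by rewrite GammaS.
rewrite ler_pdivrMr ?Gamma_gt0 //.
have -> : (s%:R + beta) * Gamma y = a^-1 * (y * Gamma y).
  by rewrite /y; field; rewrite gt_eqF.
by rewrite -[leRHS]mulrA ler_wpM2l // invr_ge0 ltW.
Qed.

Lemma Zmom_small l t : 0 <= t -> t ^+ I / I`!%:R * Zmom alpha beta (l + I) @[I --> \oo] --> 0.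
Proof.
move=> t0.
have f0 I : 0 < I`!%:R :> R by rewrite ltr0n fact_gt0.
apply: cvg_half_ratio => [I|].
  by apply: mulr_ge0; [rewrite divr_ge0 ?exprn_ge0 // ltW|exact: ltW (Zmom_gt0 _)].
(* Gives (beta + l + I + 1) a <= c (I + 1), so the ratio of consecutive terms is at most [kap] (I +
   1)^(- a), which tends to 0. *)
pose c := (beta + l%:R + 1) * a.
have c0 : 0 < c by rewrite mulr_gt0 // addr_gt0 // ltr_wpDr.
pose kap := t * a^-1 * c `^ (1 - a).
have kap0 : 0 <= kap by rewrite !mulr_ge0 ?powR_ge0 // invr_ge0 ltW.
have lim0 : kap * (I.+1%:R : R)^-1 `^ a @[I --> \oo] --> kap * 0.
  apply: cvgMl_tmp; have := invn_powR_cvg0 a_gt0.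
  by rewrite -(@cvg_shiftS _ (fun n => (n%:R : R)^-1 `^ a)).
rewrite mulr0 in lim0.
near=> I.
have N0 : 0 < I.+1%:R :> R by rewrite ltr0n.
have hk : kap * (I.+1%:R : R)^-1 `^ a <= 2^-1.
  by apply: ltW; near: I; apply: (cvgr_lt _ lim0); rewrite invr_gt0 ltr0n.
have hb : ((beta + (l + I).+1%:R) * a) `^ (1 - a) <= c `^ (1 - a) * I.+1%:R `^ (1 - a).
  rewrite -powRM ?(ltW c0) ?(ltW N0) //; apply: ge0_ler_powR.
  - by rewrite subr_ge0 ltW.
  - by rewrite nnegrE mulr_ge0 ?addr_ge0 ?ltW.
  - by rewrite nnegrE mulr_ge0 ?ltW.
  rewrite /c mulrAC ler_wpM2r ?(ltW a_gt0) // -addnS natrD !mulrDl mul1r addrA lerD2r.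
  by rewrite lerD // ler_peMr ?ler1n // ltW.
have pw : (I.+1%:R : R) `^ (1 - a) / I.+1%:R = I.+1%:R^-1 `^ a.
  rewrite powRB ?(gt_eqF N0) ?implybT // powRr1 ?(ltW N0) //.
  rewrite -[in RHS]powR_inv1 ?(ltW N0) // -powRrM mulN1r powRN.
  by field; rewrite !gt_eqF ?powR_gt0.
set W := c `^ (1 - a) * I.+1%:R `^ (1 - a) in hb.
pose Q := t ^+ I / I`!%:R * Zmom alpha beta (l + I).
have Q0 : 0 <= Q.
  by apply: mulr_ge0; [rewrite divr_ge0 ?exprn_ge0 // ltW|exact: ltW (Zmom_gt0 _)].
have z1 : Zmom alpha beta (l + I).+1 <= Zmom alpha beta (l + I) * (a^-1 * W).
  rewrite (le_trans (Zmom_ratio _)) // ler_wpM2l ?(ltW (Zmom_gt0 _)) //.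
  by rewrite ler_wpM2l // invr_ge0 ltW.
rewrite -/Q addnS exprS factS natrM.
have -> : t * t ^+ I / (I.+1%:R * I`!%:R) = t ^+ I / I`!%:R * (t / I.+1%:R).
  by rewrite invfM; ring.
have tN : 0 <= t ^+ I / I`!%:R * (t / I.+1%:R).
  by rewrite mulr_ge0 // divr_ge0 ?exprn_ge0 // ltW.
rewrite (le_trans (ler_wpM2l tN z1)) //.
have -> : t ^+ I / I`!%:R * (t / I.+1%:R) * (Zmom alpha beta (l + I) * (a^-1 * W))
   = Q * (kap * I.+1%:R^-1 `^ a).
  by rewrite -pw /Q /kap /W; ring.
by rewrite mulrC ler_wpM2r.
Unshelve. all: by end_near. Qed.

End MixingMoments.

Section TreeLimits.
Context {R : realType}.
Variables (alpha beta : R).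
Hypotheses (alpha0 : 0 < alpha) (beta0 : 0 < beta).
Implicit Types (j : nat -> nat) (n s k : nat).

(** Total mass is the factorial moment of order 0. *)
Lemma tree_dist_mass n : fexp (tree_dist alpha beta n) (fun=> 1) = 1.
Proof.
have := tree_factorial_moment n 0 alpha0 beta0 (isT : (0 < 1)%N).
rewrite /= mul0n ffactn0 expr0 {1}/rising big_ord0 !mul1r mul0r addr0 subn0 divff.
  by under fexp_ext do rewrite /ffact big_ord0.
by rewrite gt_eqF // rising_gt0 // mulr_gt0 // invr_gt0 addr_gt0.
Qed.

Lemma lambda_ge0 n k : (0 < k)%N -> 0 <= lambda alpha n k.
Proof.
move=> k0; case: n => [|n]; last by rewrite ltW // lambda_gt0.
rewrite lambdaE // powR0 ?mul0r //.
by rewrite gt_eqF // divr_gt0 // addr_gt0.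
Qed.

Lemma tree_is_expectation j n : (forall n, (1 <= j n)%N) ->
  is_expectation (fun f : R -> R => fexp (tree_dist alpha beta n)
    (fun t => f ((tree_X t (j n))%:R / lambda alpha n (j n)))).
Proof.
move=> j1; apply: fexp_is_expectation; last by move=> t; rewrite divr_ge0 // lambda_ge0.
- by move=> x; exact: tree_dist_ge0.
- exact: tree_dist_mass.
Qed.

Lemma tree_moment_cvg j s : (forall n, (1 <= j n)%N) ->
  lambda alpha n (j n) @[n --> \oo] --> +oo ->
  fexp (tree_dist alpha beta n) (fun t => ((tree_X t (j n))%:R / lambda alpha n (j n)) ^+ s)
    @[n --> \oo] --> Zmom alpha beta s.
Proof.
move=> j1 loo.
have jn : (j n)%:R / n%:R @[n --> \oo] --> (0 : R).
  by apply: (index_small alpha0 (c := 1)) => //; have /cvgryPge := loo; apply.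
have l0 : (lambda alpha n (j n))^-1 @[n --> \oo] --> (0 : R).
  apply/gtr0_cvgV0 => //; near=> n; apply: lambda_gt0 => //.
  by near: n; exact: nbhs_infty_gt.
have lX k : (lambda alpha n (j n))^-1 ^+ k @[n --> \oo] --> (0 : R) ^+ k.
  elim: k => [|k IH]; first exact: cvg_cst.
  by under eq_fun do rewrite exprS; rewrite exprS; exact: cvgM.
(* Powers are expanded in falling factorials. A term of order k < s keeps s - k spare factors 1 /
   lambda and vanishes; the term k = s has Stirling coefficient 1. *)
have -> : Zmom alpha beta s =
    \sum_(k < s.+1) (stirling2 s k)%:R * (Zmom alpha beta k * (0 : R) ^+ (s - k)).
  rewrite big_ord_recr /= stirling2_diag subnn expr0 mulr1 mul1r big1 ?add0r // => k _.
  by rewrite expr0n subn_eq0 leqNgt ltn_ord /= !mulr0.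
have c : \sum_(k < s.+1) (stirling2 s k)%:R *
   (fexp (tree_dist alpha beta n) (fun t => ffact (tree_X t (j n))%:R k) / lambda alpha n (j n) ^+ k
    * (lambda alpha n (j n))^-1 ^+ (s - k)) @[n --> \oo] -->
   \sum_(k < s.+1) (stirling2 s k)%:R * (Zmom alpha beta k * (0 : R) ^+ (s - k)).
  apply: cvg_sum_fin => k; apply: cvgMl_tmp; apply: cvgM; last exact: lX.
  exact: factorial_moment_cvg.
apply: cvg_trans c; apply: near_eq_cvg; near=> n.
have ln : 0 < lambda alpha n (j n) by apply: lambda_gt0 => //; near: n; exact: nbhs_infty_gt.
under [RHS]fexp_ext do rewrite exprMn exprn_ffact mulrC.
rewrite fexpZ fexp_sum mulr_sumr; apply: eq_bigr => k _.
have -> : (lambda alpha n (j n))^-1 ^+ s =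
    (lambda alpha n (j n))^-1 ^+ k * (lambda alpha n (j n))^-1 ^+ (s - k).
  by rewrite -exprD subnKC // -ltnS.
rewrite fexpZ -exprVn; ring.
Unshelve. all: by end_near. Qed.

(** The limits [rho ^+ k * Zmom k] are the factorial moments of the mixed Poisson law. Multiplied by
    rho^l / l!, the Taylor bound for exp(- rho x) becomes exactly the Bonferroni bound required of
    its probabilities. A general g covers bounded functions and powers alike. *)
Lemma mixed_poisson_cvg (P : probability R R) j (rho : R) (g : nat -> R) (C : R) s :
  is_expectation (mean_of P id) ->
  (forall k, mean_of P id (fun x => x ^+ k) = Zmom alpha beta k) ->
  0 < rho -> (forall n, (1 <= j n)%N) ->
  lambda alpha n (j n) @[n --> \oo] --> rho ->
  (forall l, `|g l| <= C * (1 + l%:R) ^+ s) ->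
  fexp (tree_dist alpha beta n) (fun t => g (tree_X t (j n))) @[n --> \oo] -->
  limn (fun N => \sum_(l < N)
    rho ^+ l / (l`!)%:R * mean_of P id (fun x => x ^+ l * expR (- (rho * x))) * g l).
Proof.
move=> hM mM rho0 j1 lrho hg.
have jn : (j n)%:R / n%:R @[n --> \oo] --> (0 : R).
  apply: (index_small alpha0 (c := rho / 2)) => //; first by rewrite divr_gt0.
  near=> n; apply: ltW; near: n; apply: (cvgr_gt _ lrho).
  by rewrite ltr_pdivrMr // ltr_pMr // ltr1n.
pose w k := rho ^+ k * Zmom alpha beta k.
have lX k : lambda alpha n (j n) ^+ k @[n --> \oo] --> rho ^+ k.
  elim: k => [|k IH]; first exact: cvg_cst.
  by under eq_fun do rewrite exprS; rewrite exprS; exact: cvgM.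
have w_cvg k : fexp (tree_dist alpha beta n) (fun t => ffact (tree_X t (j n))%:R k)
    @[n --> \oo] --> w k.
  have c : lambda alpha n (j n) ^+ k * (fexp (tree_dist alpha beta n)
      (fun t => ffact (tree_X t (j n))%:R k) / lambda alpha n (j n) ^+ k) @[n --> \oo] --> w k.
    by apply: cvgM; [exact: lX|exact: factorial_moment_cvg].
  apply: cvg_trans c; apply: near_eq_cvg; near=> n.
  have ln : 0 < lambda alpha n (j n) by apply: lambda_gt0 => //; near: n; exact: nbhs_infty_gt.
  by rewrite /= mulrC divfK // expf_neq0 // gt_eqF.
have w_small l : w (l + I)%N / I`!%:R @[I --> \oo] --> 0.
  have c : rho ^+ l * (rho ^+ I / I`!%:R * Zmom alpha beta (l + I)) @[I --> \oo] --> rho ^+ l * 0.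
    by apply: cvgMl_tmp; apply: Zmom_small => //; exact: ltW.
  rewrite mulr0 in c; apply: cvg_trans c; apply: near_eq_cvg; apply: nearW => I.
  by rewrite /w exprD; ring.
have d0 n x : x \in tree_dist alpha beta n -> 0 <= x.2 by exact: tree_dist_ge0.
pose p l := rho ^+ l / (l`!)%:R * mean_of P id (fun x => x ^+ l * expR (- (rho * x))).
apply: (@natural_limit _ _ _ (fun n t => tree_X t (j n)) w d0 w_cvg p g C s _ hg) => l.
apply: (@natural_pmf_cvg _ _ _ (fun n t => tree_X t (j n)) w d0 w_cvg w_small) => I.
have f0 k : 0 < k`!%:R :> R by rewrite ltr0n fact_gt0.
have r0 : 0 <= rho ^+ l / l`!%:R by rewrite divr_ge0 ?exprn_ge0 // ltW.
have := ler_wpM2l r0 (expectation_taylor hM l I (ltW rho0)).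
rewrite mM -[X in X * `|_|](ger0_norm r0) -normrM mulrBr mulr_sumr.
have -> : rho ^+ l / l`!%:R * (rho ^+ I / I`!%:R * Zmom alpha beta (l + I)) = w (l + I)%N / (l`!%:R * I`!%:R).
  by rewrite /w exprD invfM; ring.
congr (`|_ - _| <= _); apply: eq_bigr => i _.
by rewrite mM /w exprD invfM [(- rho) ^+ i]exprNn; ring.
Unshelve. all: by end_near. Qed.

End TreeLimits.

Theorem theorem1 (R : realType) (alpha beta : R) (halpha : 0 < alpha) (hbeta : 0 < beta) :
  let a := 1 / (1 + alpha) in
  let theta := beta / (1 + alpha) in
  (* equality in distribution of C_{n,j} and X_{n+1,j} *)
  (forall n j m : nat, (1 <= n)%N -> (1 <= j)%N ->
     fprob (crp a theta n) (fun p => crp_C p j == m)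
     = fprob (tree_dist alpha beta n) (fun t => tree_X t j == m))
  /\
  (* asymptotics of the factorial moments (j = j_n, j_n = o(n)) *)
  (forall (j : nat -> nat) (s : nat), (forall n, (1 <= j n)%N) ->
     (fun n => (j n)%:R / n%:R) @ \oo --> (0 : R) ->
     (1 <= s)%N ->
     (fun n => fexp (tree_dist alpha beta n) (fun t => ffact (tree_X t (j n))%:R s)
               / ((lambda alpha n (j n)) ^+ s * Zmom alpha beta s)) @ \oo --> (1 : R))
  /\
  (* the mixing distribution Z and the limit laws *)
  exists mu : probability R R,
    mu `[0%R, +oo[%classic = 1%E /\
    (forall s : nat, mu.-integrable setT (fun x => (x ^+ s)%:E) /\
                     (\int[mu]_x (x ^+ s)%:E = (Zmom alpha beta s)%:E)%E) /\
    (* (i) *)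
    (forall j : nat -> nat, (forall n, (1 <= j n)%N) ->
       (fun n => lambda alpha n (j n)) @ \oo --> +oo ->
       (forall f : R -> R, continuous f -> (exists M : R, forall x, `|f x| <= M) ->
          (fun n => fexp (tree_dist alpha beta n)
                      (fun t => f ((tree_X t (j n))%:R / lambda alpha n (j n))))
            @ \oo --> fine (\int[mu]_x (f x)%:E)) /\
       (forall s : nat,
          (fun n => fexp (tree_dist alpha beta n)
                      (fun t => ((tree_X t (j n))%:R / lambda alpha n (j n)) ^+ s))
            @ \oo --> Zmom alpha beta s)) /\
    (* (ii) *)
    (forall (j : nat -> nat) (rho : R), 0 < rho -> (forall n, (1 <= j n)%N) ->
       (fun n => lambda alpha n (j n)) @ \oo --> rho ->
       let pY := fun l : nat =>
         rho ^+ l / (l`!)%:R * fine (\int[mu]_x (x ^+ l * expR (- (rho * x)))%:E) in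
       (forall f : R -> R, continuous f -> (exists M : R, forall x, `|f x| <= M) ->
          (fun n => fexp (tree_dist alpha beta n) (fun t => f (tree_X t (j n))%:R))
            @ \oo --> limn (fun N => \sum_(l < N) (pY l * f l%:R))) /\
       (forall s : nat,
          (fun n => fexp (tree_dist alpha beta n) (fun t => (tree_X t (j n))%:R ^+ s))
            @ \oo --> limn (fun N => \sum_(l < N) (pY l * l%:R ^+ s)))).
Proof.
move=> a theta; split; first by move=> n j m n1 _; exact: crp_tree_eq.
split.
  move=> j s j1 jn _.
  have Z0 : Zmom alpha beta s != 0 by rewrite gt_eqF // Zmom_gt0.
  under eq_fun do rewrite invfM mulrA.
  have : fexp (tree_dist alpha beta n) (fun t => ffact (tree_X t (j n))%:R s)
      / lambda alpha n (j n) ^+ s * (Zmom alpha beta s)^-1 @[n --> \oo]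
      --> Zmom alpha beta s / Zmom alpha beta s.
    by apply: cvgMr_tmp; exact: factorial_moment_cvg.
  by rewrite divff.
(* Any fixed size would do: its lambda tends to infinity and the limit moments do not depend on
   it. *)
pose j0 := fun _ : nat => 1%N.
have j01 n : (1 <= j0 n)%N by [].
have l0 : lambda alpha n (j0 n) @[n --> \oo] --> +oo by exact: lambda_cvgy.
have [P [PD iP mP]] := law_of_moments (fun n => tree_is_expectation halpha hbeta n j01)
  (fun s => tree_moment_cvg halpha hbeta (s := s) j01 l0).
have hM : is_expectation (mean_of P id) by apply: mean_is_expectation.
have mM s : mean_of P id (fun x => x ^+ s) = Zmom alpha beta s by rewrite /mean_of /= mP.
exists P; split => //; split.
  by move=> s; split; [exact: (iP _ (moderateX s))|exact: mP].
split.
  move=> j j1 loo; split; last by move=> s; exact: tree_moment_cvg.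
  move=> f cf [M fM].
  exact: (moment_method (fun n => tree_is_expectation halpha hbeta n j1) hM
    (fun s => tree_moment_cvg halpha hbeta (s := s) j1 loo) mM
    (fun l t t0 => Zmom_small halpha hbeta l t0) cf fM).
move=> j rho rho0 j1 lrho pY; split.
  move=> f cf [M fM].
  have bd l : `|f l%:R| <= M * (1 + l%:R) ^+ 0 by rewrite expr0 mulr1.
  exact: (mixed_poisson_cvg halpha hbeta hM mM rho0 j1 lrho (g := fun l => f l%:R) bd).
move=> s.
have bd l : `|(l%:R : R) ^+ s| <= 1 * (1 + l%:R) ^+ s.
  by rewrite mul1r ger0_norm ?exprn_ge0 // lerXn2r ?nnegrE ?addr_ge0 // lerDr.
exact: (mixed_poisson_cvg halpha hbeta hM mM rho0 j1 lrho (g := fun l => l%:R ^+ s) bd).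
Qed.
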